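(* Let $q\ge 4$ be a prime power. Let $B$ be a minimal blocking set with respect to the lines of the hyperbolic quadric $Q^+(5,q)$ in $\mathrm{PG}(5,q)$. If $|B|\le q^3+2q^2+q+1$, then $B$ is contained in a hyperplane section of $Q^+(5,q)$, i.e. there is a hyperplane $H$ of $\mathrm{PG}(5,q)$ with $B\subseteq H\cap Q^+(5,q)$.
   Context: $Q^+(5,q)$ is the hyperbolic (Klein) quadric in $\mathrm{PG}(5,q)$: up to a change of coordinates, the set of points on which the quadratic form $x_0x_1+x_2x_3+x_4x_5$ vanishes. A blocking set of $Q^+(5,q)$ with respect to lines is a set $B$ of points of $Q^+(5,q)$ that intersects every line of $\mathrm{PG}(5,q)$ contained in $Q^+(5,q)$. It is minimal if none of its proper subsets is a blocking set with respect to lines. *)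

(* Defs.v *)
From HB Require Import structures.
From mathcomp Require Import all_boot all_order all_algebra.

Set Implicit Arguments.
Unset Strict Implicit.
Unset Printing Implicit Defensive.

Import GRing.Theory.
Local Open Scope ring_scope.

(* A subspace is stored as a square matrix, so that a finite vector space has *)
(* finitely many subspaces; the library does not declare the instance.        *)
Section FiniteSubspaces.
Import VectorInternalTheory.

HB.instance Definition _ (F : finFieldType) (V : vectType F) :=
  [Finite of {vspace V} by <:].

End FiniteSubspaces.

(* PG(5,q), with q = #|F|, is the lattice of subspaces of F^6: its points,    *)
(* lines and hyperplanes are the subspaces of vector-space dimension 1, 2, 5. *)
Section KleinQuadric.
Variable F : finFieldType.
Implicit Types (P L : {vspace 'rV[F]_6}) (Q B : {set {vspace 'rV[F]_6}}).

Definition klein_form (x : 'rV[F]_6) : F :=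
  x 0 (inord 0) * x 0 (inord 1) +
  x 0 (inord 2) * x 0 (inord 3) +
  x 0 (inord 4) * x 0 (inord 5).

(* The invertible matrix g is the change of coordinates.                      *)
Definition is_klein_quadric Q : Prop :=
  exists2 g : 'M[F]_6, g \in unitmx &
    Q = [set P : {vspace 'rV[F]_6} |
          (\dim P == 1%N) &&
          [forall x : 'rV[F]_6, (x \in P) ==> (klein_form (x *m g) == 0)]].

Definition line_contained_in Q L : bool :=
  (\dim L == 2%N) &&
  [forall P, ((\dim P == 1%N) && (P <= L)%VS) ==> (P \in Q)].

Definition line_blocking_set Q B : bool :=
  (B \subset Q) &&
  [forall L, line_contained_in Q L ==> [exists P in B, (P <= L)%VS]].

End KleinQuadric.

(* Main.v *)
(** Under the Klein correspondence the points of the quadric are the lines of PG(3,q), and the lines of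
    the quadric are the pencils (P, pi), P a point of the plane pi.  So [B] becomes a set BB of at most
    q^3 + 2 q^2 + q + 1 lines meeting every pencil, and hyperplane sections are the sets of isotropic
    lines of alternating forms.

    Every point or plane contains at least q + 1 lines of BB; call the surplus its excess.  By averaging
    there is a plane rho of excess 0, its lines in BB form the pencil at a point O, and the excesses of
    the points of rho sum to at most q^2.  If a line l of rho off O is clean (the excesses of its points
    sum to at most 2 q - 3), then BB contains all transversals of l and of some line through O skew to l.
    Three clean lines forming a triangle determine an alternating form a on F^4, and a propagates: if P is
    a point of rho other than O of excess at most q - 2, then all isotropic lines on P are in BB.  At most
    q + 1 points of rho escape this.

    Suppose an isotropic line z with a point outside the radical of a is not in BB.  Each pencil (Q, tau)
    with Q on z, z in tau and tau not the polar plane of Q must then contain a non-isotropic line of BB.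
    These lines are numerous, whereas BB has at most q^2 + m non-isotropic lines, m being the number of
    missing isotropic lines (at most m when a is degenerate); counting gives a contradiction.  Hence the
    isotropic lines of BB already meet every pencil, and minimality of [B] concludes. *)
Require Import Defs.
From HB Require Import structures.
From mathcomp Require Import all_boot all_order all_algebra finfield zify ring.

Set Implicit Arguments.
Unset Strict Implicit.
Unset Printing Implicit Defensive.
Import GRing.Theory.

(** * Blocking sets of incidence structures with unique joins *)

(** The bound on |B| is the number of lines of PG(3,q) that meet a fixed line, that is, of isotropic
    lines of a degenerate form; a nondegenerate form has q^2 fewer. The degenerate case therefore
    has no slack at all, and the two cases need separate counts at the end. The obstacle is that
    excess may be concentrated: the total q^2 on rho may sit on a single point, so nothing can be
    asserted of every point, and the form has to be built from places of small excess. Three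
    thresholds recur. Excess at most 1 forces a full pencil. Excess below q makes the plane of a
    full pencil on a point unique, as two pencils would use 2 q + 1 lines. The value 2 q - 3 for a
    line is the most that the grid argument [no_missing_cell] tolerates, while the q^2 lines of rho
    off O have average at most q, so that clean lines exist as soon as 2 (q - 1)^2 > q^2, that is, q
    >= 4. *)

Lemma card_filter_sum (T : finType) (A : {set T}) (P : pred T) :
  #|[set x in A | P x]| = \sum_(x in A) P x.
Proof.
rewrite -sum1_card big_mkcond [RHS]big_mkcond; apply: eq_bigr => x _.
by rewrite inE; case: (x \in A) => //=; case: (P x).
Qed.

Lemma exchange_card (T U : finType) (A : {set T}) (C : {set U}) (I : T -> U -> bool) :
  \sum_(a in A) #|[set c in C | I a c]| = \sum_(c in C) #|[set a in A | I a c]|.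
Proof.
under eq_bigr do rewrite card_filter_sum.
by rewrite exchange_big; apply: eq_bigr => c _; rewrite card_filter_sum.
Qed.

Lemma sum_le_const (T : finType) (A : {set T}) (f : T -> nat) k :
  (forall x, x \in A -> f x <= k) -> \sum_(x in A) f x <= k * #|A|.
Proof.
by move=> h; rewrite mulnC -sum_nat_const; apply: leq_sum => x xA; apply: h.
Qed.

Lemma sum_ge_const (T : finType) (A : {set T}) (f : T -> nat) k :
  (forall x, x \in A -> k <= f x) -> k * #|A| <= \sum_(x in A) f x.
Proof.
by move=> h; rewrite mulnC -sum_nat_const; apply: leq_sum => x xA; apply: h.
Qed.

Section BlockingSets.
Variables (T U : finType) (A S : {set T}) (C : {set U}) (I : T -> U -> bool).
Variable q : nat.
Hypothesis deg : forall a, a \in A -> #|[set c in C | I a c]| = q.+1.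
Hypothesis join : forall a b, a \in A -> b \in A -> a != b ->
  #|[set c in C | I a c && I b c]| = 1.
Hypothesis SA : S \subset A.
Hypothesis blk : forall c, c \in C -> 0 < #|[set s in S | I s c]|.

(** Each element of [S] shares exactly one constraint with [a], so the constraints through [a]
    partition [S]. *)
Lemma sum_through a : a \in A -> a \notin S ->
  \sum_(c in [set c in C | I a c]) #|[set s in S | I s c]| = #|S|.
Proof.
move=> aA aS; rewrite -exchange_card -sum1_card; apply: eq_bigr => s sS.
have sA := subsetP SA _ sS; have ne : a != s by apply: contraNneq aS => ->.
by rewrite -(join aA sA ne); apply: eq_card => c; rewrite !inE andbA.
Qed.

Lemma sum_through_in a : a \in S ->
  \sum_(c in [set c in C | I a c]) #|[set s in S | I s c]| = #|S| + q.
Proof.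
move=> aS; have aA := subsetP SA _ aS.
rewrite -exchange_card (bigD1 a) //= (cardsD1 a S) aS.
have -> : #|[set c in [set c in C | I a c] | I a c]| = q.+1.
  by rewrite -(deg aA); apply: eq_card => c; rewrite !inE -andbA andbb.
rewrite (eq_bigr (fun=> 1)) => [|s /andP[sS ne]].
  by rewrite sum1_card -cardsE (_ : [set _ | _] = S :\ a) 1?addnC ?addnA ?addn1 //;
    [rewrite addnC; lia | apply/setP => x; rewrite !inE andbC].
have sA := subsetP SA _ sS.
by rewrite -(join aA sA) 1?eq_sym //; apply: eq_card => c; rewrite !inE andbA.
Qed.

(** The other [q] constraints through [a] each contain an element of [S], and by [sum_through] none
    of these is counted twice. *)
Lemma le_missing a c : a \in A -> a \notin S -> c \in C -> I a c ->
  #|[set s in S | I s c]| + q <= #|S|.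
Proof.
move=> aA aS cC ac; rewrite -(sum_through aA aS) (bigD1 c) ?inE ?cC //= leq_add2l.
have <- : #|[set c in C | I a c] :\ c| = q.
  by have := deg aA; rewrite (cardsD1 c) !inE cC ac => -[].
rewrite -sum1_card [leqLHS](eq_bigl (fun i => (i \in [set c in C | I a c]) && (i != c))).
  by apply: leq_sum => d /andP[]; rewrite inE => /andP[dC _] _; apply: blk.
by move=> i; rewrite in_setD1 andbC.
Qed.

Lemma le_missing2 a c d : a \in A -> a \notin S -> c \in C -> I a c ->
  d \in C -> I a d -> c != d ->
  #|[set s in S | I s c]| + #|[set s in S | I s d]| + q.-1 <= #|S|.
Proof.
move=> aA aS cC ac dC ad cd.
rewrite -(sum_through aA aS) (bigD1 c) ?inE ?cC //= (bigD1 d) /=; last first.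
  by rewrite inE dC ad eq_sym.
rewrite addnA leq_add2l.
have <- : #|[set c in C | I a c] :\ c :\ d| = q.-1.
  have := deg aA; rewrite (cardsD1 c) !inE cC ac => -[].
  by rewrite (cardsD1 d) !inE dC ad eq_sym cd => <-.
rewrite -sum1_card [leqLHS](eq_bigl
    (fun i => (i \in [set c in C | I a c]) && (i != c) && (i != d))).
  by apply: leq_sum => e; rewrite inE => /andP[/andP[/andP[eC _] _] _]; apply: blk.
by move=> i; rewrite 2!in_setD1 andbC; congr (_ && _); rewrite andbC.
Qed.

Lemma blocking_card c : c \in C -> #|[set a in A | I a c]| = q.+1 -> q < #|S|.
Proof.
move=> cC hc; have [sub|/subsetPn[a]] := boolP ([set a in A | I a c] \subset S).
  by rewrite -hc; apply: subset_leq_card.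
rewrite inE => /andP[aA ac] aS.
by have := le_missing aA aS cC ac; have := blk cC; lia.
Qed.

(* If no constraint is full, every constraint meets S in at most two elements, hence (looking
   from an element of S) in exactly two, which contradicts [sum_through]. *)
Lemma small_blocking_full : 0 < q -> q < #|S| -> #|S| <= q.+2 ->
  exists2 c, c \in C & forall a, a \in A -> I a c -> a \in S.
Proof.
move=> q0 Sgt Sle.
have [/exists_inP[c cC /subsetP sub]|nofull] :=
  boolP [exists c in C, [set a in A | I a c] \subset S].
  by exists c => // a aA ac; apply: sub; rewrite inE aA.
have miss c : c \in C -> exists a, [/\ a \in A, I a c & a \notin S].
  move=> cC; move/exists_inPn: nofull => /(_ c cC) /subsetPn[a].
  by rewrite inE => /andP[]; exists a.
have le2 c : c \in C -> #|[set s in S | I s c]| <= 2.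
  move=> cC; have [a [aA ac aS]] := miss c cC.
  by have := le_missing aA aS cC ac; lia.
have [s sS] : exists s, s \in S by apply/set0Pn; rewrite -card_gt0; lia.
have [t] : exists t, t \in S :\ s.
  by apply/set0Pn; rewrite -card_gt0; have := cardsD1 s S; rewrite sS; lia.
rewrite !inE => /andP[ts tS].
have := join (subsetP SA _ sS) (subsetP SA _ tS); rewrite eq_sym ts => /(_ isT) st1.
have [c] : exists c, c \in [set c in C | I s c && I t c].
  by apply/set0Pn; rewrite -card_gt0 st1.
rewrite inE => /and3P[cC sc tc].
have two : 1 < #|[set s in S | I s c]|.
  by apply/card_gt1P; exists s, t; rewrite !inE sS tS sc tc eq_sym.
have [a [aA ac aS]] := miss c cC.
have Sq : #|S| = q.+2.
  apply/eqP; rewrite eqn_leq Sle /= -add2n; apply: leq_trans (le_missing aA aS cC ac).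
  by rewrite leq_add2r.
have eq2 d : d \in C -> #|[set s in S | I s d]| = 2.
  move=> dC; have [u] : exists u, u \in [set s in S | I s d].
    by apply/set0Pn; rewrite -card_gt0 blk.
  rewrite inE => /andP[uS ud].
  have := sum_through_in uS; have uA := subsetP SA _ uS.
  rewrite (bigD1 d) ?inE ?dC //= => h.
  have := deg uA; rewrite (cardsD1 d) !inE dC ud => -[hq].
  have : \sum_(i in [set c in C | I u c] | i != d) #|[set s in S | I s i]| <= 2 * q.
    rewrite -hq mulnC -sum_nat_const.
    rewrite [leqRHS](eq_bigl (fun i => (i \in [set c in C | I u c]) && (i != d))).
      by apply: leq_sum => e; rewrite inE => /andP[/andP[eC _] _]; apply: le2.
    by move=> i; rewrite in_setD1 andbC.
  move: h (le2 d dC); rewrite Sq; clear; lia.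
have := sum_through aA aS.
rewrite (eq_bigr (fun=> 2)) => [|e]; last by rewrite inE => /andP[eC _]; apply: eq2.
rewrite sum_nat_const deg // Sq; move: q0; clear; lia.
Qed.

End BlockingSets.

Lemma sum_sub_le (T : finType) (A B : {set T}) (f : T -> nat) :
  A \subset B -> \sum_(x in A) f x <= \sum_(x in B) f x.
Proof.
move=> sub; rewrite [leqRHS](bigID (mem A)) /= (eq_bigl (fun x => (x \in B) && (x \in A))).
  exact: leq_addr.
by move=> x; case xA: (x \in A); rewrite ?andbF // (subsetP sub).
Qed.

Lemma sum_setID (T : finType) (A B : {set T}) (f : T -> nat) : A \subset B ->
  \sum_(x in B) f x = \sum_(x in A) f x + \sum_(x in B :\: A) f x.
Proof.
move=> sub; rewrite (bigID (mem A)) /=; congr (_ + _); apply: eq_bigl => x.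
  by case xA: (x \in A); rewrite ?andbF // (subsetP sub).
by rewrite in_setD andbC.
Qed.

Lemma card_le_inj (T U : finType) (A : {set T}) (S : {set U}) (m : pred T) (f : T -> U) :
  {in A &, injective f} -> (forall a, a \in A -> ~~ m a -> f a \in S) ->
  #|A| <= #|S| + #|[set a in A | m a]|.
Proof.
move=> inj h; rewrite -(cardsID [set a | m a] A) addnC; apply: leq_add; last first.
  by apply: subset_leq_card; apply/subsetP => x; rewrite !inE.
have : {in A :\: [set a | m a] &, injective f}.
  by move=> x y /setDP[xA _] /setDP[yA _]; apply: inj.
move/card_in_imset <-; apply: subset_leq_card; apply/subsetP => _ /imsetP[a + ->].
by rewrite !inE => /andP[na aA]; apply: h.
Qed.

(** * A grid of points and planes on a line, with few missing cells *)

Section Cells.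
Variables (T U : finType) (A : {set T}) (C : {set U}).
Variables (w : T -> U -> nat) (miss : T -> U -> bool) (eA : T -> nat) (eC : U -> nat).
Variables (q X : nat).
Hypothesis q4 : 4 <= q.
Hypothesis cC : #|C| = q.+1.
Hypothesis col : forall a, a \in A -> \sum_(c in C) w a c = q.+1 + eA a.
Hypothesis w_le : forall a c, a \in A -> c \in C -> w a c <= (eC c).+1.
Hypothesis XA : \sum_(a in A) eA a = X.
Hypothesis XC : \sum_(c in C) eC c = X.
Hypothesis Xle : X + 3 <= 2 * q.
Hypothesis row_miss : forall a c, a \in A -> c \in C -> miss a c ->
  q <= eC c + #|[set a in A | miss a c]|.
Hypothesis col_miss : forall a c, a \in A -> c \in C -> miss a c ->
  q <= eA a + #|[set c in C | miss a c]|.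
Hypothesis cell_miss : forall a c, a \in A -> c \in C -> miss a c ->
  w a c + q <= eA a + #|[set c in C | miss a c]| + 1.
Let bad_cols := [set a in A | [exists c in C, miss a c]].
Let bad_rows := [set c in C | [exists a in A, miss a c]].
Hypothesis few_bad : #|bad_cols| + 2 <= q.

(** This is the origin of the bound 2q - 3: (g + 1)(q - g) is concave in g and equals 2q - 2 at both
    ends g = 1 and g = q - 2, so f > g would make f (q - g) at least 2q - 2. *)
Let arith f g : 0 < g -> g + 2 <= q -> f * (q - g) + 3 <= 2 * q -> f <= g.
Proof.
move=> g0 gq h; rewrite leqNgt; apply/negP => fg.
have : g.+1 * (q - g) <= f * (q - g) by rewrite leq_mul2r fg orbT.
have : exists k, q = g + 2 + k;
  [by exists (q - (g + 2)); move: gq; clear; lia | case=> k qk; move: h g0 fg; rewrite qk; clear].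
rewrite (_ : g + 2 + k - g = k + 2); last by lia.
move=> h g0 fg h2; have kg : k <= k * g by rewrite leq_pmulr.
move: h2; rewrite mulSn mulnDr [g * k]mulnC; move: h kg; move: (k * g) (f * (k + 2)); lia.
Qed.

(** Let f and g count the bad rows and columns. A bad row has excess at least q - g and a bad column
    at least q - f, so f (q - g) and g (q - f) are at most X, and [arith] used twice gives f = g. A
    suitable bad column then misses every bad row; [cell_miss] makes its weights there small, its
    weights elsewhere are limited by the excess that the bad rows leave over, and together they do
    not reach the column sum. *)
Lemma no_missing_cell a c : a \in A -> c \in C -> ~~ miss a c.
Proof.
move=> aA cC'; apply/negP => mac.
set g := #|bad_cols|; set f := #|bad_rows|; have gq : g + 2 <= q := few_bad.
have g0 : 0 < g.
  by apply/card_gt0P; exists a; rewrite inE aA; apply/exists_inP; exists c.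
have f0 : 0 < f.
  by apply/card_gt0P; exists c; rewrite inE cC'; apply/exists_inP; exists a.
have eC_ge d : d \in bad_rows -> q - g <= eC d.
  rewrite inE => /andP[dC /exists_inP[b bA mbd]]; have := row_miss bA dC mbd.
  have : #|[set a in A | miss a d]| <= g.
    apply: subset_leq_card; apply/subsetP => z; rewrite !inE => /andP[-> mz] /=.
    by apply/exists_inP; exists d.
  lia.
have missf b : #|[set c in C | miss b c]| <= f \/ b \notin A.
  have [bA|] := boolP (b \in A); [left | by right].
  apply: subset_leq_card; apply/subsetP => z; rewrite !inE => /andP[-> mz] /=.
  by apply/exists_inP; exists b.
have eA_ge b : b \in bad_cols -> q - f <= eA b.
  rewrite inE => /andP[bA /exists_inP[d dC mbd]]; have := col_miss bA dC mbd.
  by case: (missf b) => [|/negP//]; lia.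
have sC : bad_rows \subset C by apply/subsetP => z; rewrite inE => /andP[].
have sA : bad_cols \subset A by apply/subsetP => z; rewrite inE => /andP[].
have fX : f * (q - g) <= X.
  by rewrite -XC mulnC; apply: leq_trans (sum_sub_le _ sC); apply: sum_ge_const.
have gX : g * (q - f) <= X.
  by rewrite -XA mulnC; apply: leq_trans (sum_sub_le _ sA); apply: sum_ge_const.
have fg : f <= g by apply: arith g0 gq _; move: fX Xle; clear; lia.
have gf : g <= f.
  by apply: arith f0 _ _; [move: fg gq; clear; lia | move: gX Xle; clear; lia].
have {fg gf} gf : g = f by apply/eqP; rewrite eqn_leq fg gf.
rewrite gf in gq eC_ge fX gX g0.
have [k qk] : exists k, q = f + 2 + k by exists (q - (f + 2)); move: gq; clear; lia.
(* Were f > 1 and every bad column of excess above q - f, the total would be at least f (q - f + 1),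
   which exceeds 2q - 3. *)
have [b bG hb] : exists2 b, b \in bad_cols & f = 1 \/ eA b <= q - f.
  have [/exists_inP[b bG hb]|/exists_inPn none] := boolP [exists b in bad_cols, eA b <= q - f].
    by exists b; rewrite //; right.
  exists a; first by rewrite inE aA; apply/exists_inP; exists c.
  left; have : (q - f).+1 * g <= X.
    rewrite -XA; apply: leq_trans (sum_sub_le _ sA); apply: sum_ge_const => b bG.
    by rewrite ltnNge none.
  rewrite gf (_ : (q - f).+1 = k + 3); last by move: qk; clear; lia.
  move: Xle q4 f0; rewrite qk mulnDl; clear; case: (f) => [|[|j]] // Xle q4 _ h.
  by move: Xle q4 h; rewrite !mulnS; move: (k * j) => z; lia.
have := eA_ge b bG; move: bG; rewrite inE => /andP[bA /exists_inP[d dC mbd]] eb.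
set u := #|[set c in C | miss b c]|.
have uf : u = f.
  have := col_miss bA dC mbd; rewrite -/u; case: (missf b) => [|/negP//]; rewrite -/u.
  case: hb => [f1|]; last by move: gq; clear; lia.
  have : 0 < u by apply/card_gt0P; exists d; rewrite inE dC.
  by move: f1; clear; lia.
have missE : [set c in C | miss b c] = bad_rows.
  apply/eqP; rewrite eqEcard; apply/andP; split; last by rewrite -/f -uf.
  by apply/subsetP => z; rewrite !inE => /andP[-> mz] /=; apply/exists_inP; exists b.
have s1 : \sum_(c in bad_rows) w b c + f * q <= (eA b + f + 1) * f.
  rewrite -sum_nat_const -big_split; apply: sum_le_const => z; rewrite -missE inE => /andP[zC mz].
  by have := cell_miss bA zC mz; rewrite -/u uf.
have s2 : \sum_(c in C :\: bad_rows) w b c <= \sum_(c in C :\: bad_rows) eC c + (q.+1 - f).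
  have -> : q.+1 - f = #|C :\: bad_rows| by rewrite cardsD (setIidPr sC) cC.
  rewrite -sum1_card -big_split; apply: leq_sum => z; rewrite inE => /andP[_ zC].
  by rewrite /= addn1; apply: w_le.
have s3 : (q - f) * f + \sum_(c in C :\: bad_rows) eC c <= X.
  by rewrite -XC (sum_setID _ sC) leq_add2r; apply: sum_ge_const.
have := col bA; rewrite (sum_setID _ sC).
move: s1 s2 s3 hb eb; move: (\sum_(c in bad_rows) w b c) (\sum_(c in _) w b c) (\sum_(c in _) eC c).
move: (eA b) Xle q4 f0; rewrite qk; clear; move: f => f e.
have -> : f + 2 + k - f = k + 2 by lia.
have -> : (f + 2 + k).+1 - f = k + 3 by lia.
move=> Xle q4 f0 S1 S2 E s1 s2 s3 [f1|he] eb s4.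
  by subst f; lia.
have {he eb} ee : e = k + 2 by apply/eqP; rewrite eqn_leq he eb.
subst e; have kf : k <= k * f by rewrite leq_pmulr.
move: s1 s3; rewrite !mulnDl !mulnDr mul1n [f * k]mulnC => s1 s3; move: s1 s2 s3 s4 Xle kf.
by move: (k * f) (f * f) => y z; clear; lia.
Qed.
End Cells.

(** * Subspaces of a four-dimensional space *)

Section Dimensions.
Variables (K : fieldType) (vT : vectType K).
Implicit Types U W Z P : {vspace vT}.

Lemma dim1_cap P U : \dim P = 1 -> ~~ (P <= U)%VS -> \dim (P :&: U) = 0.
Proof.
move=> dP nPU; have := dimvS (capvSl P U); rewrite dP.
case E: (\dim _) => [|[|d]] // _; case/negP: nPU; apply/capv_idPl/eqP.
by rewrite eqEdim capvSl dP E.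
Qed.

Lemma dim_add1 P U : \dim P = 1 -> ~~ (P <= U)%VS -> \dim (P + U) = (\dim U).+1.
Proof. by move=> dP nPU; have := dimv_sum_cap P U; rewrite (dim1_cap dP nPU) dP; lia. Qed.

Lemma vs_eq U W : (U <= W)%VS -> \dim W <= \dim U -> U = W.
Proof. by move=> s d; apply/eqP; rewrite eqEdim s. Qed.

Lemma dim_cap_ge U W Z : (U <= Z)%VS -> (W <= Z)%VS ->
  \dim U + \dim W <= \dim Z + \dim (U :&: W).
Proof.
move=> uz wz; rewrite -dimv_sum_cap leq_add2r; apply: dimvS.
by rewrite subv_add uz.
Qed.

Lemma dim_cap_lt U W : ~~ (U <= W)%VS -> \dim (U :&: W) < \dim U.
Proof.
apply: contraR; rewrite -leqNgt => le; apply/capv_idPl/eqP.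
by rewrite eqEdim capvSl.
Qed.

Lemma vs_neq_sub U W : \dim U = \dim W -> U != W -> ~~ (U <= W)%VS.
Proof. by move=> d; apply: contra => s; apply/eqP/vs_eq => //; rewrite d. Qed.

Lemma dim1E P : \dim P = 1 -> exists2 x, x != 0%R & P = <[x]>%VS.
Proof.
move=> dP; have ne : vpick P != 0%R by rewrite vpick0 -dimv_eq0 dP.
exists (vpick P) => //; apply/esym/vs_eq; first by rewrite -memvE memv_pick.
by rewrite dim_vline ne dP.
Qed.

Lemma exists_point_in U : 0 < \dim U -> exists2 Z, \dim Z = 1 & (Z <= U)%VS.
Proof.
move=> dU; exists <[vpick U]>%VS; last by rewrite -memvE memv_pick.
by rewrite dim_vline vpick0 -dimv_eq0 -lt0n dU.
Qed.

Lemma line_through (n : {vspace vT}) x : \dim n = 2 -> x != 0%R -> x \in n ->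
  exists y, n = (<[x]> + <[y]>)%VS.
Proof.
move=> dn x0 xn; have dx : \dim <[x]> = 1 by rewrite dim_vline x0.
have /subvPn[y yn yx] : ~~ (n <= <[x]>)%VS by apply/negP => /dimvS; rewrite dn dx.
have y0 : y != 0%R by apply: contraNneq yx => ->; apply: mem0v.
exists y; apply/esym/vs_eq; first by rewrite subv_add -!memvE xn.
by rewrite dn addvC dim_add1 ?dx // ?dim_vline ?y0 // -memvE.
Qed.

Lemma line_span (n : {vspace vT}) : \dim n = 2 -> exists x y, n = (<[x]> + <[y]>)%VS.
Proof.
move=> dn; have n0 : vpick n != 0%R by rewrite vpick0 -dimv_eq0 dn.
by have [y E] := line_through dn n0 (memv_pick n); exists (vpick n), y.
Qed.

Lemma span2_free (x y : vT) : \dim (<[x]> + <[y]>) = 2 -> x != 0%R /\ y \notin <[x]>%VS.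
Proof.
have le (z : vT) : (<[x]> + <[y]> <= <[z]>)%VS -> \dim (<[x]> + <[y]>) <> 2.
  by move=> /dimvS le d; move: le; rewrite d dim_vline; case: (z != 0%R).
move=> d; split; apply/negP.
  by move=> /eqP x0; apply: (le y) d; rewrite subv_add -!memvE x0 mem0v memv_line.
by move=> yx; apply: (le x) d; rewrite subv_add -!memvE yx memv_line.
Qed.

End Dimensions.

Section Geometry.
Variable F : finFieldType.
Notation V := 'rV[F]_4.
Notation T := {vspace V}.
Implicit Types A C U P R O l m n pi g : T.
Let q := #|F|.

Lemma card_vsp U : #|[set x : V | x \in U]| = q ^ \dim U.
Proof. by rewrite cardsE (card_vspace U). Qed.

(** The points of the quotient C/A: one count serves for the points of a subspace, the lines of a
    pencil and the planes on a line. *)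
Definition between A C : {set T} :=
  [set U : T | [&& \dim U == (\dim A).+1, (A <= U)%VS & (U <= C)%VS]].

Lemma card_vspD A C : (A <= C)%VS ->
  #|[set x : V | (x \in C) && (x \notin A)]| = q ^ \dim C - q ^ \dim A.
Proof.
move=> AC; rewrite -!card_vsp; set SA := [set x | x \in A]; set SC := [set x | x \in C].
have sAC : SA \subset SC by apply/subsetP=> x; rewrite !inE; apply: (subvP AC).
rewrite -(setIidPr sAC) -cardsD; congr #|pred_of_set _|.
by apply/setP => x; rewrite !inE andbC.
Qed.

Lemma q_gt1 : 1 < q. Proof. exact: finNzRing_gt1. Qed.

(** Each vector x of C outside A lies in exactly one member, [A + <[x]>]; counting these vectors
    twice gives the formula, arranged so that no division occurs. *)
Lemma between_card A C : (A <= C)%VS ->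
  (#|between A C| * q.-1).+1 = q ^ (\dim C - \dim A).
Proof.
move=> AC; have le := dimvS AC; have q1 := q_gt1.
have h1 : \sum_(U in between A C) #|[set x in [set x : V | (x \in C) && (x \notin A)] | x \in U]|
   = #|between A C| * (q ^ (\dim A).+1 - q ^ \dim A).
  rewrite -sum_nat_const; apply: eq_bigr => U.
  rewrite inE => /and3P[/eqP dU AU UC].
  rewrite -dU -card_vspD //; apply: eq_card => x; rewrite !inE.
  by case xU: (x \in U); rewrite ?andbF // (subvP UC) ?xU // andbT.
have h2 : \sum_(U in between A C) #|[set x in [set x : V | (x \in C) && (x \notin A)] | x \in U]|
   = q ^ \dim C - q ^ \dim A.
  rewrite -card_vspD // -exchange_card -sum1_card; apply: eq_bigr => x.
  rewrite inE => /andP[xC xA]; apply/eqP/cards1P; exists (A + <[x]>)%VS.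
  have dx : \dim <[x]> = 1 by rewrite dim_vline; case: eqP xA => // ->; rewrite mem0v.
  apply/setP => U; rewrite !inE; apply/idP/eqP => [|->].
    case/andP=> /and3P[/eqP dU AU _] xU; apply/esym/vs_eq.
      by rewrite subv_add AU -memvE.
    by rewrite dU addvC dim_add1 // -memvE.
  rewrite addvC dim_add1 -?memvE // eqxx addvSr subv_add AC -memvE xC.
  by rewrite memvE addvSl.
have E : q ^ \dim A * (#|between A C| * q.-1).+1 = q ^ \dim A * q ^ (\dim C - \dim A).
  rewrite -expnD subnKC // -[in RHS](subnK (leq_pexp2l (ltnW q1) le)) -h2 h1.
  rewrite expnS; move: (q ^ _) => x; rewrite (_ : q * x - x = q.-1 * x).
    by rewrite mulnS addnC mulnC mulnA.
  by rewrite -subn1 mulnBl mul1n.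
by apply/eqP; rewrite -(eqn_pmul2l (m := q ^ \dim A)) ?E // expn_gt0 ltnW.
Qed.

Lemma between_card2 A C : (A <= C)%VS -> \dim C = (\dim A).+2 -> #|between A C| = q.+1.
Proof.
move=> AC dC; have := between_card AC; rewrite dC.
rewrite (_ : _ - _ = 2); last by lia.
have := q_gt1; rewrite expnS expn1; clear; move: #|between A C| => N; nia.
Qed.

Lemma between_card3 A C : (A <= C)%VS -> \dim C = (\dim A).+3 ->
  #|between A C| = q ^ 2 + q + 1.
Proof.
move=> AC dC; have := between_card AC; rewrite dC.
rewrite (_ : _ - _ = 3); last by lia.
have := q_gt1; rewrite !expnS expn0; clear; move: #|between A C| => N; nia.
Qed.

Lemma between_card4 A C : (A <= C)%VS -> \dim C = (\dim A).+4 ->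
  #|between A C| = q ^ 3 + q ^ 2 + q + 1.
Proof.
move=> AC dC; have := between_card AC; rewrite dC.
rewrite (_ : _ - _ = 4); last by lia.
have := q_gt1; rewrite !expnS expn0; clear; move: #|between A C| => N; nia.
Qed.

Lemma dim_full : \dim {:V} = 4. Proof. by rewrite dimvf /dim /= mul1n. Qed.

Definition points U : {set T} := [set P : T | (\dim P == 1) && (P <= U)%VS].

Lemma pointsE U : points U = between 0%VS U.
Proof. by apply/setP => P; rewrite !inE dimv0 sub0v. Qed.

Lemma pointsP U P : reflect (\dim P = 1 /\ (P <= U)%VS) (P \in points U).
Proof. by rewrite inE; apply: (iffP andP) => -[/eqP ? ?]; split=> //; apply/eqP. Qed.

Lemma card_points2 l : \dim l = 2 -> #|points l| = q.+1.
Proof. by move=> dl; rewrite pointsE between_card2 ?sub0v ?dimv0. Qed.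

Lemma card_points3 pi : \dim pi = 3 -> #|points pi| = q ^ 2 + q + 1.
Proof. by move=> dl; rewrite pointsE between_card3 ?sub0v ?dimv0. Qed.

Lemma card_points4 : #|points fullv| = q ^ 3 + q ^ 2 + q + 1.
Proof. by rewrite pointsE between_card4 ?sub0v ?dimv0 ?dim_full. Qed.

Lemma joinPP P R : \dim P = 1 -> \dim R = 1 -> P != R -> \dim (P + R) = 2.
Proof. by move=> dP dR ne; rewrite dim_add1 ?dR // vs_neq_sub ?dP. Qed.

Lemma line_joinE P R l : \dim P = 1 -> \dim R = 1 -> \dim l = 2 -> P != R ->
  (P <= l)%VS -> (R <= l)%VS -> l = (P + R)%VS.
Proof.
move=> dP dR dl ne Pl Rl; apply/esym/vs_eq; first by rewrite subv_add Pl.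
by rewrite joinPP // dl.
Qed.

Lemma lines_cap l m pi : \dim l = 2 -> \dim m = 2 -> \dim pi = 3 -> l != m ->
  (l <= pi)%VS -> (m <= pi)%VS -> \dim (l :&: m) = 1.
Proof.
move=> dl dm dpi ne lpi mpi; have := dim_cap_ge lpi mpi.
have : ~~ (l <= m)%VS by rewrite vs_neq_sub ?dl.
by move/dim_cap_lt; rewrite dl dm dpi; lia.
Qed.

Lemma planes_cap pi g : \dim pi = 3 -> \dim g = 3 -> pi != g -> \dim (pi :&: g) = 2.
Proof.
move=> dpi dg ne; have := dim_cap_ge (subvf pi) (subvf g).
have : ~~ (pi <= g)%VS by rewrite vs_neq_sub ?dpi.
by move/dim_cap_lt; rewrite dpi dg dim_full; lia.
Qed.

Lemma line_plane_cap l pi : \dim l = 2 -> \dim pi = 3 -> ~~ (l <= pi)%VS ->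
  \dim (l :&: pi) = 1.
Proof.
move=> dl dpi nl; have := dim_cap_ge (subvf l) (subvf pi).
by move: (dim_cap_lt nl); rewrite dl dpi dim_full; lia.
Qed.

Lemma lines_sum l m P : \dim l = 2 -> \dim m = 2 -> l != m -> \dim P = 1 ->
  (P <= l)%VS -> (P <= m)%VS -> \dim (l + m) = 3 /\ (l :&: m)%VS = P.
Proof.
move=> dl dm ne dP Pl Pm; have := dimv_sum_cap l m.
have : ~~ (l <= m)%VS by rewrite vs_neq_sub ?dl.
move/dim_cap_lt; have := dimvS (U := P) (V := l :&: m)%VS.
rewrite subv_cap Pl Pm => /(_ isT); rewrite dl dm dP => h1 h2 h3.
have d1 : \dim (l :&: m) = 1 by lia.
split; first by lia.
by apply/esym/vs_eq; rewrite ?subv_cap ?Pl ?d1 ?dP.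
Qed.

Lemma point_in_cap l m P : \dim (l :&: m) = 1 -> \dim P = 1 ->
  (P <= l)%VS -> (P <= m)%VS -> P = (l :&: m)%VS.
Proof. by move=> d1 dP Pl Pm; apply: vs_eq; rewrite ?subv_cap ?Pl ?d1 ?dP. Qed.

End Geometry.

(** * Sets of lines blocking all pencils *)

Section Blocking.
Variable F : finFieldType.
Notation V := 'rV[F]_4.
Notation T := {vspace V}.
Implicit Types U P R O l m n pi g : T.
Notation q := #|F|.

Variable BB : {set T}.
Hypothesis BBdim : forall n, n \in BB -> \dim n = 2.
Hypothesis BBblk : forall P pi, \dim P = 1 -> \dim pi = 3 -> (P <= pi)%VS ->
  exists2 n, n \in BB & (P <= n)%VS && (n <= pi)%VS.

Definition flag P pi : {set T} := [set n in BB | (P <= n)%VS && (n <= pi)%VS].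
Definition star P : {set T} := [set n in BB | (P <= n)%VS].
Definition trace pi : {set T} := [set n in BB | (n <= pi)%VS].
Definition planes l : {set T} := [set pi : T | (\dim pi == 3) && (l <= pi)%VS].
Definition lines_in pi : {set T} := [set n : T | (\dim n == 2) && (n <= pi)%VS].
Definition lines_on P : {set T} := [set n : T | (\dim n == 2) && (P <= n)%VS].

Lemma card_planes_line l : \dim l = 2 -> #|planes l| = q.+1.
Proof.
move=> dl; rewrite -(between_card2 (subvf l)) ?dl ?dim_full //.
by apply: eq_card => pi; rewrite !inE dl subvf andbT.
Qed.

Lemma card_lines_on P : \dim P = 1 -> #|lines_on P| = q ^ 2 + q + 1.
Proof.
move=> dP; rewrite -(between_card3 (subvf P)) ?dP ?dim_full //.
by apply: eq_card => pi; rewrite !inE dP subvf andbT.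
Qed.

Lemma card_pencil P pi : \dim P = 1 -> \dim pi = 3 -> (P <= pi)%VS ->
  #|[set n in lines_in pi | (P <= n)%VS]| = q.+1.
Proof.
move=> dP dpi Ppi; rewrite -(between_card2 Ppi) ?dP ?dpi //.
by apply: eq_card => n; rewrite !inE dP -andbA [(n <= _)%VS && _]andbC.
Qed.

Lemma flag_gt0 P pi : \dim P = 1 -> \dim pi = 3 -> (P <= pi)%VS -> 0 < #|flag P pi|.
Proof.
move=> dP dpi Ppi; have [n nB h] := BBblk dP dpi Ppi.
by apply/card_gt0P; exists n; rewrite inE nB.
Qed.

(* The plane pi, with its lines as elements and its points as constraints. *)
Lemma plane_deg pi n : n \in lines_in pi -> #|[set P in points pi | (P <= n)%VS]| = q.+1.
Proof.
rewrite inE => /andP[/eqP dn npi]; rewrite -(card_points2 dn).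
apply: eq_card => P; rewrite !inE; case: (\dim P == 1) => //=.
by case Pn: (P <= n)%VS; rewrite ?andbF // (subv_trans Pn npi).
Qed.

Lemma plane_join pi m n : \dim pi = 3 -> m \in lines_in pi -> n \in lines_in pi -> m != n ->
  #|[set P in points pi | (P <= m)%VS && (P <= n)%VS]| = 1.
Proof.
rewrite !inE => dpi /andP[/eqP dm mpi] /andP[/eqP dn npi] ne.
have dc := lines_cap dm dn dpi ne mpi npi.
apply/eqP/cards1P; exists (m :&: n)%VS; apply/setP => P; rewrite !inE.
apply/idP/eqP => [/andP[/andP[/eqP dP _] /andP[Pm Pn]]|->].
  exact: point_in_cap.
by rewrite dc eqxx capvSl capvSr (subv_trans (capvSl _ _)).
Qed.

Lemma trace_sub pi : trace pi \subset lines_in pi.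
Proof. by apply/subsetP => n; rewrite !inE => /andP[nB ->]; rewrite BBdim. Qed.

Lemma trace_flag P pi : [set n in trace pi | (P <= n)%VS] = flag P pi.
Proof. by apply/setP => n; rewrite !inE -andbA [(n <= _)%VS && _]andbC. Qed.

Lemma trace_blk pi P : \dim pi = 3 -> P \in points pi -> 0 < #|[set n in trace pi | (P <= n)%VS]|.
Proof. by move=> dpi /pointsP[dP Ppi]; rewrite trace_flag flag_gt0. Qed.

(* The quotient plane at P, with its lines as elements and its planes as constraints. *)
Lemma point_deg P n : n \in lines_on P -> #|[set pi in planes P | (n <= pi)%VS]| = q.+1.
Proof.
rewrite inE => /andP[/eqP dn Pn]; rewrite -(card_planes_line dn).
apply: eq_card => pi; rewrite !inE; case: (\dim pi == 3) => //=.
by case npi: (n <= pi)%VS; rewrite ?andbF // (subv_trans Pn npi).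
Qed.

Lemma point_join P m n : \dim P = 1 -> m \in lines_on P -> n \in lines_on P -> m != n ->
  #|[set pi in planes P | (m <= pi)%VS && (n <= pi)%VS]| = 1.
Proof.
rewrite !inE => dP /andP[/eqP dm Pm] /andP[/eqP dn Pn] ne.
have [d3 _] := lines_sum dm dn ne dP Pm Pn.
apply/eqP/cards1P; exists (m + n)%VS; apply/setP => pi; rewrite !inE.
apply/idP/eqP => [/andP[/andP[/eqP dpi _] /andP[mpi npi]]|->].
  by apply/esym/vs_eq; rewrite ?subv_add ?mpi ?d3 ?dpi.
by rewrite d3 eqxx addvSl addvSr (subv_trans Pm (addvSl _ _)).
Qed.

Lemma star_sub P : star P \subset lines_on P.
Proof. by apply/subsetP => n; rewrite !inE => /andP[nB ->]; rewrite BBdim. Qed.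

Lemma star_flag P pi : [set n in star P | (n <= pi)%VS] = flag P pi.
Proof. by apply/setP => n; rewrite !inE -andbA. Qed.

Lemma star_blk P pi : \dim P = 1 -> pi \in planes P -> 0 < #|[set n in star P | (n <= pi)%VS]|.
Proof. by move=> dP; rewrite inE => /andP[/eqP dpi Ppi]; rewrite star_flag flag_gt0. Qed.

Lemma points_lineE l pi : (l <= pi)%VS -> [set P in points pi | (P <= l)%VS] = points l.
Proof.
move=> lpi; apply/setP => P; rewrite !inE; case: (\dim P == 1) => //=.
by case Pl: (P <= l)%VS; rewrite ?andbF // (subv_trans Pl lpi).
Qed.

Lemma planes_lineE l P : (P <= l)%VS -> [set pi in planes P | (l <= pi)%VS] = planes l.
Proof.
move=> Pl; apply/setP => pi; rewrite !inE; case: (\dim pi == 3) => //=.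
by case lpi: (l <= pi)%VS; rewrite ?andbF // (subv_trans Pl lpi).
Qed.

Section Plane.
Variable pi : T.
Hypothesis dpi : \dim pi = 3.

Lemma trace_card : q < #|trace pi|.
Proof.
have [P /pointsP[dP Ppi]] : exists P, P \in points pi.
  by apply/card_gt0P; rewrite card_points3 // addn1.
apply: (blocking_card (@plane_deg pi) (fun m n => @plane_join pi m n dpi) (trace_sub pi) (fun P => @trace_blk pi P dpi)
  (c := P)); first by apply/pointsP.
exact: card_pencil.
Qed.

(** [small_blocking_full] with lines as elements and points as constraints. This and its dual
    [star_full] are the source of all full pencils. *)
Lemma trace_full : #|trace pi| <= q.+2 -> exists R, [/\ \dim R = 1, (R <= pi)%VS &
  forall n, \dim n = 2 -> (R <= n)%VS -> (n <= pi)%VS -> n \in BB].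
Proof.
move=> le; have q0 : 0 < q := ltnW (q_gt1 F).
have [R /pointsP[dR Rpi] h] := small_blocking_full (@plane_deg pi) (fun m n => @plane_join pi m n dpi)
  (trace_sub pi) (fun P => @trace_blk pi P dpi) q0 trace_card le.
exists R; split=> // n dn Rn npi.
have : n \in trace pi by apply: h => //; rewrite inE dn npi.
by rewrite inE => /andP[].
Qed.

Lemma trace_sum l : \dim l = 2 -> (l <= pi)%VS -> l \notin BB ->
  \sum_(P in points l) #|flag P pi| = #|trace pi|.
Proof.
move=> dl lpi lB; rewrite -(sum_through (fun m n => @plane_join pi m n dpi) (trace_sub pi) (a := l)).
- by rewrite points_lineE //; apply: eq_bigr => P _; rewrite trace_flag.
- by rewrite inE dl lpi.
by rewrite inE (negPf lB).
Qed.

Lemma trace_missing R l : \dim R = 1 -> \dim l = 2 -> (R <= l)%VS -> (l <= pi)%VS -> l \notin BB ->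
  #|flag R pi| + q <= #|trace pi|.
Proof.
move=> dR dl Rl lpi lB; rewrite -trace_flag.
apply: (le_missing (@plane_deg pi) (fun m n => @plane_join pi m n dpi) (trace_sub pi)
  (fun P => @trace_blk pi P dpi) (a := l)) => //.
- by rewrite inE dl lpi.
- by rewrite inE (negPf lB).
by apply/pointsP; rewrite (subv_trans Rl).
Qed.

End Plane.

Section Point.
Variable P : T.
Hypothesis dP : \dim P = 1.

Lemma card_planes_on : 0 < #|planes P|.
Proof.
have [n] : exists n, n \in lines_on P by apply/card_gt0P; rewrite card_lines_on // addn1.
rewrite inE => /andP[/eqP dn Pn].
have [pi] : exists pi, pi \in planes n by apply/card_gt0P; rewrite card_planes_line.
rewrite inE => /andP[dpi npi]; apply/card_gt0P; exists pi.
by rewrite inE dpi (subv_trans Pn).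
Qed.

Lemma star_card : q < #|star P|.
Proof.
have [pi] : exists pi, pi \in planes P by apply/card_gt0P/card_planes_on.
rewrite inE => /andP[/eqP dpi Ppi].
apply: (blocking_card (@point_deg P) (fun m n => @point_join P m n dP) (star_sub P) (fun pi => @star_blk P pi dP)
  (c := pi)); first by rewrite inE dpi Ppi.
rewrite -(card_pencil dP dpi Ppi); apply: eq_card => n; rewrite !inE.
by rewrite -!andbA [(P <= n)%VS && _]andbC.
Qed.

Lemma star_full : #|star P| <= q.+2 -> exists g, [/\ \dim g = 3, (P <= g)%VS &
  forall n, \dim n = 2 -> (P <= n)%VS -> (n <= g)%VS -> n \in BB].
Proof.
move=> le; have q0 : 0 < q := ltnW (q_gt1 F).
have [g gP h] := small_blocking_full (@point_deg P) (fun m n => @point_join P m n dP)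
  (star_sub P) (fun pi => @star_blk P pi dP) q0 star_card le.
move: gP; rewrite inE => /andP[/eqP dg Pg].
exists g; split=> // n dn Pn ng.
have : n \in star P by apply: h => //; rewrite inE dn Pn.
by rewrite inE => /andP[].
Qed.

Lemma star_sum l : \dim l = 2 -> (P <= l)%VS -> l \notin BB ->
  \sum_(pi in planes l) #|flag P pi| = #|star P|.
Proof.
move=> dl Pl lB; rewrite -(sum_through (fun m n => @point_join P m n dP) (star_sub P) (a := l)).
- by rewrite planes_lineE //; apply: eq_bigr => pi _; rewrite star_flag.
- by rewrite inE dl Pl.
by rewrite inE (negPf lB).
Qed.

Lemma star_missing g l : \dim g = 3 -> \dim l = 2 -> (P <= l)%VS -> (l <= g)%VS -> l \notin BB ->
  #|flag P g| + q <= #|star P|.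
Proof.
move=> dg dl Pl lg lB; rewrite -star_flag.
apply: (le_missing (@point_deg P) (fun m n => @point_join P m n dP) (star_sub P)
  (fun pi => @star_blk P pi dP) (a := l)) => //.
- by rewrite inE dl Pl.
- by rewrite inE (negPf lB).
by rewrite inE dg (subv_trans Pl).
Qed.

Lemma star_missing2 g pi l : \dim g = 3 -> \dim pi = 3 -> g != pi -> \dim l = 2 ->
  (P <= l)%VS -> (l <= g)%VS -> (l <= pi)%VS -> l \notin BB ->
  #|flag P g| + #|flag P pi| + q.-1 <= #|star P|.
Proof.
move=> dg dpi ne dl Pl lg lpi lB; rewrite -!star_flag.
apply: (le_missing2 (@point_deg P) (fun m n => @point_join P m n dP) (star_sub P)
  (fun pi => @star_blk P pi dP) (a := l)) => //.
- by rewrite inE dl Pl.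
- by rewrite inE (negPf lB).
- by rewrite inE dg (subv_trans Pl).
by rewrite inE dpi (subv_trans Pl).
Qed.

End Point.

End Blocking.

(** * Clean lines of a thin plane *)

Section Excess.
Variable F : finFieldType.
Notation V := 'rV[F]_4.
Notation T := {vspace V}.
Implicit Types U P R O l m n pi g : T.
Notation q := #|F|.

Variable BB : {set T}.
Hypothesis BBdim : forall n, n \in BB -> \dim n = 2.
Hypothesis BBblk : forall P pi, \dim P = 1 -> \dim pi = 3 -> (P <= pi)%VS ->
  exists2 n, n \in BB & (P <= n)%VS && (n <= pi)%VS.

Notation flag := (flag BB).
Notation star := (star BB).
Notation trace := (trace BB).

Definition eP P := #|star P| - q.+1.
Definition eH pi := #|trace pi| - q.+1.

Definition pencil P pi := [forall n, [&& \dim n == 2, (P <= n)%VS & (n <= pi)%VS] ==> (n \in BB)].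

Lemma pencilP P pi : reflect (forall n, \dim n = 2 -> (P <= n)%VS -> (n <= pi)%VS -> n \in BB)
  (pencil P pi).
Proof.
apply: (iffP forallP) => h n; last by apply/implyP => /and3P[/eqP]; apply: h.
by move=> dn Pn npi; move/implyP: (h n); rewrite dn Pn npi; apply.
Qed.

Lemma starE P : \dim P = 1 -> #|star P| = q.+1 + eP P.
Proof. by move=> dP; rewrite /eP subnKC // star_card. Qed.

Lemma traceE pi : \dim pi = 3 -> #|trace pi| = q.+1 + eH pi.
Proof. by move=> dpi; rewrite /eH subnKC // trace_card. Qed.

Lemma pencil_star P : \dim P = 1 -> eP P <= 1 -> exists g, [/\ \dim g = 3, (P <= g)%VS & pencil P g].
Proof.
move=> dP le; have : #|star P| <= q.+2 by rewrite starE //; lia.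
by case/(star_full BBdim BBblk dP) => g [dg Pg h]; exists g; split => //; apply/pencilP.
Qed.

Lemma pencil_trace pi : \dim pi = 3 -> eH pi <= 1 ->
  exists R, [/\ \dim R = 1, (R <= pi)%VS & pencil R pi].
Proof.
move=> dpi le; have : #|trace pi| <= q.+2 by rewrite traceE //; lia.
by case/(trace_full BBdim BBblk dpi) => g [dg Pg h]; exists g; split => //; apply/pencilP.
Qed.

Lemma pencil_flag P pi : \dim P = 1 -> \dim pi = 3 -> (P <= pi)%VS -> pencil P pi ->
  #|flag P pi| = q.+1.
Proof.
move=> dP dpi Ppi /pencilP h; rewrite -(card_pencil dP dpi Ppi); apply: eq_card => n.
rewrite !inE; apply/andP/andP => [[nB /andP[-> ->]]|[/andP[/eqP dn npi] Pn]].
  by rewrite BBdim.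
by rewrite h // Pn npi.
Qed.

(* Two full pencils on P share only one line. *)
Lemma pencil_uniq P g h : \dim P = 1 -> \dim g = 3 -> \dim h = 3 -> (P <= g)%VS -> (P <= h)%VS ->
  pencil P g -> pencil P h -> eP P < q -> g = h.
Proof.
move=> dP dg dh Pg Ph pg ph eq; apply/eqP; apply: contraTT eq => ne; rewrite -leqNgt.
have sub : flag P g :|: flag P h \subset star P.
  by apply/subsetP => n; rewrite !inE => /orP[] /and3P[-> ->].
have := subset_leq_card sub; rewrite cardsU !pencil_flag // starE //.
have : flag P g :&: flag P h \subset [set (g :&: h)%VS].
  apply/subsetP => n; rewrite !inE => /andP[/and3P[nB Pn ng] /and3P[_ _ nh]].
  by apply/eqP/vs_eq; rewrite ?subv_cap ?ng // planes_cap // BBdim.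
by move/subset_leq_card; rewrite cards1; lia.
Qed.

Section Local.
Variables rho O l : T.
Hypothesis dr : \dim rho = 3.
Hypothesis dO : \dim O = 1.
Hypothesis Or : (O <= rho)%VS.
Hypothesis thin : forall n, \dim n = 2 -> (n <= rho)%VS -> (n \in BB) = (O <= n)%VS.
Hypothesis dl : \dim l = 2.
Hypothesis lr : (l <= rho)%VS.
Hypothesis Ol : ~~ (O <= l)%VS.

Let X := \sum_(P in points l) eP P.
Hypothesis Xle : X + 3 <= 2 * q.

Let lB : l \notin BB. Proof. by rewrite thin. Qed.
Let cpts : #|points l| = q.+1. Proof. exact: card_points2. Qed.
Let cpls : #|planes l| = q.+1. Proof. exact: card_planes_line. Qed.

Let ptsP P : P \in points l -> \dim P = 1 /\ (P <= l)%VS.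
Proof. by move/pointsP. Qed.
Let plsP pi : pi \in planes l -> \dim pi = 3 /\ (l <= pi)%VS.
Proof. by rewrite inE => /andP[/eqP]. Qed.

Let rhoP : rho \in planes l. Proof. by rewrite inE dr eqxx. Qed.

Let pts_pls P pi : P \in points l -> pi \in planes l -> (P <= pi)%VS.
Proof. by move=> /ptsP[_ Pl] /plsP[_]; apply: subv_trans. Qed.

(** Since l is not in BB, a line of BB meeting l determines one flag on l, its point of intersection
    and its span with l. Summing by points or by planes counts the same lines. *)
Lemma excess_sum : X = \sum_(pi in planes l) eH pi.
Proof.
have h1 : \sum_(P in points l) #|star P| = q.+1 * q.+1 + X.
  have -> : q.+1 * q.+1 = \sum_(P in points l) q.+1 by rewrite sum_nat_const cpts.
  by rewrite -big_split; apply: eq_bigr => P /ptsP[dP _]; rewrite starE.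
have h2 : \sum_(pi in planes l) #|trace pi| = q.+1 * q.+1 + \sum_(pi in planes l) eH pi.
  have -> : q.+1 * q.+1 = \sum_(pi in planes l) q.+1 by rewrite sum_nat_const cpls.
  by rewrite -big_split; apply: eq_bigr => pi /plsP[dpi _]; rewrite traceE.
apply/eqP; rewrite -(eqn_add2l (q.+1 * q.+1)) -h1 -h2; apply/eqP.
transitivity (\sum_(P in points l) \sum_(pi in planes l) #|flag P pi|).
  by apply: eq_bigr => P /ptsP[dP Pl]; rewrite star_sum.
rewrite exchange_big; apply: eq_bigr => pi /plsP[dpi lpi].
by rewrite -(trace_sum BBdim dpi dl lpi lB).
Qed.

Lemma flag_pos P pi : P \in points l -> pi \in planes l -> 0 < #|flag P pi|.
Proof.
move=> Pl pil; have [[dP _] [dpi _]] := (ptsP Pl, plsP pil).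
by apply: flag_gt0 => //; apply: pts_pls.
Qed.

Lemma flag_le_eH P pi : P \in points l -> pi \in planes l -> #|flag P pi| <= (eH pi).+1.
Proof.
move=> Pl pil; have [dpi lpi] := plsP pil; have sP : [set P] \subset points l by rewrite sub1set.
have := trace_sum BBdim dpi dl lpi lB; rewrite traceE // (sum_setID _ sP) big_set1.
have : 1 * #|points l :\: [set P]| <= \sum_(R in points l :\: [set P]) #|flag R pi|.
  by apply: sum_ge_const => R; rewrite inE => /andP[_ Rl]; apply: flag_pos.
rewrite cardsD (setIidPr sP) cpts cards1.
by move: (\sum_(R in _ :\: _) #|flag R pi|) => b; clear; lia.
Qed.

(** Each of the q + 1 planes on l holds a line of the star of P; every plane of [K] holds a second
    one, which is charged to the excess. *)
Lemma card_le_eP P (K : {set T}) : P \in points l -> K \subset planes l ->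
  (forall pi, pi \in K -> 1 < #|flag P pi|) -> #|K| <= eP P.
Proof.
move=> Pl sK hK; have [dP Pl'] := ptsP Pl.
have := star_sum BBdim dP dl Pl' lB; rewrite starE // (sum_setID _ sK).
have := sum_ge_const hK.
have : 1 * #|planes l :\: K| <= \sum_(pi in planes l :\: K) #|flag P pi|.
  by apply: sum_ge_const => pi; rewrite inE => /andP[_ pil]; apply: flag_pos.
have := subset_leq_card sK; rewrite cardsD (setIidPr sK) cpls.
by move: (\sum_(pi in K) #|flag P pi|) (\sum_(pi in _ :\: K) #|flag P pi|) => a b; move: #|K| #|F|; clear; lia.
Qed.

Lemma card_le_eH pi (K : {set T}) : pi \in planes l -> K \subset points l ->
  (forall P, P \in K -> 1 < #|flag P pi|) -> #|K| <= eH pi.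
Proof.
move=> pil sK hK; have [dpi lpi] := plsP pil.
have := trace_sum BBdim dpi dl lpi lB; rewrite traceE // (sum_setID _ sK).
have := sum_ge_const hK.
have : 1 * #|points l :\: K| <= \sum_(P in points l :\: K) #|flag P pi|.
  by apply: sum_ge_const => P; rewrite inE => /andP[_ Pl]; apply: flag_pos.
have := subset_leq_card sK; rewrite cardsD (setIidPr sK) cpts.
by move: (\sum_(P in K) #|flag P pi|) (\sum_(P in _ :\: K) #|flag P pi|) => a b; move: #|K| #|F|; clear; lia.
Qed.

Let thinP n : n \in BB -> (n <= rho)%VS -> (O <= n)%VS.
Proof. by move=> nB nr; rewrite -thin // BBdim. Qed.

Let plane_O pi : pi \in planes l -> pi != rho -> ~~ (O <= pi)%VS.
Proof.
move=> /plsP[dpi lpi]; apply: contra => Opi; apply/eqP/esym/vs_eq; last by rewrite dpi dr.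
rewrite (_ : rho = (O + l)%VS) ?subv_add ?Opi //.
by apply/esym/vs_eq; rewrite ?subv_add ?Or // dim_add1 // dl dr.
Qed.

Let notl g P : P \in points l -> pencil P g -> ~~ (l <= g)%VS.
Proof. by move=> /ptsP[dP Pl] /pencilP h; apply: contra lB; apply: h. Qed.

(** The plane g of the pencil on P is not rho, because l is not in BB. So g meets rho in a line of
    BB, and the lines of BB in rho all pass through O. *)
Lemma good_pencil P : P \in points l -> eP P <= 1 ->
  exists g, [/\ \dim g = 3, (P <= g)%VS, pencil P g, (O <= g)%VS & ~~ (l <= g)%VS].
Proof.
move=> Pl le; have [dP Pl'] := ptsP Pl.
have [g [dg Pg pg]] := pencil_star dP le; have ng := notl Pl pg; exists g; split=> //.
have ne : g != rho by apply: contraNneq ng => ->.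
have dc := planes_cap dg dr ne.
apply: subv_trans (capvSl g rho); apply: thinP (capvSr _ _).
move/pencilP: pg; apply=> //; last exact: capvSl.
by rewrite subv_cap Pg (subv_trans Pl').
Qed.

Definition colplane P := odflt 0%VS [pick g : T | [&& \dim g == 3, (P <= g)%VS, pencil P g,
  (O <= g)%VS & ~~ (l <= g)%VS]].

Lemma colplaneP P : P \in points l -> eP P <= 1 -> [/\ \dim (colplane P) = 3, (P <= colplane P)%VS,
  pencil P (colplane P), (O <= colplane P)%VS & ~~ (l <= colplane P)%VS].
Proof.
move=> Pl le; rewrite /colplane; case: pickP => [g /and5P[/eqP dg ? ? ? ?] //|none].
have [g [dg h1 h2 h3 h4]] := good_pencil Pl le.
by move: (none g); rewrite dg h1 h2 h3 h4.
Qed.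

Lemma good_row pi : pi \in planes l -> eH pi <= 1 ->
  exists R, [/\ \dim R = 1, (R <= pi)%VS, pencil R pi & ~~ (R <= l)%VS].
Proof.
move=> pil le; have [dpi lpi] := plsP pil.
have [R [dR Rpi pR]] := pencil_trace dpi le; exists R; split=> //.
by apply: contra lB => Rl; move/pencilP: pR; apply.
Qed.

(* A good row through R with R outside the pencil plane of P carries the two lines PR and
   [colplane P :&: pi] on P. *)
Lemma row_exception P pi R : P \in points l -> eP P <= 1 -> pi \in planes l ->
  \dim R = 1 -> (R <= pi)%VS -> pencil R pi -> ~~ (R <= l)%VS ->
  ~~ (R <= colplane P)%VS -> 1 < #|flag P pi|.
Proof.
move=> Pl le pil dR Rpi pR Rl Rg; have [dP Pl'] := ptsP Pl; have [dpi lpi] := plsP pil.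
have [dg Pg pg _ lg] := colplaneP Pl le; have Ppi := pts_pls Pl pil.
have ne : colplane P != pi by apply: contraNneq lg => ->.
have PR : P != R by apply: contraNneq Rl => <-.
apply/card_gt1P; exists (P + R)%VS, (colplane P :&: pi)%VS; rewrite !inE capvSr addvSl.
rewrite !subv_add Ppi Rpi subv_cap Pg Ppi !andbT; split.
- by move/pencilP: pR; apply; rewrite ?joinPP ?addvSr // subv_add Ppi.
- by move/pencilP: pg; apply; rewrite ?planes_cap ?capvSl // subv_cap Pg.
by apply: contraNneq Rg => E; apply: subv_trans (capvSl _ pi); rewrite -E addvSr.
Qed.

Let GP := [set P in points l | eP P <= 1].
Let GR := [set pi in planes l :\ rho | eH pi <= 1].

Let GPP P : P \in GP -> P \in points l /\ eP P <= 1.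
Proof. by rewrite inE => /andP[]. Qed.
Let GRP pi : pi \in GR -> [/\ pi \in planes l, pi != rho & eH pi <= 1].
Proof. by rewrite !inE => /andP[/andP[-> ->]]. Qed.

Let sGP : GP \subset points l. Proof. by apply/subsetP => P /GPP[]. Qed.

Let bad_points : 2 * (q.+1 - #|GP|) + \sum_(P in GP) eP P <= X.
Proof.
rewrite /X (sum_setID _ sGP) addnC leq_add2l -cpts -{1}(setIidPr sGP) -cardsD.
by apply: sum_ge_const => P; rewrite !inE => /andP[]; rewrite negb_and -ltnNge => /orP[/negP h /h|].
Qed.

Lemma card_good_points : 3 <= #|GP|.
Proof. by move: bad_points Xle; clear; move: (\sum_(P in GP) eP P) #|GP| => ? ?; lia. Qed.

Definition vertex pi := odflt 0%VS [pick R : T | [&& \dim R == 1, (R <= pi)%VS, pencil R pi & ~~ (R <= l)%VS]].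

Let vertexP pi : pi \in GR -> [/\ \dim (vertex pi) = 1, (vertex pi <= pi)%VS, pencil (vertex pi) pi
  & ~~ (vertex pi <= l)%VS].
Proof.
case/GRP => pil _ le; rewrite /vertex; case: pickP => [R /and4P[/eqP dR ? ? ?] //|none].
by have [R [dR h1 h2 h3]] := good_row pil le; move: (none R); rewrite dR h1 h2 h3.
Qed.

Let plane_meet pi : pi \in planes l -> pi != rho -> (pi :&: rho)%VS = l.
Proof.
move=> /plsP[dpi lpi] ne; apply/esym/vs_eq; first by rewrite subv_cap lpi.
by rewrite planes_cap // dl.
Qed.

Let vertex_rho pi : pi \in GR -> ~~ (vertex pi <= rho)%VS.
Proof.
move=> piG; have [_ Rpi _] := vertexP piG; have [pil ne _] := GRP piG.
by apply: contra => Rr; rewrite -(plane_meet pil ne) subv_cap Rpi.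
Qed.

Let vertex_line pi : pi \in GR -> \dim (O + vertex pi) = 2.
Proof.
move=> piG; have [dR Rpi _ _] := vertexP piG; rewrite joinPP //.
by apply: contraNneq (vertex_rho piG) => <-.
Qed.

(** The candidate is the join of O to the vertex of a good row. If it fails for every good row, each
    such row has exactly one exceptional good point, since two would exceed its excess. Two rows
    have different exceptional points a1 and a2 for the dual reason. The planes of two further good
    points meet in a line, which must be the candidate of both rows; so the candidates coincide, and
    a1, not being exceptional for the second row, is not exceptional for the first. *)
Lemma common_line : exists ls, [/\ \dim ls = 2, (O <= ls)%VS, ~~ (ls <= rho)%VS &
  forall P, P \in points l -> eP P <= 1 -> (ls <= colplane P)%VS].
Proof.
have done_by pi : pi \in GR -> (forall P, P \in GP -> (vertex pi <= colplane P)%VS) ->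
  exists ls, [/\ \dim ls = 2, (O <= ls)%VS, ~~ (ls <= rho)%VS &
  forall P, P \in points l -> eP P <= 1 -> (ls <= colplane P)%VS].
  move=> piG h; exists (O + vertex pi)%VS; rewrite vertex_line // addvSl; split=> //.
    by apply: contra (vertex_rho piG); apply: subv_trans; apply: addvSr.
  move=> P Pl le; have [_ _ _ OP _] := colplaneP Pl le; rewrite subv_add OP h //.
  by rewrite inE Pl.
have [/exists_inP[pi piG /forall_inP h]|none] :=
  boolP [exists pi in GR, [forall P in GP, vertex pi <= colplane P]%VS]; first exact: done_by h.
have exc pi : pi \in GR -> exists2 a, a \in GP & ~~ (vertex pi <= colplane a)%VS.
  by move=> piG; move/exists_inPn: none => /(_ pi piG) /forall_inPn.
have excflag pi a : pi \in GR -> a \in GP -> ~~ (vertex pi <= colplane a)%VS -> 1 < #|flag a pi|.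
  move=> piG /GPP[al ea]; have [dR Rpi pR Rl] := vertexP piG; have [pil _ _] := GRP piG.
  exact: row_exception.
have ge1 pi : pi \in GR -> 1 <= eH pi.
  move=> piG; have [a aG na] := exc pi piG; have [pil _ _] := GRP piG.
  rewrite -(cards1 a); apply: card_le_eH => //; first by rewrite sub1set (subsetP sGP).
  by move=> P /set1P ->; apply: excflag.
have uniq pi a P : pi \in GR -> a \in GP -> ~~ (vertex pi <= colplane a)%VS ->
    P \in GP -> P != a -> (vertex pi <= colplane P)%VS.
  move=> piG aG na PG ne; apply: contraT => nP; have [pil _ le] := GRP piG.
  suff : 2 <= eH pi by rewrite ltnNge le.
  have <- : #|[set P; a]| = 2 by rewrite cards2 ne.
  apply: card_le_eH => //; first by rewrite subUset !sub1set !(subsetP sGP).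
  by move=> R; rewrite !inE => /orP[] /eqP ->; apply: excflag.
(* Good rows now have excess 1 and the other planes on l, except possibly rho, at least 2; the sum
   2q - #|GR| must not exceed 2q - 3. *)
have GR3 : 2 < #|GR|.
  have sGR : GR \subset planes l :\ rho by apply/subsetP => pi; rewrite inE => /andP[].
  have := excess_sum; rewrite (bigD1 rho rhoP) /=.
  have -> : \sum_(pi in planes l | pi != rho) eH pi = \sum_(pi in planes l :\ rho) eH pi.
    by apply: eq_bigl => pi; rewrite in_setD1 andbC.
  rewrite (sum_setID _ sGR).
  have : 1 * #|GR| <= \sum_(pi in GR) eH pi by apply: sum_ge_const.
  have : 2 * #|(planes l :\ rho) :\: GR| <= \sum_(pi in (planes l :\ rho) :\: GR) eH pi.
    apply: sum_ge_const => pi; rewrite in_setD => /andP[h pil]; move: h.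
    by rewrite inE pil /= -ltnNge.
  have := cardsD1 rho (planes l); rewrite rhoP cpls => /esym h.
  rewrite cardsD (setIidPr sGR); have {h} -> : #|planes l :\ rho| = q by apply: succn_inj; rewrite -h.
  move: (\sum_(pi in GR) eH pi) (\sum_(pi in _ :\: _) eH pi) (eH rho) Xle => a b c.
  by move: #|GR| #|F|; clear; lia.
have [pi1 [pi2 [G1 G2 ne12]]] : exists pi1 pi2, [/\ pi1 \in GR, pi2 \in GR & pi1 != pi2].
  by apply/card_gt1P; apply: ltnW.
have [[a1 aG1 na1] [a2 aG2 na2]] := (exc _ G1, exc _ G2).
have [al1 le1] := GPP aG1; have [al2 le2] := GPP aG2.
have ne : a1 != a2.
  apply: contraTneq le1 => E; rewrite -ltnNge.
  have <- : #|[set pi1; pi2]| = 2 by rewrite cards2 ne12.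
  apply: card_le_eP => //.
    by rewrite subUset !sub1set; case/GRP: G1 => ->; case/GRP: G2 => ->.
  by move=> pi; rewrite !inE => /orP[] /eqP ->; apply: excflag; rewrite ?E // -E.
have ea pi a : pi \in GR -> a \in GP -> ~~ (vertex pi <= colplane a)%VS -> 1 <= eP a.
  move=> piG aG na; have [pil _ _] := GRP piG; rewrite -(cards1 pi); apply: card_le_eP => //.
  - by case/GPP: aG.
  - by rewrite sub1set.
  by move=> pi' /set1P ->; apply: excflag.
have s12 : [set a1; a2] \subset GP by rewrite subUset !sub1set aG1.
(* Both exceptional points have excess at least 1, so 2 (q + 1 - #|GP|) + 2 <= 2q - 3, which leaves
   at least four good points. *)
have GP4 : 1 < #|GP :\: [set a1; a2]|.
  rewrite cardsD (setIidPr s12) cards2 ne /=.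
  have : 2 <= \sum_(P in GP) eP P.
    apply: leq_trans (sum_sub_le _ s12); rewrite (bigD1 a1) ?inE ?eqxx //= (bigD1 a2) /=; last first.
      by rewrite !inE eqxx orbT eq_sym.
    by apply: (leq_add (ea _ _ G1 aG1 na1)); apply: leq_trans (ea _ _ G2 aG2 na2) (leq_addr _ _).
  move: bad_points Xle; move: (\sum_(P in GP) eP P) #|GP| #|F| => s c k; clear; lia.
have [P [P' [PG PG' nP]]] : exists P P', [/\ P \in GP :\: [set a1; a2], P' \in GP :\: [set a1; a2] & P != P'].
  exact/card_gt1P.
move: PG PG'; rewrite !in_setD !in_set2 !negb_or => /andP[/andP[P1 P2] PG] /andP[/andP[P1' P2'] PG'].
have [Pl le] := GPP PG; have [Pl' le'] := GPP PG'.
have [dg Pg pg Og lg] := colplaneP Pl le; have [dg' Pg' pg' Og' lg'] := colplaneP Pl' le'.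
have [dP Pl0] := ptsP Pl; have [dP' Pl0'] := ptsP Pl'.
have neg : colplane P != colplane P'.
  apply: contraNneq lg => E.
  by rewrite (line_joinE dP dP' dl nP Pl0 Pl0') subv_add Pg E.
have dc := planes_cap dg dg' neg.
have capE pi : pi \in GR -> (vertex pi <= colplane P)%VS -> (vertex pi <= colplane P')%VS ->
    (O + vertex pi = colplane P :&: colplane P')%VS.
  move=> piG v v'; apply: vs_eq; last by rewrite dc vertex_line.
  by rewrite subv_add !subv_cap Og Og' v.
have E1 := capE _ G1 (uniq _ _ _ G1 aG1 na1 PG P1) (uniq _ _ _ G1 aG1 na1 PG' P1').
have E2 := capE _ G2 (uniq _ _ _ G2 aG2 na2 PG P2) (uniq _ _ _ G2 aG2 na2 PG' P2').
apply: (done_by pi1 G1) => R RG; have [Rl leR] := GPP RG.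
have [R1|R1] := eqVneq R a1; last exact: uniq R1.
have := uniq _ _ _ G2 aG2 na2 RG; rewrite R1 => /(_ ne) v2.
have [_ _ _ OR _] := colplaneP Rl leR.
apply: subv_trans (addvSr O _) _; rewrite E1 -E2 subv_add -R1 OR R1.
exact: v2.
Qed.

(** The cell (P, pi) of the grid is the line joining P to the point of [ls] in pi, and these lines
    are all the transversals of l and [ls]. In a row they form a pencil at that point of [ls], in a
    column a pencil at P; a missing cell therefore forces excess by [trace_missing] and
    [star_missing], as [no_missing_cell] demands. *)
Lemma local_line : 4 <= q -> exists ls, [/\ \dim ls = 2, (O <= ls)%VS, (l :&: ls = 0)%VS &
  forall P R, \dim P = 1 -> (P <= l)%VS -> \dim R = 1 -> (R <= ls)%VS -> (P + R)%VS \in BB].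
Proof.
move=> q4; have [ls [dls Ols lsr hls]] := common_line; exists ls.
have capr : (ls :&: rho)%VS = O.
  by apply/esym/vs_eq; rewrite ?subv_cap ?Ols // line_plane_cap ?dO.
have skew : (l :&: ls = 0)%VS.
  apply/eqP; rewrite -dimv_eq0; apply: contraNT Ol => d0.
  have s : (l :&: ls <= O)%VS by rewrite -capr subv_cap capvSr (subv_trans (capvSl _ _)).
  by rewrite -(vs_eq s) ?capvSl // dO lt0n.
have lspi pi : pi \in planes l -> ~~ (ls <= pi)%VS.
  move=> pil; have [->//|ne] := eqVneq pi rho.
  by apply: contra (plane_O pil ne); apply: subv_trans.
pose c pi := (ls :&: pi)%VS.
have dc pi : pi \in planes l -> \dim (c pi) = 1.
  by move=> pil; have [dpi _] := plsP pil; rewrite line_plane_cap // lspi.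
have cl pi : pi \in planes l -> ~~ (c pi <= l)%VS.
  move=> pil; apply/negP => cl; have : (c pi <= l :&: ls)%VS by rewrite subv_cap cl capvSl.
  by rewrite skew => /dimvS; rewrite dimv0 dc.
have dcell P pi : P \in points l -> pi \in planes l -> \dim (P + c pi) = 2.
  move=> Pl pil; have [dP Pl'] := ptsP Pl; rewrite joinPP ?dc //.
  by apply: contraNneq (cl _ pil) => <-.
have cellpi P pi : P \in points l -> pi \in planes l -> (P + c pi <= pi)%VS.
  by move=> Pl pil; rewrite subv_add capvSr (pts_pls Pl pil).
have Pls P : P \in points l -> ~~ (P <= ls)%VS.
  move=> /ptsP[dP Pl]; apply/negP => Pls; have : (P <= l :&: ls)%VS by rewrite subv_cap Pl.
  by rewrite skew => /dimvS; rewrite dimv0 dP.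
pose miss P pi := (P + c pi)%VS \notin BB.
have rowflag pi : pi \in planes l -> q.+1 <= #|flag (c pi) pi| + #|[set P in points l | miss P pi]|.
  move=> pil; have [dpi lpi] := plsP pil; rewrite -cpts.
  apply: (card_le_inj (f := fun P => P + c pi)%VS) => [P P' Pl Pl' E|P Pl].
    apply/eqP; apply: contraNT (cl _ pil) => ne.
    have [[dP Pl0] [dP' Pl0']] := (ptsP Pl, ptsP Pl').
    have s : (l <= P + c pi)%VS.
      by rewrite (line_joinE dP dP' dl ne Pl0 Pl0') subv_add addvSl E addvSl.
    by rewrite (vs_eq s) ?addvSr // dcell // dl.
  by rewrite negbK inE => ->; rewrite addvSr cellpi.
have colflag P : P \in points l -> q.+1 <= #|flag P (P + ls)| + #|[set pi in planes l | miss P pi]|.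
  move=> Pl; have [dP Pl0] := ptsP Pl; rewrite -cpls.
  apply: (card_le_inj (f := fun pi => P + c pi)%VS) => [pi pi' pil pil' E|pi pil].
    apply/eqP; apply: contraNT (cl _ pil') => ne.
    have [[dpi lpi] [dpi' lpi']] := (plsP pil, plsP pil').
    have <- : (pi :&: pi')%VS = l.
      by apply/esym/vs_eq; rewrite ?subv_cap ?lpi // planes_cap ?dl.
    by rewrite subv_cap capvSr andbT; apply: subv_trans (cellpi _ _ Pl pil); rewrite E addvSr.
  by rewrite negbK inE => ->; rewrite addvSl addvS ?capvSl.
have dPls P : P \in points l -> \dim (P + ls) = 3.
  by move=> Pl; have [dP _] := ptsP Pl; rewrite dim_add1 ?dls ?Pls.
have colS P pi : (P + c pi <= P + ls)%VS by rewrite addvS ?capvSl.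
have nomiss : forall P pi, P \in points l -> pi \in planes l -> ~~ miss P pi.
  apply: (@no_missing_cell _ _ (points l) (planes l) (fun P pi => #|flag P pi|) miss eP eH q X) => //.
  - move=> P Pl; have [dP Pl0] := ptsP Pl.
    by rewrite (star_sum BBdim dP dl Pl0 lB) starE.
  - exact: flag_le_eH.
  - by rewrite -excess_sum.
  - move=> P pi Pl pil mis; have [dpi lpi] := plsP pil.
    have := trace_missing BBdim BBblk dpi (dc _ pil) (dcell _ _ Pl pil) (addvSr _ _) (cellpi _ _ Pl pil) mis.
    by rewrite traceE //; have := rowflag _ pil; move: #|flag _ _| #|[set P in _ | _]| #|F|; clear; lia.
  - move=> P pi Pl pil mis; have [dP Pl0] := ptsP Pl.
    have := star_missing BBdim BBblk dP (dPls _ Pl) (dcell _ _ Pl pil) (addvSl _ _) (colS _ _) mis.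
    by rewrite starE //; have := colflag _ Pl; move: #|flag _ _| #|[set P in _ | _]| #|F|; clear; lia.
  - move=> P pi Pl pil mis; have [dP Pl0] := ptsP Pl; have [dpi lpi] := plsP pil.
    have ne : (P + ls)%VS != pi by apply: contraNneq (lspi _ pil) => <-; rewrite addvSr.
    have := star_missing2 BBdim BBblk dP (dPls _ Pl) dpi ne (dcell _ _ Pl pil) (addvSl _ _) (colS _ _)
      (cellpi _ _ Pl pil) mis.
    rewrite starE //; have := colflag _ Pl.
    move: #|flag P (P + ls)| #|flag P pi| #|[set P in _ | _]| #|F| q4; clear; lia.
  (* A good column has no missing cell, because its full pencil lies in a plane containing [ls]. At
     least three columns are good, so at most q - 2 are bad. *)
  have := card_good_points; have : #|[set P in points l | [exists pi in planes l, miss P pi]]| <= #|points l :\: GP|.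
    apply: subset_leq_card; apply/subsetP => P; rewrite in_setD inE => /andP[Pl /exists_inP[pi pil mis]].
    rewrite Pl andbT; apply: contra mis => /GPP[_ le].
    have [dg Pg /pencilP pg Og lg] := colplaneP Pl le.
    apply: pg; rewrite ?dcell ?addvSl // subv_add Pg.
    by apply: subv_trans (capvSl _ _) (hls _ Pl le).
  rewrite cardsD (setIidPr sGP) cpts; move: #|GP| #|F| #|[set P in _ | _]| q4; clear; lia.
split=> // P R dP Pl0 dR Rls; have Pl : P \in points l by apply/pointsP.
have Rl : ~~ (R <= l)%VS.
  apply/negP => Rl; have : (R <= l :&: ls)%VS by rewrite subv_cap Rl.
  by rewrite skew => /dimvS; rewrite dimv0 dR.
have pil : (R + l)%VS \in planes l by rewrite inE addvSr dim_add1 // dl.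
have := nomiss _ _ Pl pil; rewrite /miss negbK.
have -> // : c (R + l)%VS = R.
by apply/esym/vs_eq; rewrite ?subv_cap ?Rls ?addvSl // dc ?dR.
Qed.

End Local.
End Excess.

(** * A plane of excess 0 and the total excess of its points *)

Section Thin.
Variable F : finFieldType.
Notation V := 'rV[F]_4.
Notation T := {vspace V}.
Implicit Types U P R O l m n pi g rho : T.
Notation q := #|F|.

Variable BB : {set T}.
Hypothesis BBdim : forall n, n \in BB -> \dim n = 2.
Hypothesis BBblk : forall P pi, \dim P = 1 -> \dim pi = 3 -> (P <= pi)%VS ->
  exists2 n, n \in BB & (P <= n)%VS && (n <= pi)%VS.
Hypothesis BBcard : #|BB| <= q ^ 3 + 2 * q ^ 2 + q + 1.

Notation flag := (flag BB).
Notation star := (star BB).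
Notation trace := (trace BB).
Notation eP := (eP BB).
Notation eH := (eH BB).

Lemma sum_star : \sum_(P in points fullv) #|star P| = q.+1 * #|BB|.
Proof.
rewrite -(exchange_card BB (points fullv) (fun n P => (P <= n)%VS)) mulnC -sum_nat_const.
by apply: eq_bigr => n nB; rewrite (points_lineE (subvf n)) card_points2 // BBdim.
Qed.

Lemma sum_star_plane pi : \dim pi = 3 ->
  \sum_(P in points pi) #|star P| = #|BB| + q * #|trace pi|.
Proof.
move=> dpi; rewrite -(exchange_card BB (points pi) (fun n P => (P <= n)%VS)).
have sub : trace pi \subset BB by apply/subsetP => n; rewrite inE => /andP[].
rewrite (sum_setID _ sub) -(cardsID (trace pi) BB) (setIidPr sub).
rewrite (eq_bigr (fun=> q.+1)) => [|n]; last first.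
  rewrite inE => /andP[nB npi]; rewrite points_lineE // card_points2 // BBdim //.
rewrite [X in _ + X](eq_bigr (fun=> 1)) => [|n]; last first.
  rewrite !inE => /andP[+ nB]; rewrite nB /= => npi.
  have d1 := line_plane_cap (BBdim nB) dpi npi.
  apply/eqP/cards1P; exists (n :&: pi)%VS; apply/setP => P; rewrite !inE.
  apply/idP/eqP => [/andP[/andP[/eqP dP Ppi] Pn]|->]; first exact: point_in_cap.
  by rewrite d1 eqxx capvSl capvSr.
by rewrite !sum_nat_const; move: #|trace pi| #|F|; clear; nia.
Qed.

Lemma sum_trace_point P : \dim P = 1 ->
  \sum_(pi in planes P) #|trace pi| = #|BB| + q * #|star P|.
Proof.
move=> dP; rewrite -(exchange_card BB (planes P) (fun n pi => (n <= pi)%VS)).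
have sub : star P \subset BB by apply/subsetP => n; rewrite inE => /andP[].
rewrite (sum_setID _ sub) -(cardsID (star P) BB) (setIidPr sub).
rewrite (eq_bigr (fun=> q.+1)) => [|n]; last first.
  by rewrite inE => /andP[nB Pn]; rewrite planes_lineE // card_planes_line // BBdim.
rewrite [X in _ + X](eq_bigr (fun=> 1)) => [|n]; last first.
  rewrite !inE => /andP[+ nB]; rewrite nB /= => Pn.
  have d3 : \dim (P + n) = 3 by rewrite dim_add1 // BBdim.
  apply/eqP/cards1P; exists (P + n)%VS; apply/setP => pi; rewrite !inE.
  apply/idP/eqP => [/andP[/andP[/eqP dpi Ppi] npi]|->].
    by apply/esym/vs_eq; rewrite ?subv_add ?Ppi ?d3 ?dpi.
  by rewrite d3 eqxx addvSl addvSr.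
by rewrite !sum_nat_const; move: #|star P| #|F|; clear; nia.
Qed.

Lemma card_planes_point P : \dim P = 1 -> #|planes P| = q ^ 2 + q + 1.
Proof.
move=> dP; have := exchange_card (lines_on P) (planes P) (fun n pi => (n <= pi)%VS).
rewrite (eq_bigr (fun=> q.+1)) => [|n nP]; last exact: point_deg.
rewrite [in RHS](eq_bigr (fun=> q.+1)) => [|pi]; last first.
  rewrite inE => /andP[/eqP dpi Ppi]; rewrite -(card_pencil dP dpi Ppi).
  by apply: eq_card => n; rewrite !inE -!andbA [(P <= n)%VS && _]andbC.
rewrite !sum_nat_const card_lines_on // => /eqP; rewrite eqn_pmul2r // => /eqP.
exact: esym.
Qed.

(** Averaging is done twice, over all points and then over the planes on a point of excess 0. Each
    time the count falls short of the one for excess at least 1 everywhere by at least q + 1. *)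
Lemma thin_plane : exists rho, \dim rho = 3 /\ #|trace rho| = q.+1.
Proof.
have q1 := q_gt1 F.
have [P [dP bP]] : exists P, \dim P = 1 /\ #|star P| = q.+1.
  have [/exists_inP[P /pointsP[dP _] /eqP bP]|/exists_inPn none] :=
    boolP [exists P in points (fullv : T), #|star P| == q.+1]; first by exists P.
  have : q.+2 * #|points (fullv : T)| <= \sum_(P in points (fullv : T)) #|star P|.
    apply: sum_ge_const => P Pf; have [dP _] := pointsP _ _ Pf.
    by have := star_card BBdim BBblk dP; have := none P Pf; clear; lia.
  rewrite sum_star card_points4; move: BBcard q1; rewrite !expnS expn0; clear; nia.
have [/exists_inP[pi]|/exists_inPn none] := boolP [exists pi in planes P, #|trace pi| == q.+1].
  by rewrite inE => /andP[/eqP dpi _] /eqP; exists pi.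
have : q.+2 * #|planes P| <= \sum_(pi in planes P) #|trace pi|.
  apply: sum_ge_const => pi piP; have := none pi piP; move: piP; rewrite inE => /andP[/eqP dpi _].
  by have := trace_card BBdim BBblk dpi; clear; lia.
rewrite sum_trace_point // bP card_planes_point //; move: BBcard q1; rewrite !expnS expn0; clear; nia.
Qed.

Lemma thin_point rho : \dim rho = 3 -> #|trace rho| = q.+1 ->
  exists O, [/\ \dim O = 1, (O <= rho)%VS &
    forall n, \dim n = 2 -> (n <= rho)%VS -> (n \in BB) = (O <= n)%VS].
Proof.
move=> dr tr; have [O [dO Or h]] : exists O, [/\ \dim O = 1, (O <= rho)%VS &
    forall n, \dim n = 2 -> (O <= n)%VS -> (n <= rho)%VS -> n \in BB].
  by apply: (trace_full BBdim BBblk dr); rewrite tr.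
exists O; split=> // n dn nr; apply/idP/idP => [nB|On]; last exact: h.
have : flag O rho == trace rho.
  rewrite eqEcard tr -(card_pencil dO dr Or); apply/andP; split.
    by apply/subsetP => m; rewrite !inE => /and3P[-> _ ->].
  by apply: subset_leq_card; apply/subsetP => m; rewrite !inE => /andP[/andP[/eqP dm mr] Om]; rewrite h ?Om.
move/eqP/setP/(_ n); rewrite !inE nB nr /= andbT; exact.
Qed.

(** The value is |BB| + q (q + 1) - (q + 1)(q^2 + q + 1), which is q^2 at the extreme size of BB. *)
Lemma sum_eP rho : \dim rho = 3 -> #|trace rho| = q.+1 -> \sum_(P in points rho) eP P <= q ^ 2.
Proof.
move=> dr tr; have := sum_star_plane dr; rewrite tr.
have -> : \sum_(P in points rho) #|star P| = q.+1 * #|points rho| + \sum_(P in points rho) eP P.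
  rewrite mulnC -sum_nat_const -big_split; apply: eq_bigr => P /pointsP[dP _].
  by rewrite starE.
rewrite card_points3 //; move: BBcard (\sum_(P in _) eP P); rewrite !expnS expn0; clear; nia.
Qed.

End Thin.

(** * Three clean lines *)

Section Weights.
Variable F : finFieldType.
Notation V := 'rV[F]_4.
Notation T := {vspace V}.
Implicit Types U P R O l m n pi g rho C : T.
Notation q := #|F|.

Variables (rho O : T) (e : T -> nat).
Hypothesis dr : \dim rho = 3.
Hypothesis dO : \dim O = 1.
Hypothesis Or : (O <= rho)%VS.
Hypothesis q4 : 4 <= q.
Hypothesis sum_e : \sum_(P in points rho) e P <= q ^ 2.

Definition weight l := \sum_(P in points l) e P.

Lemma sum_weight (L : {set T}) : L \subset lines_in rho ->
  \sum_(n in L) weight n = \sum_(P in points rho) e P * #|[set n in L | (P <= n)%VS]|.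
Proof.
move=> sL; transitivity (\sum_(n in L) \sum_(P in points rho) e P * (P <= n)%VS).
  apply: eq_bigr => n nL; move: (subsetP sL _ nL); rewrite inE => /andP[_ nr].
  rewrite /weight -(points_lineE nr) big_mkcond [RHS]big_mkcond; apply: eq_bigr => P _.
  by rewrite !inE; case: (\dim P == 1) => //=; case: (P <= rho)%VS => //=; case: (P <= n)%VS;
    rewrite ?muln1 ?muln0.
by rewrite exchange_big; apply: eq_bigr => P _; rewrite -big_distrr card_filter_sum.
Qed.

Lemma line_join_in P R n : \dim P = 1 -> \dim R = 1 -> \dim n = 2 -> P != R ->
  (P <= n)%VS -> (R <= n)%VS -> (n == P + R)%VS.
Proof. by move=> dP dR dn ne Pn Rn; apply/eqP; apply: line_joinE. Qed.

Let pencil_set P := [set n in lines_in rho | (P <= n)%VS].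

Let card_pencil_set P : P \in points rho -> #|pencil_set P| = q.+1.
Proof. by move/pointsP => [dP Pr]; apply: card_pencil. Qed.

Let join_pencil P R : P \in points rho -> R \in points rho -> P != R -> (P + R)%VS \in pencil_set P.
Proof.
move=> /pointsP[dP Pr] /pointsP[dR Rr] ne.
by rewrite !inE joinPP // subv_add Pr Rr addvSl.
Qed.

Let Op : O \in points rho. Proof. exact/pointsP. Qed.

Lemma card_off P (L : {set T}) : P \in points rho ->
  L \subset [set n in lines_in rho | ~~ (O <= n)%VS] -> #|[set n in L | (P <= n)%VS]| <= q.
Proof.
move=> Pp sL; have [->|ne] := eqVneq P O.
  rewrite (_ : [set n in L | _] = set0) ?cards0 //; apply/setP => n; rewrite !inE.
  by apply/negP => /andP[/(subsetP sL)]; rewrite !inE => /andP[_ /negPf->].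
have h := cardsD1 (P + O)%VS (pencil_set P); move: h; rewrite join_pencil // card_pencil_set // => -[->].
apply: subset_leq_card; apply/subsetP => n; rewrite in_setD1 !inE => /andP[nL Pn].
move: (subsetP sL _ nL); rewrite !inE => /andP[-> On]; rewrite Pn !andbT.
by apply: contraNneq On => ->; rewrite addvSr.
Qed.

Section Avoid.
Variable C : T.
Hypothesis Cp : C \in points rho.
Hypothesis CO : C != O.

Let L0 := [set n in lines_in rho | ~~ (O <= n)%VS && ~~ (C <= n)%VS].
Let dC : \dim C = 1. Proof. by case/pointsP: Cp. Qed.
Let Cr : (C <= rho)%VS. Proof. by case/pointsP: Cp. Qed.
Let m := (O + C)%VS.
Let dm : \dim m = 2. Proof. by rewrite joinPP // eq_sym. Qed.
Let mr : (m <= rho)%VS. Proof. by rewrite subv_add Or. Qed.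

Let L0P n : n \in L0 -> [/\ \dim n = 2, (n <= rho)%VS, ~~ (O <= n)%VS & ~~ (C <= n)%VS].
Proof. by rewrite !inE => /andP[/andP[/eqP -> ->] /andP[-> ->]]. Qed.

(** Lines of [L0] are sorted by their intersection with [m]: there are q - 1 points of [m] other
    than O and C, each with q lines besides [m]. *)
Let card_L0 : q.-1 * q <= #|L0|.
Proof.
have <- : \sum_(n in L0) #|[set R in points m | (R <= n)%VS]| = #|L0|.
  rewrite -sum1_card; apply: eq_bigr => n /L0P[dn nr On _].
  have ne : m != n by apply: contraNneq On => <-; rewrite addvSl.
  have d1 := lines_cap dm dn dr ne mr nr.
  apply/eqP/cards1P; exists (m :&: n)%VS; apply/setP => P; rewrite !inE.
  apply/idP/eqP => [/andP[/andP[/eqP dP Pm] Pn]|->]; first exact: point_in_cap.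
  by rewrite d1 eqxx capvSl capvSr.
rewrite (exchange_card L0 (points m) (fun n R => (R <= n)%VS)).
have sm : points m :\ O :\ C \subset points m by rewrite setDDl subsetDl.
apply: leq_trans (sum_sub_le _ sm).
have -> : q.-1 = #|points m :\ O :\ C|.
  have := cardsD1 O (points m); have := cardsD1 C (points m :\ O).
  rewrite card_points2 // !inE CO dC dO addvSl addvSr /= => h1 h2.
  by move: h1 h2; move: #|_ :\ C| #|_ :\ O| #|F|; clear; lia.
rewrite mulnC; apply: sum_ge_const => R; rewrite !in_setD1 => /and3P[RC RO /pointsP[dR Rm]].
have Rp : R \in points rho by apply/pointsP; rewrite (subv_trans Rm).
have := cardsD1 m (pencil_set R); rewrite card_pencil_set // !inE dm mr Rm /= => -[->].
apply: subset_leq_card; apply/subsetP => n; rewrite in_setD1 !inE => /andP[nm /andP[/andP[/eqP dn nr] Rn]].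
rewrite dn nr Rn /= andbT; apply/andP; split; apply: contraNN nm => h.
  by rewrite (line_joinE dR dO dn RO Rn h) eq_sym line_join_in ?addvSl.
by rewrite (line_joinE dR dC dn RC Rn h) eq_sym line_join_in ?addvSr.
Qed.

Let card_L0_through R : R \in points rho -> ~~ (R <= m)%VS -> #|[set n in L0 | (R <= n)%VS]| <= q.-1.
Proof.
move=> Rp Rm; have [dR Rr] := pointsP _ _ Rp.
have RO : R != O by apply: contraNneq Rm => ->; rewrite addvSl.
have RC : R != C by apply: contraNneq Rm => ->; rewrite addvSr.
have ne : (R + O != R + C)%VS.
  apply: contraNneq Rm => E; rewrite (_ : m = (R + O)%VS) ?addvSl //.
  by apply/vs_eq; [rewrite /m subv_add addvSr E addvSr | rewrite joinPP ?dm].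
have := cardsD1 (R + O)%VS (pencil_set R); have := cardsD1 (R + C)%VS (pencil_set R :\ (R + O)%VS).
rewrite join_pencil // card_pencil_set // in_setD1 eq_sym ne join_pencil //.
have : #|[set n in L0 | (R <= n)%VS]| <= #|pencil_set R :\ (R + O)%VS :\ (R + C)%VS|.
  apply: subset_leq_card; apply/subsetP => n; rewrite !in_setD1 inE => /andP[/L0P[dn nr On Cn] Rn].
  rewrite !inE dn nr Rn /= andbT; apply/andP; split.
    by apply: contraNneq Cn => ->; rewrite addvSr.
  by apply: contraNneq On => ->; rewrite addvSr.
by move: #|[set n in L0 | _]| #|_ :\ (R + C)%VS| #|_ :\ (R + O)%VS| #|F|; clear; lia.
Qed.

(** Avoiding a point of D costs at most q - 1 lines but removes at least q from the total excess. If
    no line of [L] were clean, then 2 (q - 1) #|L| <= q * (q^2 - q #|D|) with #|L| >= (q - 1)(q -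
    #|D|), hence 2 (q - 1)^2 <= q^2, which is false from q = 4 on. *)
Lemma clean_line (D : {set T}) : D \subset points rho -> #|D| <= 2 ->
  (forall R, R \in D -> ~~ (R <= O + C)%VS /\ q <= e R) ->
  exists l, [/\ \dim l = 2, (l <= rho)%VS, ~~ (O <= l)%VS, ~~ (C <= l)%VS &
    (forall R, R \in D -> ~~ (R <= l)%VS) /\ weight l + 3 <= 2 * q].
Proof.
move=> sD D2 hD; pose L := [set n in L0 | [forall R in D, ~~ (R <= n)%VS]].
have sL0 : L \subset L0 by apply/subsetP => n; rewrite inE => /andP[].
have cL : #|L0| <= #|L| + q.-1 * #|D|.
  rewrite -(cardsID L L0) (setIidPr sL0) leq_add2l.
  have : \sum_(R in D) #|[set n in L0 | (R <= n)%VS]| <= q.-1 * #|D|.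
    apply: sum_le_const => R RD; have [Rm _] := hD R RD.
    by apply: card_L0_through => //; apply: subsetP RD.
  apply: leq_trans; rewrite -(exchange_card L0 D (fun n R => (R <= n)%VS)).
  apply: leq_trans (sum_sub_le _ (subsetDl L0 L)); rewrite -sum1_card; apply: leq_sum => n.
  rewrite in_setD inE => /andP[+ nL0]; rewrite nL0 /= => /forall_inPn[R RD].
  by rewrite negbK => Rn; apply/card_gt0P; exists R; rewrite inE RD.
have [/exists_inP[l lL le]|/exists_inPn none] := boolP [exists l in L, weight l + 3 <= 2 * q].
  exists l; have [dl lr Ol Cl] := L0P (subsetP sL0 _ lL); split=> //; split=> // R RD.
  by move: lL; rewrite inE => /andP[_ /forall_inP]; apply.
have s1 : 2 * q.-1 * #|L| <= \sum_(n in L) weight n.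
  by apply: sum_ge_const => n nL; have := none n nL; move: (weight n) #|F| q4; clear; lia.
have sL : L \subset [set n in lines_in rho | ~~ (O <= n)%VS].
  by apply/subsetP => n /(subsetP sL0)/L0P[dn nr On _]; rewrite !inE dn nr On.
have sL' : L \subset lines_in rho.
  by apply: subset_trans sL _; apply/subsetP => n; rewrite inE => /andP[].
have s2 : \sum_(n in L) weight n <= q * \sum_(P in points rho :\: D) e P.
  rewrite sum_weight // (sum_setID _ sD) big1 => [|R RD]; last first.
    rewrite (_ : [set n in L | _] = set0) ?cards0 ?muln0 //; apply/setP => n; rewrite !inE.
    by apply/negP => /andP[/andP[_ /forall_inP/(_ R RD)/negPf->]].
  rewrite add0n big_distrr; apply: leq_sum => P /setDP[Pp _].
  by rewrite mulnC leq_mul2r card_off ?orbT.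
have s3 : q * #|D| + \sum_(P in points rho :\: D) e P <= q ^ 2.
  apply: leq_trans sum_e; rewrite (sum_setID _ sD) leq_add2r.
  by apply: sum_ge_const => R /hD[].
exfalso; move: cL s1 s2 s3 D2 q4 card_L0; rewrite !expnS expn0.
move: #|L0| #|L| #|D| (\sum_(n in L) _) (\sum_(P in _ :\: _) _) #|F|; clear.
move=> a b k x y p; case: k => [|[|[|k]]] //; nia.
Qed.

End Avoid.

Lemma exists_off : exists2 C, C \in points rho & C != O.
Proof.
have := cardsD1 O (points rho); rewrite Op card_points3 // => h.
have [C] : exists C, C \in points rho :\ O.
  by apply/card_gt0P; move: h q4; move: #|_ :\ O|; rewrite expnS expn1; clear; nia.
by rewrite in_setD1 => /andP[CO Cp]; exists C.
Qed.

Definition clean l := [&& \dim l == 2, (l <= rho)%VS, ~~ (O <= l)%VS & weight l + 3 <= 2 * q].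

Lemma cleanP l : reflect [/\ \dim l = 2, (l <= rho)%VS, ~~ (O <= l)%VS & weight l + 3 <= 2 * q] (clean l).
Proof. by apply: (iffP and4P) => -[/eqP ? ? ? ?]; split=> //; apply/eqP. Qed.

Lemma clean_heavy l P R : clean l -> P \in points l -> R \in points l ->
  q <= e P -> q <= e R -> P = R.
Proof.
case/cleanP => _ _ _ le Pl Rl hP hR; apply: contraTeq le => ne.
have : [set P; R] \subset points l by rewrite subUset !sub1set Pl.
move/sum_sub_le => /(_ e); rewrite -/(weight l) (bigD1 P) ?inE ?eqxx //= (bigD1 R) /=; last first.
  by rewrite !inE eqxx orbT eq_sym.
move=> h; have : q + q <= weight l.
  by apply: leq_trans h; rewrite addnA; apply: leq_trans (leq_add hP hR) (leq_addr _ _).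
by rewrite -ltnNge; move: (weight l) #|F|; clear; lia.
Qed.

(** A clean line has no room for two points of excess q. When it has none, C is an arbitrary point,
    so that later constructions need no case distinction. *)
Lemma clean_heavy_at l : clean l -> exists2 C, C \in points l &
  forall P, P \in points l -> q <= e P -> P = C.
Proof.
move=> cl; have [/exists_inP[C Cl hC]|/exists_inPn none] := boolP [exists C in points l, q <= e C].
  by exists C => // P Pl hP; apply: clean_heavy cl _ _ _ _.
have [dl _ _ _] := cleanP _ cl.
have [C Cl] : exists C, C \in points l by apply/card_gt0P; rewrite card_points2.
by exists C => // P Pl hP; move: (none P Pl); rewrite hP.
Qed.

Let clean_points l P : clean l -> P \in points l -> [/\ P \in points rho, \dim P = 1, P != O & (P <= l)%VS].
Proof.
move=> /cleanP[dl lr Ol _] /pointsP[dP Pl]; split=> //; first by apply/pointsP; rewrite (subv_trans Pl).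
by apply: contraNneq Ol => <-.
Qed.

Let clean_cap l l' : clean l -> clean l' -> l != l' -> (l :&: l')%VS \in points l /\ (l :&: l')%VS \in points l'.
Proof.
move=> /cleanP[dl lr _ _] /cleanP[dl' lr' _ _] ne; have d1 := lines_cap dl dl' dr ne lr lr'.
by split; apply/pointsP; rewrite ?capvSl ?capvSr.
Qed.

(* Lines of a given kind are found by double counting, l2 avoiding the heavy point of l1, and l3
   avoiding those of l1 and l2 as well as the point where l1 and l2 meet. *)
Lemma clean_triangle : exists l1 l2 l3,
  [/\ [/\ clean l1, clean l2 & clean l3], [/\ l1 != l2, l1 != l3 & l2 != l3],
   ~~ (l1 :&: l2 <= l3)%VS & [/\ e (l1 :&: l2) < q, e (l1 :&: l3) < q & e (l2 :&: l3) < q]].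
Proof.
have no_D C : forall R, R \in (set0 : {set T}) -> ~~ (R <= O + C)%VS /\ q <= e R by move=> R; rewrite inE.
have clean_avoid C : C \in points rho -> C != O -> exists2 l, clean l & ~~ (C <= l)%VS.
  move=> Cp CO; have [|l [dl lr Ol Cl [_ le]]] := clean_line Cp CO (sub0set _) _ (no_D C).
    by rewrite cards0.
  by exists l => //; apply/cleanP.
have [C0 C0p C0O] := exists_off; have [l1 c1 _] := clean_avoid _ C0p C0O.
have [C1 C1l h1] := clean_heavy_at c1; have [C1p dC1 C1O C1l1] := clean_points c1 C1l.
have [l2 c2 C1l2] := clean_avoid _ C1p C1O.
have ne12 : l1 != l2 by apply: contraNneq C1l2 => <-.
have [X1 X2] := clean_cap c1 c2 ne12; set X := (l1 :&: l2)%VS in X1 X2 *.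
have [Xp dX XO Xl1] := clean_points c1 X1.
have eX : e X < q.
  rewrite ltnNge; apply/negP => /(h1 _ X1) E; move: C1l2; rewrite -E capvSr //.
have [C2 C2l h2] := clean_heavy_at c2; have [C2p dC2 C2O C2l2] := clean_points c2 C2l.
(* Only those of C1 and C2 that are really heavy are to be avoided, since [clean_line] pays for each
   member of D with its excess. The point X takes the part of C there. *)
pose D := [set R in [set C1; C2] | q <= e R].
have off l R : clean l -> X \in points l -> R \in points l -> q <= e R -> ~~ (R <= O + X)%VS.
  move=> cl Xl Rl hR; have [_ dR _ Rl'] := clean_points cl Rl; have [_ _ _ Xl'] := clean_points cl Xl.
  have [dl _ Ol _] := cleanP _ cl.
  have RX : R != X by apply: contraTneq hR => ->; rewrite -ltnNge.
  apply: contra Ol => h; have -> : l = (O + X)%VS.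
    apply: vs_eq; last by rewrite dl joinPP // eq_sym.
    by rewrite (line_joinE dR dX dl RX Rl' Xl') subv_add h addvSr.
  exact: addvSl.
have [||R|l3 [dl3 l3r Ol3 Xl3 [Dl3 le3]]] := @clean_line X Xp XO D.
- by apply/subsetP => R; rewrite !inE => /andP[/orP[]/eqP -> _]; rewrite ?C1p ?C2p; move: C1p C2p; rewrite !inE.
- apply: leq_trans (_ : #|[set C1; C2]| <= 2); last by rewrite cards2; case: (_ != _).
  by apply: subset_leq_card; apply/subsetP => R; rewrite inE => /andP[].
- rewrite !inE => /andP[/orP[]/eqP -> h]; split=> //; [exact: off c1 _ _ _ | exact: off c2 _ _ _].
have c3 : clean l3 by apply/cleanP.
have ne13 : l1 != l3 by apply: contraNneq Xl3 => <-; apply: capvSl.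
have ne23 : l2 != l3 by apply: contraNneq Xl3 => <-; apply: capvSr.
have [Y1 Y3] := clean_cap c1 c3 ne13; have [Z2 Z3] := clean_cap c2 c3 ne23.
exists l1, l2, l3; split=> //; split=> //.
  rewrite ltnNge; apply/negP => hY; have E := h1 _ Y1 hY.
  have /Dl3 : C1 \in D by rewrite !inE eqxx -E hY.
  by rewrite -E capvSr.
rewrite ltnNge; apply/negP => hY; have E := h2 _ Z2 hY.
have /Dl3 : C2 \in D by rewrite !inE eqxx orbT -E hY.
by rewrite -E capvSr.
Qed.

End Weights.

(** * Alternating forms *)

Section Form.
Variable F : finFieldType.
Notation V := 'rV[F]_4.
Notation T := {vspace V}.
Implicit Types U W P R O l m n pi g rho C : T.
Implicit Types x y z : V.

Definition alternating (a : V -> V -> F) : Prop :=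
  [/\ forall c x y z, a (c *: x + y) z = c * a x z + a y z,
      forall x y, a x y = - a y x & forall x, a x x = 0]%R.

Section Alternating.
Variable a : V -> V -> F.
Hypothesis alt : alternating a.

Definition orth U W := [forall x in U, forall y in W, a x y == 0%R].

Lemma orthP U W : reflect (forall x y, x \in U -> y \in W -> a x y = 0%R) (orth U W).
Proof.
apply: (iffP forall_inP) => h x => [y xU yW|xU]; last by apply/forall_inP => y yW; rewrite h.
by move/forall_inP: (h x xU) => /(_ y yW)/eqP.
Qed.

Lemma alt_linear c x y z : (a (c *: x + y) z = c * a x z + a y z)%R.
Proof. by case: alt. Qed.
Lemma alt_anti x y : (a x y = - a y x)%R. Proof. by case: alt. Qed.
Lemma altxx x : a x x = 0%R. Proof. by case: alt. Qed.
Lemma altDl x y z : (a (x + y) z = a x z + a y z)%R.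
Proof. by rewrite -[x]scale1r alt_linear scale1r mul1r. Qed.
Lemma alt0l z : (a 0 z = 0)%R.
Proof.
by have := alt_linear 1 0 0 z; rewrite scaler0 addr0 mul1r => /eqP;
  rewrite -[X in X == _]addr0 (inj_eq (addrI _)) => /eqP.
Qed.
Lemma altZl c x z : (a (c *: x) z = c * a x z)%R.
Proof. by rewrite -[X in a X](addr0) alt_linear alt0l addr0. Qed.
Lemma altDr x y z : (a z (x + y) = a z x + a z y)%R.
Proof. by rewrite alt_anti altDl opprD -!alt_anti. Qed.
Lemma altZr c x z : (a z (c *: x) = c * a z x)%R.
Proof. by rewrite alt_anti altZl -mulrN -alt_anti. Qed.

Lemma orth_sym U W : orth U W = orth W U.
Proof.
by apply/orthP/orthP => h x y xU yW; rewrite alt_anti h ?oppr0.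
Qed.

Lemma orth_sub U U' W W' : (U <= U')%VS -> (W <= W')%VS -> orth U' W' -> orth U W.
Proof. by move=> /subvP sU /subvP sW /orthP h; apply/orthP => x y /sU xU /sW; apply: h. Qed.

Lemma orthDr U W W' : orth U (W + W')%VS = orth U W && orth U W'.
Proof.
apply/idP/andP => [h|[/orthP h /orthP h']].
  by split; apply: orth_sub h; rewrite ?addvSl ?addvSr.
by apply/orthP => x _ xU /memv_addP[y yW [z zW ->]]; rewrite altDr h ?h' ?addr0.
Qed.

Lemma orthDl U W W' : orth (W + W')%VS U = orth W U && orth W' U.
Proof. by rewrite ![orth _ U]orth_sym orthDr. Qed.

Lemma orth_line x U : reflect (forall y, y \in U -> a x y = 0%R) (orth <[x]> U).
Proof.
apply: (iffP (orthP _ _)) => [h y|h _ y /vlineP[c ->] yU]; first by apply: h; apply: memv_line.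
by rewrite altZl h // mulr0.
Qed.

Lemma orth_vline x y : a x y = 0%R -> orth <[x]> <[y]>.
Proof. by move=> h; apply/orth_line => _ /vlineP[c ->]; rewrite altZr h mulr0. Qed.

Lemma orth_point P : \dim P = 1 -> orth P P.
Proof.
move=> /dim1E[x _ ->]; apply/orth_line => _ /vlineP[c ->].
by rewrite altZr altxx mulr0.
Qed.

(** Isotropy of a line can be tested at any one of its points, because every point is orthogonal to
    itself. *)
Lemma orth_self P n : \dim P = 1 -> \dim n = 2 -> (P <= n)%VS -> orth P n = orth n n.
Proof.
move=> dP dn Pn; apply/idP/idP => [h|]; last exact: orth_sub.
have [Z] : exists Z, Z \in points n :\ P.
  apply/card_gt0P; have := cardsD1 P (points n); rewrite card_points2 //.
  by have := q_gt1 F; move: #|F| (P \in _) #|_ :\ P|; clear => ? []; lia.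
rewrite in_setD1 eq_sym => /andP[ne /pointsP[dZ Zn]].
have E := line_joinE dP dZ dn ne Pn Zn.
rewrite {1}E orthDl h {1}E orthDr orth_point // andbT orth_sym.
exact: orth_sub h.
Qed.

Definition form_at z : V -> F^o := fun x => a x z.
Lemma form_at_linear z : linear (form_at z).
Proof. by move=> c x y; rewrite /form_at alt_linear. Qed.
HB.instance Definition _ z := GRing.isLinear.Build F V F^o *:%R (form_at z) (form_at_linear z).

Definition perp P := lker (linfun (form_at (vpick P))).

Lemma perpE P U : \dim P = 1 -> (U <= perp P)%VS = orth P U.
Proof.
move=> dP; have E : P = <[vpick P]>%VS.
  apply/esym/vs_eq; first by rewrite -memvE memv_pick.
  by rewrite dim_vline vpick0 -dimv_eq0 dP.
rewrite {2}E; apply/subvP/orth_line => h y yU.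
  by have := h y yU; rewrite memv_ker lfunE /= /form_at => /eqP E0; rewrite alt_anti E0 oppr0.
by rewrite memv_ker lfunE /= /form_at alt_anti h ?oppr0.
Qed.

Lemma dim_perp P : 3 <= \dim (perp P).
Proof.
have := limg_ker_dim (linfun (form_at (vpick P))) fullv; rewrite capfv dim_full -/(perp P).
have := dimvS (subvf (limg (linfun (form_at (vpick P))))); rewrite dimvf /dim /=.
by move: (\dim (perp P)) (\dim (limg _)); clear; lia.
Qed.

Lemma perp3 P R : \dim P = 1 -> ~~ orth P R -> \dim (perp P) = 3.
Proof.
move=> dP; rewrite -perpE // => h; have := dim_perp P.
have /dim_cap_lt : ~~ (fullv <= perp P)%VS by apply: contra h; apply: subv_trans (subvf R).
by rewrite capfv dim_full; lia.
Qed.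

End Alternating.

Lemma dim3_gen P R x g : \dim P = 1 -> \dim R = 1 -> P != R -> \dim g = 3 -> (P <= g)%VS -> (R <= g)%VS ->
  x \in g -> x \notin (P + R)%VS -> g = (P + R + <[x]>)%VS.
Proof.
move=> dP dR ne dg Pg Rg xg xn; apply/esym/vs_eq; first by rewrite !subv_add Pg Rg -memvE.
have x0 : x != 0%R by apply: contraNneq xn => ->; apply: mem0v.
by rewrite addvC dim_add1 ?joinPP ?dg // ?dim_vline ?x0 // -memvE.
Qed.

(** The requirement that O be the radical on rho fixes the restriction to rho up to a scalar. The
    three values against a vector off rho remain free, and each is fixed by one of the planes. *)
Lemma form_exists rho O P1 P2 P3 g1 g2 g3 :
  \dim rho = 3 -> \dim O = 1 -> \dim P1 = 1 -> \dim P2 = 1 -> \dim P3 = 1 ->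
  (P1 + P2 + P3 = rho)%VS -> (O <= rho)%VS ->
  ~~ (O <= P1 + P2)%VS -> ~~ (O <= P1 + P3)%VS -> ~~ (O <= P2 + P3)%VS ->
  [/\ \dim g1 = 3, (P1 <= g1)%VS, (O <= g1)%VS & g1 != rho] ->
  [/\ \dim g2 = 3, (P2 <= g2)%VS, (O <= g2)%VS & g2 != rho] ->
  [/\ \dim g3 = 3, (P3 <= g3)%VS, (O <= g3)%VS & g3 != rho] ->
  exists a, [/\ alternating a, [/\ orth a P1 g1, orth a P2 g2 & orth a P3 g3], orth a O rho &
    forall P, \dim P = 1 -> (P <= rho)%VS -> orth a P rho -> P = O].
Proof.
move=> dr dO d1 d2 d3 rE Or O12 O13 O23 hg1 hg2 hg3.
have [o o0 OE] := dim1E dO.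
have : o \in (P1 + P2 + P3)%VS by rewrite rE; move: Or; rewrite OE -memvE.
move/memv_addP => [e12 /memv_addP[e1 e1P [e2 e2P E12]] [e3 e3P oE]]; rewrite {}E12 in oE.
have e10 : e1 != 0%R.
  apply: contraNneq O23 => e0; rewrite OE -memvE oE e0 add0r memv_add //.
have e20 : e2 != 0%R.
  apply: contraNneq O13 => e0; rewrite OE -memvE oE e0 addr0 memv_add //.
have e30 : e3 != 0%R.
  apply: contraNneq O12 => e0; rewrite OE -memvE oE e0 addr0 memv_add //.
have genP P e : \dim P = 1 -> e \in P -> e != 0%R -> P = <[e]>%VS.
  by move=> dP eP e0; apply/esym/vs_eq; rewrite -?memvE // dim_vline e0 dP.
have [[P1E P2E] P3E] := (genP _ _ d1 e1P e10, genP _ _ d2 e2P e20, genP _ _ d3 e3P e30).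
have [w wr] : exists w, w \notin rho.
  apply/existsP; rewrite -negb_forall; apply/negP => /forallP h.
  by have /dimvS : (fullv <= rho)%VS by [apply/subvP => x _; apply: h]; rewrite dim_full dr.
pose X := [tuple e1; e2; e3; w].
have Xb : basis_of fullv X.
  rewrite basisEdim size_tuple dim_full leqnn andbT.
  rewrite span_cons span_cons span_cons span_seq1 -P1E -P2E -P3E !addvA rE.
  suff -> : (rho + <[w]>)%VS = fullv by [].
  apply: vs_eq; first exact: subvf.
  have w0 : w != 0%R by apply: contraNneq wr => ->; apply: mem0v.
  by rewrite addvC dim_add1 ?dim_full ?dr ?dim_vline ?w0 // -memvE.

have fX := basis_free Xb.
pose c (i : nat) x : F := coord X (inord i) x.
have cl i k x y : (c i (k *: x + y) = k * c i x + c i y)%R by rewrite /c linearP.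
have cX i j : i < 4 -> j < 4 -> (c i X`_j = (i == j)%:R)%R.
  move=> hi hj; rewrite /c -[Y in nth _ _ Y](inordK (n' := 3) hj) coord_free //.
  by rewrite -val_eqE /= !inordK // eq_sym.
have xE x : x = (c 0 x *: e1 + c 1 x *: e2 + c 2 x *: e3 + c 3 x *: w)%R.
  rewrite {1}(coord_basis Xb (memvf x)) !big_ord_recr big_ord0 /= add0r.
  by congr (_ + _ + _ + _)%R; congr (_ *: _)%R; rewrite /c; congr (coord _ _ _); apply/val_inj;
    rewrite /= inordK.
have c_rho x : (x \in rho) = (c 3 x == 0%R).
  have e123 : (c 0 x *: e1 + c 1 x *: e2 + c 2 x *: e3)%R \in rho.
    by rewrite -rE !memv_add // memvZ.
  rewrite {1}(xE x) rpredDl //; case: eqVneq => [->|n0]; first by rewrite scale0r mem0v.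
  apply/negP => /(memvZ (c 3 x)^-1%R); rewrite scalerA mulVf // scale1r.
  exact/negP.
have D i x y : (c i (x + y) = c i x + c i y)%R by rewrite /c linearD.
have ce1 i : i < 4 -> c i e1 = ((i == 0%N)%:R)%R by move=> hi; apply: (cX i 0).
have ce2 i : i < 4 -> c i e2 = ((i == 1%N)%:R)%R by move=> hi; apply: (cX i 1).
have ce3 i : i < 4 -> c i e3 = ((i == 2%N)%:R)%R by move=> hi; apply: (cX i 2).
have c_o i : i < 4 -> c i o = ((i != 3%N)%:R)%R.
  move=> hi; rewrite oE !D ce1 // ce2 // ce3 //.
  by move: hi; case: i => [|[|[|[|i]]]] //= _; rewrite ?addr0 ?add0r.
(* Since o = e1 + e2 + e3, taking value 1 on the cyclic pairs (e1,e2), (e2,e3), (e3,e1) makes o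
   orthogonal to rho; p_i is the value at (e_i, w). *)
pose fa (p1 p2 p3 : F) x y : F := ((c 0 x * c 1 y - c 1 x * c 0 y) + (c 1 x * c 2 y - c 2 x * c 1 y)
  + (c 2 x * c 0 y - c 0 x * c 2 y) + p1 * (c 0 x * c 3 y - c 3 x * c 0 y)
  + p2 * (c 1 x * c 3 y - c 3 x * c 1 y) + p3 * (c 2 x * c 3 y - c 3 x * c 2 y))%R.
have fa_alt p1 p2 p3 : alternating (fa p1 p2 p3).
  by split=> [k x y z|x y|x]; rewrite /fa ?cl; ring.
have fa1 p1 p2 p3 y : (fa p1 p2 p3 e1 y = c 1 y - c 2 y + p1 * c 3 y)%R.
  by rewrite /fa !ce1 //=; ring.
have fa2 p1 p2 p3 y : (fa p1 p2 p3 e2 y = c 2 y - c 0 y + p2 * c 3 y)%R.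
  by rewrite /fa !ce2 //=; ring.
have fa3 p1 p2 p3 y : (fa p1 p2 p3 e3 y = c 0 y - c 1 y + p3 * c 3 y)%R.
  by rewrite /fa !ce3 //=; ring.
have get_r P g : \dim P = 1 -> (P <= rho)%VS -> P != O -> [/\ \dim g = 3, (P <= g)%VS, (O <= g)%VS & g != rho] ->
    exists2 r, c 3 r != 0%R & g = (P + O + <[r]>)%VS.
  move=> dP Pr ne [dg Pg Og /vs_neq_sub nsub].
  have /subvPn[r rg rr] : ~~ (g <= rho)%VS by rewrite nsub ?dg.
  exists r; first by rewrite -c_rho.
  apply: dim3_gen => //; apply: contra rr => h; apply: subvP h; first by rewrite subv_add Pr.
have [r1 r10 g1E] : exists2 r, c 3 r != 0%R & g1 = (P1 + O + <[r]>)%VS.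
  apply: get_r => //; first by rewrite -rE -addvA addvSl.
  by apply: contraNneq O12 => <-; rewrite addvSl.
have [r2 r20 g2E] : exists2 r, c 3 r != 0%R & g2 = (P2 + O + <[r]>)%VS.
  apply: get_r => //; first by rewrite -rE [(P1 + P2)%VS]addvC -addvA addvSl.
  by apply: contraNneq O12 => <-; rewrite addvSr.
have [r3 r30 g3E] : exists2 r, c 3 r != 0%R & g3 = (P3 + O + <[r]>)%VS.
  apply: get_r => //; first by rewrite -rE addvSr.
  by apply: contraNneq O13 => <-; rewrite addvSr.
(* Each p_i solves a(e_i, r_i) = 0; the division is possible because r_i lies off rho. *)
pose a := fa (- (c 1 r1 - c 2 r1) / c 3 r1)%R (- (c 2 r2 - c 0 r2) / c 3 r2)%R (- (c 0 r3 - c 1 r3) / c 3 r3)%R.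
have alt : alternating a by apply: fa_alt.
exists a; split=> //.
- split.
  + rewrite g1E !orthDr // orth_point // P1E OE !orth_vline // /a fa1 ?c_o //= ?mulr0 ?subrr ?addr0 //.
    by rewrite divfK // addrN.
  + rewrite g2E !orthDr // orth_point // P2E OE !orth_vline // /a fa2 ?c_o //= ?mulr0 ?subrr ?addr0 //.
    by rewrite divfK // addrN.
  rewrite g3E !orthDr // orth_point // P3E OE !orth_vline // /a fa3 ?c_o //= ?mulr0 ?subrr ?addr0 //.
  by rewrite divfK // addrN.
- rewrite -rE orth_sym // !orthDl // P1E P2E P3E OE !orth_vline // /a ?fa1 ?fa2 ?fa3 !c_o //= mulr0 subrr addr0 //.
move=> P /dim1E[x x0 PE] Pr /orthP h; rewrite PE.
have xr : x \in rho by move: Pr; rewrite PE -memvE.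
have xP : x \in P by rewrite PE memv_line.
have c3x : c 3 x = 0%R by apply/eqP; rewrite -c_rho.
have e1r : e1 \in rho by rewrite -rE -addvA (subvP (addvSl _ _)).
have e2r : e2 \in rho by rewrite -rE [(P1 + P2)%VS]addvC -addvA (subvP (addvSl _ _)).
have := h _ _ xP e1r; rewrite alt_anti // /a fa1 c3x mulr0 addr0 => /eqP; rewrite oppr_eq0 subr_eq0 => /eqP E1.
have := h _ _ xP e2r; rewrite alt_anti // /a fa2 c3x mulr0 addr0 => /eqP; rewrite oppr_eq0 subr_eq0 => /eqP E2.
have xo : x = (c 0 x *: o)%R by rewrite {1}(xE x) c3x scale0r addr0 E1 E2 oE !scalerDr.
apply: vs_eq; first by rewrite -memvE xo OE memvZ ?memv_line.
by rewrite dO dim_vline x0.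
Qed.

End Form.

(** * The complex glued from three clean lines *)

Section Patch.
Variable F : finFieldType.
Notation V := 'rV[F]_4.
Notation T := {vspace V}.
Implicit Types U P R O l m n pi g rho C : T.
Notation q := #|F|.

Variable BB : {set T}.
Hypothesis BBdim : forall n, n \in BB -> \dim n = 2.
Hypothesis BBblk : forall P pi, \dim P = 1 -> \dim pi = 3 -> (P <= pi)%VS ->
  exists2 n, n \in BB & (P <= n)%VS && (n <= pi)%VS.
Hypothesis q4 : 4 <= q.
Notation eP := (eP BB).

Variables rho O : T.
Hypothesis dr : \dim rho = 3.
Hypothesis dO : \dim O = 1.
Hypothesis Or : (O <= rho)%VS.
Hypothesis thin : forall n, \dim n = 2 -> (n <= rho)%VS -> (n \in BB) = (O <= n)%VS.
Hypothesis sum_e : \sum_(P in points rho) eP P <= q ^ 2.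

Notation clean := (clean rho O eP).

Definition skew_partner l ls := [/\ \dim ls = 2, (O <= ls)%VS, (l :&: ls = 0)%VS &
  forall P R, \dim P = 1 -> (P <= l)%VS -> \dim R = 1 -> (R <= ls)%VS -> (P + R)%VS \in BB].

Lemma clean_partner l : clean l -> exists ls, skew_partner l ls.
Proof.
move=> /cleanP[dl lr Ol le].
exact: (local_line BBdim BBblk dr dO Or thin dl lr Ol).
Qed.

Lemma skew_point l ls P : (l :&: ls = 0)%VS -> P \in points l -> ~~ (P <= ls)%VS.
Proof.
move=> sk /pointsP[dP Pl]; apply/negP => Pls; have : (P <= l :&: ls)%VS by rewrite subv_cap Pl.
by rewrite sk => /dimvS; rewrite dimv0 dP.
Qed.

(** Every line on P in the plane [P + ls] meets [ls], hence is one of the given transversals. *)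
Lemma partner_plane l ls P : skew_partner l ls -> P \in points l ->
  \dim (P + ls) = 3 /\ pencil BB P (P + ls).
Proof.
move=> [dls Ols sk tr] Pl; have Pls := skew_point sk Pl; have [dP Pl'] := pointsP _ _ Pl.
have d3 : \dim (P + ls) = 3 by rewrite dim_add1 ?dls.
split=> //; apply/pencilP => n dn Pn np.
have ne : n != ls by apply: contraNneq Pls => <-.
have d1 := lines_cap dn dls d3 ne np (addvSr _ _).
have nR : P != (n :&: ls)%VS by apply: contraNneq Pls => ->; apply: capvSr.
by rewrite (line_joinE dP d1 dn nR Pn (capvSl _ _)); apply: tr; rewrite // capvSr.
Qed.

Lemma partner_neq l ls P : clean l -> skew_partner l ls -> (P + ls)%VS != rho.
Proof.
move=> /cleanP[dl lr Ol le] [dls Ols sk tr]; apply/eqP => E.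
have lsr : (ls <= rho)%VS by rewrite -E addvSr.
have ne : l != ls by apply: contraNneq Ol => ->.
by have := lines_cap dl dls dr ne lr lsr; rewrite sk dimv0.
Qed.

Section WithForm.
Variable a : V -> V -> F.
Hypothesis alt : alternating a.
Hypothesis radO : orth a O rho.
Hypothesis rad : forall P, \dim P = 1 -> (P <= rho)%VS -> orth a P rho -> P = O.

Definition good P := pencil BB P (perp a P).

Lemma dim_perp_rho P : P \in points rho -> P != O -> \dim (perp a P) = 3.
Proof.
by move=> /pointsP[dP Pr] ne; apply: (@perp3 _ _ alt _ rho) => //; apply: contraNN ne => /rad->.
Qed.

Lemma clean_point l P : clean l -> P \in points l -> P \in points rho /\ P != O.
Proof.
move=> /cleanP[dl lr Ol _] /pointsP[dP Pl]; split; first by apply/pointsP; rewrite (subv_trans Pl).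
by apply: contraNneq Ol => <-.
Qed.

Lemma absorbed l ls P : clean l -> skew_partner l ls -> orth a l ls -> P \in points l -> good P.
Proof.
move=> cl sp o Pl; have [d3 pen] := partner_plane sp Pl; have [Pr PO] := clean_point cl Pl.
have [dP Pl'] := pointsP _ _ Pl; rewrite /good.
suff <- : (P + ls)%VS = perp a P by [].
apply: vs_eq; last by rewrite dim_perp_rho ?d3.
by rewrite perpE // orthDr // orth_point //; apply: orth_sub o.
Qed.

(** P carries full pencils in [P + ls] and in its polar plane. Excess below q forces these planes to
    coincide. *)
Lemma light_orth l ls P : clean l -> skew_partner l ls -> P \in points l -> good P -> eP P < q ->
  orth a P ls.
Proof.
move=> cl sp Pl gP lt; have [d3 pen] := partner_plane sp Pl; have [Pr PO] := clean_point cl Pl.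
have [dP Pl'] := pointsP _ _ Pl.
have Pp : (P <= perp a P)%VS by rewrite perpE // orth_point.
by rewrite -perpE // -(pencil_uniq BBdim BBblk dP d3 (dim_perp_rho Pr PO) (addvSl _ _) Pp pen gP lt) addvSr.
Qed.

(** The propagation step: two light good points make the whole clean line orthogonal to its partner,
    and then the polar plane of each of its points contains the partner. *)
Lemma absorption l P P' : clean l -> P \in points l -> P' \in points l -> P != P' ->
  good P -> good P' -> eP P < q -> eP P' < q -> forall R, R \in points l -> good R.
Proof.
move=> cl Pl Pl' ne gP gP' lt lt' R Rl; have [ls sp] := clean_partner cl.
apply: (absorbed cl sp) Rl; have [[dP Pl0] [dP' Pl0']] := (pointsP _ _ Pl, pointsP _ _ Pl').
have [dl _ _ _] := cleanP _ _ _ _ cl.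
by rewrite (line_joinE dP dP' dl ne Pl0 Pl0') orthDl // !(light_orth cl sp).
Qed.

End WithForm.

(** At a vertex of the triangle both sides supply a full pencil, and the vertex being light, the two
    planes agree. So the plane given to [form_exists] at a vertex serves both sides, each side
    becomes orthogonal to its partner, and [absorbed] applies. *)
Lemma patch_form : exists a l1 l2 l3, [/\ [/\ alternating a, orth a O rho &
  forall P, \dim P = 1 -> (P <= rho)%VS -> orth a P rho -> P = O],
  [/\ clean l1, clean l2 & clean l3],
  [/\ [/\ l1 != l2, l1 != l3 & l2 != l3], ~~ (l1 :&: l2 <= l3)%VS &
   [/\ eP (l1 :&: l2) < q, eP (l1 :&: l3) < q & eP (l2 :&: l3) < q]] &
  forall P, [|| P \in points l1, P \in points l2 | P \in points l3] -> good a P].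
Proof.
have [l1 [l2 [l3 [[c1 c2 c3] [n12 n13 n23] nc [e12 e13 e23]]]]] := clean_triangle dr dO Or q4 sum_e.
have [[ls1 s1] [ls2 s2] [ls3 s3]] := And3 (clean_partner c1) (clean_partner c2) (clean_partner c3).
have [[dl1 l1r O1 _] [dl2 l2r O2 _] [dl3 l3r O3 _]] := And3 (cleanP _ _ _ _ c1) (cleanP _ _ _ _ c2) (cleanP _ _ _ _ c3).
pose P3 := (l1 :&: l2)%VS; pose P2 := (l1 :&: l3)%VS; pose P1 := (l2 :&: l3)%VS.
have d3 : \dim P3 = 1 := lines_cap dl1 dl2 dr n12 l1r l2r.
have d2 : \dim P2 = 1 := lines_cap dl1 dl3 dr n13 l1r l3r.
have d1 : \dim P1 = 1 := lines_cap dl2 dl3 dr n23 l2r l3r.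
have n32 : P3 != P2 by apply: contraNneq nc => E; rewrite -/P3 E capvSr.
have n31 : P3 != P1 by apply: contraNneq nc => E; rewrite -/P3 E capvSr.
have n21 : P2 != P1.
  apply: contraNneq n32 => E; apply/eqP/esym/vs_eq; last by rewrite d2 d3.
  by rewrite subv_cap capvSl E capvSl.
have l1E : l1 = (P3 + P2)%VS by apply: line_joinE; rewrite ?capvSl.
have l2E : l2 = (P3 + P1)%VS by apply: line_joinE; rewrite ?capvSl ?capvSr.
have l3E : l3 = (P2 + P1)%VS by apply: line_joinE; rewrite ?capvSr.
have [P31 P32 P21] : [/\ P3 \in points l1, P3 \in points l2 & P2 \in points l1].
  by split; apply/pointsP; rewrite ?capvSl ?capvSr.
have [P23 P12 P13] : [/\ P2 \in points l3, P1 \in points l2 & P1 \in points l3].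
  by split; apply/pointsP; rewrite ?capvSl ?capvSr.
have plane_eq P l l' ls ls' : skew_partner l ls -> skew_partner l' ls' -> P \in points l -> P \in points l' ->
    eP P < q -> (P + ls = P + ls')%VS.
  move=> sp sp' Pl Pl' lt; have [[dg pg] [dg' pg']] := (partner_plane sp Pl, partner_plane sp' Pl').
  by have [dP _] := pointsP _ _ Pl; apply: (pencil_uniq BBdim BBblk dP) lt; rewrite ?addvSl.
have g3E := plane_eq _ _ _ _ _ s1 s2 P31 P32 e12.
have g2E := plane_eq _ _ _ _ _ s1 s3 P21 P23 e13.
have g1E := plane_eq _ _ _ _ _ s2 s3 P12 P13 e23.
have O_in ls l P : skew_partner l ls -> (O <= P + ls)%VS.
  by case=> _ Ols _ _; apply: subv_trans Ols (addvSr _ _).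
have [a [alt [o1 o2 o3] radO rad]] : exists a, [/\ alternating a,
   [/\ orth a P1 (P1 + ls2)%VS, orth a P2 (P2 + ls1)%VS & orth a P3 (P3 + ls1)%VS], orth a O rho &
    forall P, \dim P = 1 -> (P <= rho)%VS -> orth a P rho -> P = O].
  apply: form_exists => //.
  - rewrite addvC [(P1 + P2)%VS]addvC -l3E.
    apply: vs_eq; last by rewrite dim_add1 ?dl3 ?dr.
    by rewrite subv_add l3r (subv_trans (capvSl _ _)).
  - by rewrite addvC -l3E.
  - by rewrite addvC -l2E.
  - by rewrite addvC -l1E.
  - by split; rewrite ?addvSl ?(O_in _ _ _ s2) ?(partner_neq _ c2 s2) //; case: (partner_plane s2 P12).
  - by split; rewrite ?addvSl ?(O_in _ _ _ s1) ?(partner_neq _ c1 s1) //; case: (partner_plane s1 P21).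
  by split; rewrite ?addvSl ?(O_in _ _ _ s1) ?(partner_neq _ c1 s1) //; case: (partner_plane s1 P31).
exists a, l1, l2, l3; split=> // P /or3P[] Pl.
- apply: (absorbed alt rad c1 s1) Pl; rewrite l1E orthDl //; apply/andP.
  by split; [apply: orth_sub o3 | apply: orth_sub o2]; rewrite ?addvSr.
- apply: (absorbed alt rad c2 s2) Pl; rewrite l2E orthDl //; apply/andP.
  by split; [rewrite g3E in o3; apply: orth_sub o3 | apply: orth_sub o1]; rewrite ?addvSr.
apply: (absorbed alt rad c3 s3) Pl; rewrite l3E orthDl //; apply/andP.
by split; [rewrite g2E in o2; apply: orth_sub o2 | rewrite g1E in o1; apply: orth_sub o1]; rewrite ?addvSr.
Qed.


(* Let P be light.  A clean line on P without heavy points, or a clean line on P off the vertices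
   of the triangle, meets the sides in two distinct good light points.  If there is no such line, the
   q lines of rho on P and off O carry too much excess. *)
Lemma light_good : exists a, [/\ alternating a, orth a O rho,
  (forall P, \dim P = 1 -> (P <= rho)%VS -> orth a P rho -> P = O) &
  forall P, P \in points rho -> P != O -> eP P + 2 <= q -> good a P].
Proof.
have [a [l1 [l2 [l3 [[alt radO rad] [c1 c2 c3] [[n12 n13 n23] nc [e12 e13 e23]] gd]]]]] := patch_form.
exists a; split=> // P Pp PO eP2; apply: contraT => ng.
have [dP Pr] := pointsP _ _ Pp.
have gd1 R : R \in points l1 -> good a R by move=> h; apply: gd; rewrite h.
have gd2 R : R \in points l2 -> good a R by move=> h; apply: gd; rewrite h orbT.
have gd3 R : R \in points l3 -> good a R by move=> h; apply: gd; rewrite h !orbT.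
have [[dl1 l1r O1 _] [dl2 l2r O2 _] [dl3 l3r O3 _]] := And3 (cleanP _ _ _ _ c1) (cleanP _ _ _ _ c2) (cleanP _ _ _ _ c3).
have d12 : \dim (l1 :&: l2) = 1 := lines_cap dl1 dl2 dr n12 l1r l2r.
have d13 : \dim (l1 :&: l3) = 1 := lines_cap dl1 dl3 dr n13 l1r l3r.
have d23 : \dim (l2 :&: l3) = 1 := lines_cap dl2 dl3 dr n23 l2r l3r.
pose L := [set n in lines_in rho | (P <= n)%VS] :\ (P + O)%VS.
have LP n : n \in L -> [/\ \dim n = 2, (n <= rho)%VS, (P <= n)%VS & ~~ (O <= n)%VS].
  rewrite in_setD1 !inE => /andP[ne /andP[/andP[/eqP dn nr] Pn]]; split=> //.
  by apply: contra ne => On; rewrite (line_joinE dP dO dn PO Pn On).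
have cL : #|L| = q.
  have := cardsD1 (P + O)%VS [set n in lines_in rho | (P <= n)%VS].
  by rewrite card_pencil // !inE joinPP // subv_add Pr Or addvSl /= => h; apply: succn_inj; rewrite h.
have clean2 n R R' : n \in L -> clean n -> R \in points n -> R' \in points n -> R != R' ->
    good a R -> good a R' -> eP R < q -> eP R' < q -> False.
  move=> /LP[dn nr Pn On] cn Rn Rn' ne gR gR' lR lR'; move/negP: ng; apply.
  by apply: (absorption alt rad cn Rn Rn' ne gR gR' lR lR'); apply/pointsP.
have capL n l : n \in L -> clean l -> (forall R, R \in points l -> good a R) ->
    [/\ (n :&: l)%VS \in points n, (n :&: l)%VS \in points l & good a (n :&: l)%VS].
  move=> nL /cleanP[dl lr _ _] gl; have [dn nr Pn _] := LP n nL.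
  have ne : n != l by apply: contraNneq ng => E; apply: gl; apply/pointsP; rewrite -E.
  have d1 := lines_cap dn dl dr ne nr lr.
  have hl : (n :&: l)%VS \in points l by apply/pointsP; rewrite capvSr.
  by split; [apply/pointsP; rewrite capvSl | | apply: gl].
have noteq l l' R R' n : \dim (l :&: l') = 1 -> R = (n :&: l)%VS -> R' = (n :&: l')%VS ->
    \dim R = 1 -> R = R' -> R = (l :&: l')%VS.
  move=> d RE RE' dR E; apply: vs_eq; last by rewrite d dR.
  by rewrite subv_cap {1}RE capvSr E RE' capvSr.
(* Without a point of excess q, the intersections of n with the sides would be good and light, hence
   all equal by [clean2]; the three sides would be concurrent. *)
have three n : n \in L -> clean n -> (exists2 R, R \in points n & q <= eP R).
  move=> nL cn; have [Y1n Y1l gY1] := capL _ _ nL c1 gd1; have [Y2n Y2l gY2] := capL _ _ nL c2 gd2.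
  have [Y3n Y3l gY3] := capL _ _ nL c3 gd3.
  have [/exists_inP[R Rn hR]|/exists_inPn none] := boolP [exists R in points n, q <= eP R].
    by exists R.
  have lt R : R \in points n -> eP R < q by move=> Rn; rewrite ltnNge none.
  exfalso; have [E12|ne] := eqVneq (n :&: l1)%VS (n :&: l2)%VS; last first.
    exact: (clean2 n _ _ nL cn Y1n Y2n ne gY1 gY2 (lt _ Y1n) (lt _ Y2n)).
  have [E13|ne] := eqVneq (n :&: l1)%VS (n :&: l3)%VS; last first.
    exact: (clean2 n _ _ nL cn Y1n Y3n ne gY1 gY3 (lt _ Y1n) (lt _ Y3n)).
  have [dY1 _] := pointsP _ _ Y1n.
  move/negP: nc; apply; rewrite -(noteq l1 l2 _ _ n d12 erefl erefl dY1 E12) E13; exact: capvSr.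
have wge n : n \in L -> q + eP P <= weight eP n.
  move=> nL; have [dn nr Pn On] := LP n nL.
  have [cn|] := boolP (clean n); last first.
    by rewrite /clean dn nr On eqxx /= -ltnNge; move: (weight _ _) (eP P) #|F| eP2; clear => ? ? ?; lia.
  have [R Rn hR] := three n nL cn; have Pn' : P \in points n by apply/pointsP.
  have ne : R != P by apply: contraTneq hR => ->; rewrite -ltnNge; move: eP2; clear; lia.
  rewrite /weight (bigD1 R) //= (bigD1 P) /=; last by rewrite Pn' eq_sym.
  by rewrite addnA; apply: leq_trans (leq_addr _ _); rewrite leq_add2r.
(* At most three of the q >= 4 lines of [L] join P to a vertex. *)
have [n0 n0L [av1 av2 av3]] : exists2 n0, n0 \in L & [/\ ~~ (l1 :&: l2 <= n0)%VS,
    ~~ (l1 :&: l3 <= n0)%VS & ~~ (l2 :&: l3 <= n0)%VS].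
  pose D := [set (P + l1 :&: l2)%VS; (P + l1 :&: l3)%VS; (P + l2 :&: l3)%VS].
  have [n] : exists n, n \in L :\: D.
    apply/card_gt0P; have : #|L :&: D| <= 3.
      apply: leq_trans (subset_leq_card (subsetIr _ _)) _.
      by apply: leq_trans (leq_card_setU _ _) _; rewrite cards1 cards2; case: (_ != _).
    by rewrite cardsD cL; move: #|L :&: D| #|F| q4; clear; lia.
  case/setDP => nL; rewrite !inE !negb_or => /andP[/andP[h1 h2] h3].
  have [dn nr Pn On] := LP n nL.
  have av l l' : clean l -> (forall R, R \in points l -> good a R) -> \dim (l :&: l') = 1 ->
      n != (P + l :&: l')%VS -> ~~ (l :&: l' <= n)%VS.
    move=> cl gl d; apply: contra => An; apply/eqP; apply: line_joinE => //.
    by apply: contraNneq ng => E; apply: gl; apply/pointsP; rewrite dP E capvSl.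
  by exists n => //; split; [apply: (av l1 l2) | apply: (av l1 l3) | apply: (av l2 l3)].
have w0 : 2 * q.-1 <= weight eP n0.
  have [dn nr Pn On] := LP n0 n0L.
  have [cn|] := boolP (clean n0); last first.
    by rewrite /clean dn nr On eqxx /= -ltnNge; move: (weight _ _) #|F| q4; clear => ? ?; lia.
  exfalso.
  have [Y1n Y1l gY1] := capL _ _ n0L c1 gd1; have [Y2n Y2l gY2] := capL _ _ n0L c2 gd2.
  have [Y3n Y3l gY3] := capL _ _ n0L c3 gd3.
  have [[dY1 _] [dY2 _]] := (pointsP _ _ Y1n, pointsP _ _ Y2n).
  have ne12 : (n0 :&: l1)%VS != (n0 :&: l2)%VS.
    by apply: contraNneq av1 => E; rewrite -(noteq l1 l2 _ _ n0 d12 erefl erefl dY1 E) capvSl.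
  have ne13 : (n0 :&: l1)%VS != (n0 :&: l3)%VS.
    by apply: contraNneq av2 => E; rewrite -(noteq l1 l3 _ _ n0 d13 erefl erefl dY1 E) capvSl.
  have ne23 : (n0 :&: l2)%VS != (n0 :&: l3)%VS.
    by apply: contraNneq av3 => E; rewrite -(noteq l2 l3 _ _ n0 d23 erefl erefl dY2 E) capvSl.
  have light R R' : R \in points n0 -> R' \in points n0 -> R != R' -> q <= eP R -> eP R' < q.
    by move=> Rn Rn' ne hR; rewrite ltnNge; apply: contra ne => hR'; rewrite (clean_heavy cn Rn Rn' hR hR').
  have [h1|l1'] := leqP q (eP (n0 :&: l1)).
    exact: (clean2 n0 _ _ n0L cn Y2n Y3n ne23 gY2 gY3 (light _ _ Y1n Y2n ne12 h1) (light _ _ Y1n Y3n ne13 h1)).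
  have [h2|l2'] := leqP q (eP (n0 :&: l2)).
    exact: (clean2 n0 _ _ n0L cn Y1n Y3n ne13 gY1 gY3 l1' (light _ _ Y2n Y3n ne23 h2)).
  exact: (clean2 n0 _ _ n0L cn Y1n Y2n ne12 gY1 gY2 l1' l2').
have sL : L \subset lines_in rho by apply/subsetP => n /LP[dn nr _ _]; rewrite inE dn nr.
have lower : q.-1 * (q + eP P) + 2 * q.-1 <= \sum_(n in L) weight eP n.
  rewrite (bigD1 n0) //= addnC; apply: leq_add => //.
  have : (q + eP P) * #|L :\ n0| <= \sum_(n in L :\ n0) weight eP n.
    by apply: sum_ge_const => n; rewrite in_setD1 => /andP[_]; apply: wge.
  have := cardsD1 n0 L; rewrite n0L cL => ->.
  rewrite mulnC; congr (_ <= _); apply: eq_bigl => n; rewrite in_setD1 andbC //.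
have upper : \sum_(n in L) weight eP n <= q * eP P + (q ^ 2 - eP P).
  rewrite (sum_weight eP sL) (bigD1 P) //=; apply: leq_add.
    by rewrite mulnC leq_mul2r -cL subset_leq_card ?orbT //; apply/subsetP => n; rewrite inE => /andP[].
  apply: (@leq_trans (\sum_(R in points rho | R != P) eP R)).
    apply: leq_sum => R /andP[Rp ne]; rewrite -[leqRHS]muln1 leq_mul2l; apply/orP; right.
    have [dR Rr] := pointsP _ _ Rp.
    apply: (@leq_trans #|[set (P + R)%VS]|); last by rewrite cards1.
    apply: subset_leq_card; apply/subsetP => n; rewrite inE in_set1.
    by move=> /andP[/LP[dn nr Pn On] Rn]; apply/eqP; apply: line_joinE; rewrite // eq_sym.
  by move: sum_e; rewrite (bigD1 P) //=; move: (eP P) (\sum_(R in _ | _) eP R); clear; lia.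
(* With e the excess of P, [lower] is (q - 1) e + q^2 + q - 2 and [upper] is (q - 1) e + q^2; e <=
   q^2 makes the truncated subtraction in [upper] exact. *)
have : eP P <= q ^ 2 by move: sum_e; rewrite (bigD1 P) //=; apply: leq_trans; apply: leq_addr.
move: lower upper q4; rewrite !expnS expn0; move: (\sum_(n in L) _) (eP P) #|F|; clear.
by move=> s e q; nia.
Qed.

End Patch.

(** * Missing isotropic lines *)

Lemma double_count (T U : finType) (S : {set T}) (X : {set U}) (I : T -> U -> bool) k m :
  (forall z, z \in S -> k <= #|[set x in X | I z x]|) ->
  (forall x, x \in X -> #|[set z in S | I z x]| <= m) -> k * #|S| <= m * #|X|.
Proof.
move=> hk hm; apply: leq_trans (sum_ge_const hk) _.
by rewrite exchange_card; apply: sum_le_const.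
Qed.

Lemma card_sub1 (T : finType) (A : {set T}) x : (forall y, y \in A -> y = x) -> #|A| <= 1.
Proof. by move=> h; rewrite -(cards1 x); apply/subset_leq_card/subsetP => y /h ->; apply/set1P. Qed.

Section Complex.
Variable F : finFieldType.
Notation V := 'rV[F]_4.
Notation T := {vspace V}.
Implicit Types U P R O l m n pi g rho C z x tau Q : T.
Notation q := #|F|.

Variable BB : {set T}.
Hypothesis BBdim : forall n, n \in BB -> \dim n = 2.
Hypothesis BBblk : forall P pi, \dim P = 1 -> \dim pi = 3 -> (P <= pi)%VS ->
  exists2 n, n \in BB & (P <= n)%VS && (n <= pi)%VS.
Variable a : V -> V -> F.
Hypothesis alt : alternating a.

Definition isotropic : {set T} := [set n : T | (\dim n == 2) && orth a n n].
Definition extra := BB :\: isotropic.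
Definition missing := isotropic :\: BB.
Definition missing_on P := [set z in missing | (P <= z)%VS].
Definition radical P := orth a P fullv.

Lemma missingP z : z \in missing -> [/\ \dim z = 2, orth a z z & z \notin BB].
Proof. by rewrite !inE => /andP[zB /andP[/eqP dz oz]]. Qed.

Lemma perp_dim P : \dim P = 1 -> ~~ radical P -> \dim (perp a P) = 3.
Proof. by move=> dP nr; apply: perp3 nr. Qed.

Lemma sub_perp P : \dim P = 1 -> (P <= perp a P)%VS.
Proof. by move=> dP; rewrite perpE // orth_point. Qed.

Lemma perp_plane P tau : \dim P = 1 -> ~~ radical P -> \dim tau = 3 -> orth a P tau -> tau = perp a P.
Proof. by move=> dP nr dt o; apply: vs_eq; rewrite ?perpE // perp_dim ?dt. Qed.

Lemma isotropic_on P : \dim P = 1 -> ~~ radical P ->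
  [set n in isotropic | (P <= n)%VS] = [set n in lines_in (perp a P) | (P <= n)%VS].
Proof.
move=> dP nr; apply/setP => n; rewrite !inE; case: eqP => //= dn; case Pn: (P <= n)%VS; rewrite ?andbF //.
by rewrite !andbT perpE // (orth_self alt dP dn Pn).
Qed.

Section Missing.
Variables P z : T.
Hypothesis dP : \dim P = 1.
Hypothesis nrP : ~~ radical P.
Hypothesis zM : z \in missing.
Hypothesis Pz : (P <= z)%VS.

Let dz : \dim z = 2. Proof. by case: (missingP zM). Qed.
Let oz : orth a z z. Proof. by case: (missingP zM). Qed.
Let zB : z \notin BB. Proof. by case: (missingP zM). Qed.

Lemma missing_perp : (z <= perp a P)%VS.
Proof. by rewrite perpE // (orth_self alt dP dz Pz). Qed.

(* If [tau] is not the polar plane of [Q], the only isotropic line of the pencil (Q, tau) is z. *)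
Lemma extra_in_flag Q tau : Q \in points z -> tau \in planes z -> ~~ orth a Q tau ->
  exists2 x, x \in extra & (Q <= x)%VS && (x <= tau)%VS.
Proof.
move=> /pointsP[dQ Qz]; rewrite inE => /andP[/eqP dt zt] no.
have [x xB /andP[Qx xt]] := BBblk dQ dt (subv_trans Qz zt); exists x; last by rewrite Qx.
rewrite !inE xB andbT BBdim //=; apply: contra no => ox.
have dx := BBdim xB; have ne : x != z by apply: contraNneq zB => <-.
have [d3 _] := lines_sum dx dz ne dQ Qx Qz.
have -> : tau = (x + z)%VS by apply/esym/vs_eq; rewrite ?subv_add ?xt // d3 dt.
by rewrite orthDr // (orth_sub Qx (subvv x) ox) (orth_sub Qz (subvv z) oz).
Qed.

Lemma extra_cap x tau : x \in extra -> tau \in planes z -> (x <= tau)%VS ->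
  [/\ \dim x = 2, x != z, \dim (x :&: z) = 1 & tau = (x + z)%VS].
Proof.
rewrite inE => /andP[_ xB]; rewrite inE => /andP[/eqP dt zt] xt; have dx := BBdim xB.
have ne : x != z by apply: contraNneq zB => <-.
have d1 := lines_cap dx dz dt ne xt zt; split=> //.
have [d3 _] := lines_sum dx dz ne d1 (capvSl _ _) (capvSr _ _).
by apply/esym/vs_eq; rewrite ?subv_add ?xt // d3 dt.
Qed.

(** Two such points span z, so P would be orthogonal to [tau] as well, making [tau] the polar plane
    of P. *)
Lemma card_polar_points tau : tau \in planes z -> tau != perp a P ->
  #|[set Q in points z | orth a Q tau]| <= 1.
Proof.
rewrite inE => /andP[/eqP dt zt] ne; apply/card_le1P => Q1; rewrite inE => /andP[/pointsP[d1 z1] o1].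
move=> Q2; rewrite !inE; apply/andP/eqP => [[/andP[/eqP d2 z2] o2]|->]; last by rewrite d1 eqxx z1.
apply/eqP; apply: contraNT ne => n12; apply/eqP/perp_plane => //.
apply: orth_sub Pz (subvv _) _.
by rewrite (line_joinE d2 d1 dz n12 z2 z1) orthDl // o2.
Qed.

(** Of the q + 1 points of z, P and at most one polar point are discarded. The others give distinct
    lines, each meeting z in one point only. *)
Lemma card_extra_plane tau : tau \in planes z -> tau != perp a P ->
  q.-1 <= #|[set x in extra | (x <= tau)%VS && ~~ (P <= x)%VS]|.
Proof.
move=> tz ne; rewrite -[leqRHS]mul1n.
apply: (@leq_trans (1 * #|[set Q in points z | ~~ orth a Q tau] :\ P|)).
  rewrite mul1n; have := card_polar_points tz ne; have := cardsD1 P [set Q in points z | ~~ orth a Q tau].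
  have := cardsID [set Q | orth a Q tau] (points z); rewrite card_points2 //.
  rewrite (_ : points z :&: _ = [set Q in points z | orth a Q tau]); last by apply/setP => Q; rewrite !inE.
  rewrite (_ : points z :\: _ = [set Q in points z | ~~ orth a Q tau]); last by apply/setP => Q; rewrite !inE andbC.
  move: #|[set Q in points z | orth a Q tau]| #|[set Q in points z | _]| #|_ :\ P| (P \in _) #|F|.
  by clear => ? ? ? []; lia.
apply: (double_count (I := fun Q x => (Q <= x)%VS)) => [Q|x].
  rewrite in_setD1 inE => /andP[QP /andP[Qz no]].
  have [x xX /andP[Qx xt]] := extra_in_flag Qz tz no; apply/card_gt0P; exists x.
  rewrite !inE in xX *; rewrite xX xt Qx !andbT; have [dQ Qz'] := pointsP _ _ Qz.
  have xX' : x \in extra by rewrite !inE.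
  have [dx xz _ _] := extra_cap xX' tz xt.
  by apply: contra xz => Px; rewrite (line_joinE dQ dP dx QP Qx Px) (line_joinE dQ dP dz QP Qz' Pz).
rewrite inE => /andP[xX /andP[xt Px]]; have [dx xz d1 _] := extra_cap xX tz xt.
apply: (@card_sub1 _ _ (x :&: z)%VS) => Q.
rewrite inE in_setD1 => /andP[/andP[_]]; rewrite inE => /andP[/pointsP[dQ Qz] _] Qx.
exact: point_in_cap.
Qed.

Lemma card_extra_star : q <= #|[set x in extra | (P <= x)%VS]|.
Proof.
rewrite -[leqRHS]mul1n; apply: (@leq_trans (1 * #|planes z :\ perp a P|)).
  rewrite mul1n; have := cardsD1 (perp a P) (planes z); rewrite card_planes_line //.
  by move: (_ \in _) #|_ :\ _| #|F|; clear => [[]] ? ?; lia.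
apply: (double_count (I := fun tau x => (x <= tau)%VS)) => [tau|x].
  rewrite in_setD1 => /andP[ne tz]; have no : ~~ orth a P tau.
    by move: tz; rewrite inE => /andP[/eqP dt _]; apply: contra ne => o; apply/eqP/perp_plane.
  have [|x xX /andP[Px xt]] := extra_in_flag _ tz no; first by apply/pointsP.
  by apply/card_gt0P; exists x; rewrite inE xt inE xX Px.
rewrite inE => /andP[xX Px]; apply: (@card_sub1 _ _ (x + z)%VS) => tau; rewrite inE in_setD1 => /andP[/andP[_ tz] xt].
by have [_ _ _ ->] := extra_cap xX tz xt.
Qed.

End Missing.

Lemma exists_point_out U : \dim U < 4 -> exists2 Y, \dim Y = 1 & ~~ (Y <= U)%VS.
Proof.
move=> dU; have /subvPn[y _ yU] : ~~ (fullv <= U)%VS.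
  by apply/negP => /dimvS; rewrite dim_full leqNgt dU.
exists <[y]>%VS; last by rewrite -memvE.
by rewrite dim_vline; case: eqP yU => // ->; rewrite mem0v.
Qed.

(** For a point Y off [tau], the polar space of Y meets z. A common point would be orthogonal to Y
    and to [tau], hence to everything. *)
Lemma orth_line_plane z tau : (forall R, \dim R = 1 -> ~~ radical R) -> \dim z = 2 -> \dim tau = 3 ->
  ~~ orth a z tau.
Proof.
move=> nd dz dt; apply/negP => o.
have [Y dY Yt] : exists2 Y, \dim Y = 1 & ~~ (Y <= tau)%VS by apply: exists_point_out; rewrite dt.
have [Z dZ] : exists2 Z, \dim Z = 1 & (Z <= z :&: perp a Y)%VS.
  apply: exists_point_in; have := dim_cap_ge (subvf z) (subvf (perp a Y)).
  by have := dim_perp a Y; rewrite dz dim_full; move: (\dim _) (\dim _); clear; lia.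
rewrite subv_cap => /andP[Zz]; rewrite perpE // => oY; move/negP: (nd Z dZ); apply.
have E : (Y + tau)%VS = fullv by apply: vs_eq; rewrite ?subvf // dim_add1 ?dim_full ?dt.
by rewrite /radical -E orthDr // orth_sym // oY (orth_sub Zz (subvv _) o).
Qed.

(** In each of the q + 1 planes on z, all but at most one point of z lie on an extra line: some
    point of z is not orthogonal to the plane, so [card_polar_points] applies with that point. *)
Lemma card_extra_meet z : (forall R, \dim R = 1 -> ~~ radical R) -> z \in missing ->
  q * q.+1 <= #|[set x in extra | (x :&: z != 0)%VS]|.
Proof.
move=> nd zM; have [dz oz zB] := missingP zM; rewrite -[leqRHS]mul1n -(card_planes_line dz).
apply: (double_count (I := fun tau x => (x <= tau)%VS)) => [tau tz|x]; last first.
  rewrite inE => /andP[xX _]; apply: (@card_sub1 _ _ (x + z)%VS) => tau.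
  by rewrite inE => /andP[tz xt]; have [_ _ _ ->] := extra_cap zM xX tz xt.
have dt : \dim tau = 3 by move: tz; rewrite inE => /andP[/eqP].
have [/exists_inP[R Rz nR]|/exists_inPn none] := boolP [exists R in points z, ~~ orth a R tau]; last first.
  have [R1 [R2 [R1z R2z ne]]] : exists R1 R2, [/\ R1 \in points z, R2 \in points z & R1 != R2].
    by apply/card_gt1P; rewrite card_points2 // ltnS ltnW // q_gt1.
  have [[d1 z1] [d2 z2]] := (pointsP _ _ R1z, pointsP _ _ R2z).
  case/negP: (orth_line_plane nd dz dt); rewrite (line_joinE d1 d2 dz ne z1 z2) orthDl //.
  by move: (none _ R1z) (none _ R2z); rewrite !negbK => -> ->.
have [dR Rz'] := pointsP _ _ Rz.
have ne : tau != perp a R by apply: contraNneq nR => ->; rewrite -perpE.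
have c1 := card_polar_points dR (nd R dR) zM Rz' tz ne.
rewrite -[leqRHS]mul1n; apply: (@leq_trans (1 * #|[set Q in points z | ~~ orth a Q tau]|)).
  rewrite mul1n; have := cardsID [set Q | orth a Q tau] (points z); rewrite card_points2 //.
  rewrite (_ : points z :&: _ = [set Q in points z | orth a Q tau]); last by apply/setP => Q; rewrite !inE.
  rewrite (_ : points z :\: _ = [set Q in points z | ~~ orth a Q tau]); last by apply/setP => Q; rewrite !inE andbC.
  by move: #|[set Q in points z | orth a Q tau]| c1 #|[set Q in points z | _]| #|F|; clear; lia.
apply: (double_count (I := fun Q x => (Q <= x)%VS)) => [Q|x].
  rewrite inE => /andP[Qz no]; have [x xX /andP[Qx xt]] := extra_in_flag zM Qz tz no.
  have [dx xz d1 _] := extra_cap zM xX tz xt.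
  apply/card_gt0P; exists x; rewrite inE Qx andbT inE xt andbT inE xX /=.
  by rewrite -dimv_eq0 d1.
rewrite inE => /andP[]; rewrite inE => /andP[xX _] xt; have [dx xz d1 _] := extra_cap zM xX tz xt.
apply: (@card_sub1 _ _ (x :&: z)%VS) => Q.
rewrite inE => /andP[]; rewrite inE => /andP[/pointsP[dQ Qz] _] Qx.
exact: point_in_cap.
Qed.

(** The first q lines pass through P. The others come from pairs (z, tau) of a missing line on P and
    a plane on it other than the polar plane, q - 1 from each pair. No line is counted twice: a line
    off P meeting two missing lines on P lies in their span, the polar plane of P, and so would
    tau. *)
Lemma card_extra_missing_on P : \dim P = 1 -> ~~ radical P -> 0 < #|missing_on P| ->
  q + q * q.-1 * #|missing_on P| <= #|extra|.
Proof.
move=> dP nrP /card_gt0P[z0]; rewrite inE => /andP[z0M Pz0].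
rewrite -(cardsID [set x | (P <= x)%VS] extra); apply: leq_add.
  apply: leq_trans (card_extra_star dP nrP z0M Pz0) _.
  by apply: subset_leq_card; apply/subsetP => x; rewrite !inE.
pose S := [set zt : T * T | [&& zt.1 \in missing_on P, zt.2 \in planes zt.1 & zt.2 != perp a P]].
have cS : q * #|missing_on P| <= #|S|.
  rewrite -[leqRHS]mul1n; apply: (double_count (I := fun z (zt : T * T) => zt.1 == z)) => [z zP|zt].
    have [dz _ _] : [/\ \dim z = 2, orth a z z & z \notin BB] by apply: missingP; move: zP; rewrite inE => /andP[].
    apply: (@leq_trans #|planes z :\ perp a P|).
      have := cardsD1 (perp a P) (planes z); rewrite card_planes_line //.
      by move: (_ \in _) #|_ :\ _| #|F|; clear => [[]] ? ?; lia.
    rewrite -(card_imset (f := fun tau => (z, tau))); last by move=> ? ? [].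
    apply: subset_leq_card; apply/subsetP => _ /imsetP[tau + ->].
    by rewrite in_setD1 => /andP[ne tz]; rewrite inE eqxx andbT inE /= zP tz.
  by move=> _; apply: (@card_sub1 _ _ zt.1) => z; rewrite inE => /andP[_ /eqP->].
apply: (@leq_trans (q.-1 * #|S|)).
  by rewrite [q * _]mulnC -mulnA leq_mul2l cS orbT.
rewrite -[leqRHS]mul1n; apply: (double_count (I := fun (zt : T * T) x => (x <= zt.2)%VS)) => [[z tau]|x].
  rewrite inE /= => /and3P[]; rewrite inE => /andP[zM Pz] tz ne.
  apply: leq_trans (card_extra_plane dP nrP zM Pz tz ne) _.
  by apply: subset_leq_card; apply/subsetP => x; rewrite !inE => /andP[-> /andP[-> ->]].
rewrite in_setD inE => /andP[Px xX].
have SP z tau : (z, tau) \in S -> [/\ z \in missing, (P <= z)%VS, tau \in planes z & tau != perp a P].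
  by rewrite /S in_set /= => /and3P[/setIdP[? ?] ? ?].
apply/card_le1_eqP => -[z tau] [z' tau'] /setIdP[/SP[zM Pz tz ne] /= xt] /setIdP[/SP[zM' Pz' tz' ne'] /= xt'].
have [dx xz d1 tE] := extra_cap zM xX tz xt; have [_ xz' d1' tE'] := extra_cap zM' xX tz' xt'.
have [zz'|nz] := eqVneq z z'; first by rewrite tE tE' zz'.
have [[dz _ _] [dz' _ _]] := (missingP zM, missingP zM').
have [_ capE] := lines_sum dz dz' nz dP Pz Pz'.
have nQ : (x :&: z)%VS != (x :&: z')%VS.
  apply: contraNneq Px => E; rewrite (_ : P = (x :&: z)%VS) ?capvSl //.
  by apply/esym/vs_eq; rewrite ?dP ?d1 // -capE subv_cap capvSr E capvSr.
case/negP: ne; apply/eqP/vs_eq; last first.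
  by rewrite perp_dim //; move: tz; rewrite inE => /andP[/eqP->].
rewrite tE subv_add (missing_perp dP zM Pz) andbT (line_joinE d1 d1' dx nQ (capvSl _ _) (capvSl _ _)) subv_add.
rewrite (subv_trans (capvSr x z)) ?(missing_perp dP zM Pz) //.
by rewrite (subv_trans (capvSr x z')) // (missing_perp dP zM' Pz').
Qed.

Lemma sum_isotropic :
  \sum_(P in points (fullv : T)) #|[set n in isotropic | (P <= n)%VS]| = q.+1 * #|isotropic|.
Proof.
rewrite -(exchange_card isotropic (points fullv) (fun n P => (P <= n)%VS)) mulnC -sum_nat_const.
by apply: eq_bigr => n; rewrite inE => /andP[/eqP dn _]; rewrite (points_lineE (subvf n)) card_points2.
Qed.

Lemma card_isotropic_on P : \dim P = 1 -> ~~ radical P -> #|[set n in isotropic | (P <= n)%VS]| = q.+1.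
Proof. by move=> dP nr; rewrite isotropic_on // card_pencil // ?perp_dim // sub_perp. Qed.

Lemma card_isotropic_on_rad P : \dim P = 1 -> radical P ->
  #|[set n in isotropic | (P <= n)%VS]| = q ^ 2 + q + 1.
Proof.
move=> dP rP; rewrite -(card_lines_on dP); apply: eq_card => n; rewrite !inE.
case: eqP => //= dn; case Pn: (P <= n)%VS; rewrite ?andbF // andbT.
by rewrite -(orth_self alt dP dn Pn) (orth_sub (subvv P) (subvf n) rP).
Qed.

Lemma card_balance : #|extra| + #|isotropic| = #|BB| + #|missing|.
Proof.
have := cardsID isotropic BB; have := cardsID BB isotropic; rewrite setIC.
by move: #|BB :&: _| #|BB :\: _| #|_ :\: BB| #|BB| #|isotropic|; clear; lia.
Qed.

Lemma card_nondegenerate : (forall P, \dim P = 1 -> ~~ radical P) ->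
  #|isotropic| = q ^ 3 + q ^ 2 + q + 1.
Proof.
move=> nd; apply/eqP; rewrite -(eqn_pmul2l (ltn0Sn q)) -sum_isotropic -card_points4.
rewrite mulnC -sum_nat_const; apply/eqP/eq_bigr => P /pointsP[dP _].
by rewrite card_isotropic_on // nd.
Qed.

(** These are the lines meeting v. Their number is exactly the bound on |BB|, so [card_balance]
    gives only #|extra| <= #|missing| in this case. *)
Lemma card_degenerate v : \dim v = 2 -> (forall P, \dim P = 1 -> radical P = (P <= v)%VS) ->
  #|isotropic| = q ^ 3 + 2 * q ^ 2 + q + 1.
Proof.
move=> dv rv; apply/eqP; rewrite -(eqn_pmul2l (ltn0Sn q)) -sum_isotropic.
have sv : points v \subset points (fullv : T).
  by apply/subsetP => P /pointsP[dP _]; apply/pointsP; rewrite subvf.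
rewrite (sum_setID _ sv) (eq_bigr (fun=> q ^ 2 + q + 1)) => [|P /pointsP[dP Pv]]; last first.
  by rewrite card_isotropic_on_rad // rv.
rewrite [X in _ + X](eq_bigr (fun=> q.+1)) => [|P /setDP[/pointsP[dP _] nP]]; last first.
  by rewrite card_isotropic_on // rv //; apply: contra nP => Pv; apply/pointsP.
rewrite !sum_nat_const cardsD (setIidPr sv) card_points2 // card_points4.
rewrite (_ : q ^ 3 + q ^ 2 + q + 1 - q.+1 = q ^ 3 + q ^ 2); last by clear; lia.
by apply/eqP; rewrite !expnS expn0; clear; nia.
Qed.

End Complex.

(** * No isotropic line with a nonradical point is missing *)

Section NoMissing.
Variable F : finFieldType.
Notation V := 'rV[F]_4.
Notation T := {vspace V}.
Implicit Types U P R O l m n pi g rho C z x tau Q Y : T.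
Notation q := #|F|.

Variable BB : {set T}.
Hypothesis BBdim : forall n, n \in BB -> \dim n = 2.
Hypothesis BBblk : forall P pi, \dim P = 1 -> \dim pi = 3 -> (P <= pi)%VS ->
  exists2 n, n \in BB & (P <= n)%VS && (n <= pi)%VS.
Hypothesis BBcard : #|BB| <= q ^ 3 + 2 * q ^ 2 + q + 1.
Hypothesis q4 : 4 <= q.
Notation eP := (eP BB).

Variables rho O : T.
Hypothesis dr : \dim rho = 3.
Hypothesis dO : \dim O = 1.
Hypothesis Or : (O <= rho)%VS.
Hypothesis thin : forall n, \dim n = 2 -> (n <= rho)%VS -> (n \in BB) = (O <= n)%VS.
Hypothesis sum_e : \sum_(P in points rho) eP P <= q ^ 2.
Variable a : V -> V -> F.
Hypothesis alt : alternating a.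
Hypothesis radO : orth a O rho.
Hypothesis rad : forall P, \dim P = 1 -> (P <= rho)%VS -> orth a P rho -> P = O.
Hypothesis lightP : forall P, P \in points rho -> P != O -> eP P + 2 <= q -> good BB a P.

Notation missing := (missing BB a).
Notation missing_on := (missing_on BB a).
Notation extra := (extra BB a).
Notation radical := (radical a).

Let heavy := [set P in points rho | (P != O) && ~~ good BB a P].

(** Members have excess at least q - 1 out of a total of q^2, and (q - 1)(q + 2) > q^2. *)
Lemma card_heavy : #|heavy| <= q.+1.
Proof.
have : q.-1 * #|heavy| <= q ^ 2.
  apply: leq_trans sum_e; apply: leq_trans (sum_sub_le _ (_ : heavy \subset _)); last first.
    by apply/subsetP => P /setIdP[].
  apply: sum_ge_const => P /setIdP[Pr /andP[PO ng]].
  have : ~~ (eP P + 2 <= q) by apply: contra ng; apply: lightP.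
  by move: (eP P) #|F|; clear => ? ?; lia.
by move: q4; rewrite expnS expn1; move: #|heavy| #|F|; clear => x y; nia.
Qed.

Lemma dim_perp_light P : P \in points rho -> P != O -> ~~ radical P.
Proof.
by move=> /pointsP[dP Pr] ne; apply: contra ne => rP; apply/eqP/rad => //; apply: orth_sub rP; rewrite ?subvf.
Qed.

(** An isotropic line of rho off O would span rho together with O, so each of its points would be
    orthogonal to rho and hence equal to O. *)
Lemma isotropic_rho n : \dim n = 2 -> orth a n n -> (n <= rho)%VS -> n \in BB.
Proof.
move=> dn on nr; rewrite thin //; apply: contraT => On.
have E : (O + n)%VS = rho by apply: vs_eq; rewrite ?subv_add ?Or // dim_add1 ?dn ?dr.
have [P [R [Pn Rn ne]]] : exists P R, [/\ P \in points n, R \in points n & P != R].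
  by apply/card_gt1P; rewrite card_points2 // ltnS ltnW // q_gt1.
have isO Z : Z \in points n -> Z = O.
  move=> /pointsP[dZ Zn]; apply: rad => //; first exact: subv_trans nr.
  rewrite -E orthDr // (orth_sub Zn (subvv n) on) andbT orth_sym //.
  by apply: orth_sub radO; rewrite ?(subv_trans Zn).
by rewrite (isO P Pn) (isO R Rn) eqxx in ne.
Qed.

Lemma missing_cap z : z \in missing -> \dim (z :&: rho) = 1.
Proof.
case/missingP => dz oz zB; apply: line_plane_cap => //.
by apply: contra zB; apply: isotropic_rho.
Qed.

Let nonrad := [set z in missing | [exists P in points z, ~~ radical P]].

Let nonradP z : z \in nonrad -> z \in missing /\ exists2 P, P \in points z & ~~ radical P.
Proof. by move=> /setIdP[zM /exists_inP[P]]; split=> //; exists P. Qed.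

(** A missing line off O meets rho in a point that is not good, since at a good point all isotropic
    lines belong to BB. At most q + 1 points are available. *)
Lemma card_nonrad_off k : (forall P, \dim P = 1 -> ~~ radical P -> #|missing_on P| <= k) ->
  #|[set z in nonrad | ~~ (O <= z)%VS]| <= k * q.+1.
Proof.
move=> hk; apply: (@leq_trans (k * #|heavy|)); last by rewrite leq_mul2l card_heavy orbT.
rewrite -[leqLHS]mul1n; apply: (double_count (I := fun z P => (P <= z)%VS)) => [z|P].
  move=> /setIdP[/nonradP[zM _] Oz]; have d1 := missing_cap zM; have [dz oz zB] := missingP zM.
  have Yp : (z :&: rho)%VS \in points rho by apply/pointsP; rewrite capvSr.
  have YO : (z :&: rho)%VS != O by apply: contraNneq Oz => <-; apply: capvSl.
  apply/card_gt0P; exists (z :&: rho)%VS; rewrite inE capvSl andbT inE Yp YO /=.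
  apply: contra zB => /pencilP; apply=> //; first exact: capvSl.
  by rewrite perpE // (orth_self alt d1 dz (capvSl _ _)).
move=> /setIdP[Pp /andP[PO _]]; have [dP _] := pointsP _ _ Pp.
apply: leq_trans (hk P dP (dim_perp_light Pp PO)); apply: subset_leq_card; apply/subsetP => z.
by move=> /setIdP[/setIdP[/nonradP[zM _] _] Pz]; apply/setIdP.
Qed.

Section Degenerate.
Hypothesis deg : exists2 P, \dim P = 1 & radical P.

Lemma radical_O : radical O.
Proof.
have [Z dZ rZ] := deg.
have [Zr|Zr] := boolP (Z <= rho)%VS.
  by rewrite -(rad dZ Zr) //; apply: orth_sub rZ; rewrite ?subvf.
have E : (Z + rho)%VS = fullv by apply: vs_eq; rewrite ?subvf // dim_add1 ?dim_full ?dr.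
suff: orth a O fullv by [].
rewrite -E orthDr // radO andbT orth_sym //.
by apply: orth_sub rZ; rewrite ?subvf.
Qed.

(** The line v is the polar space of rho, cut out by two points that span rho together with O. It
    meets rho only in O, so v and rho span the space; v is orthogonal to rho, and also to itself
    because it contains the radical point O. *)
Lemma radical_line : exists v, [/\ \dim v = 2, (O <= v)%VS, ~~ (v <= rho)%VS &
  forall P, \dim P = 1 -> radical P = (P <= v)%VS].
Proof.
have rO := radical_O.
have [P dP [Pr nPO]] : exists2 P, \dim P = 1 & (P <= rho)%VS /\ P != O.
  by have [P /pointsP[dP Pr] nPO] := exists_off dr dO Or q4; exists P.
have dOP : \dim (O + P) = 2 by rewrite joinPP // eq_sym.
have [x xr xOP] : exists2 x, x \in rho & x \notin (O + P)%VS.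
  by apply/subvPn/negP => /dimvS; rewrite dOP dr.
pose R := <[x]>%VS.
have dR : \dim R = 1 by rewrite /R dim_vline; case: eqP xOP => // ->; rewrite mem0v.
have rhoE : (R + (O + P))%VS = rho.
  by apply: vs_eq; rewrite ?subv_add -?memvE ?xr ?Or ?Pr // dim_add1 ?dOP ?dr // -memvE.
pose v := (perp a P :&: perp a R)%VS.
have Ov : (O <= v)%VS.
  rewrite subv_cap !perpE // ![orth a _ O]orth_sym //.
  by rewrite (orth_sub (subvv _) (subvf P) rO) (orth_sub (subvv _) (subvf R) rO).
have v_rho : orth a v rho.
  rewrite -rhoE !orthDr // ![orth a v _]orth_sym // -!perpE // capvSl capvSr andbT /=.
  by rewrite perpE // (orth_sub (subvv _) (subvf v) rO).
have vr Z : \dim Z = 1 -> (Z <= v)%VS -> (Z <= rho)%VS -> Z = O.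
  by move=> dZ Zv Zr; apply: rad => //; apply: orth_sub v_rho.
have dv2 : 2 <= \dim v.
  have := dim_cap_ge (subvf (perp a P)) (subvf (perp a R)); rewrite dim_full.
  by move: (dim_perp a P) (dim_perp a R); rewrite -/v; move: (\dim _) (\dim _) (\dim _); clear; lia.
have capO : (v :&: rho)%VS = O.
  apply/eqP; rewrite eqEsubv subv_cap Ov Or !andbT; apply/subvP => y.
  rewrite memv_cap => /andP[yv yr]; have [->|y0] := eqVneq y 0%R; first exact: mem0v.
  by rewrite -(vr <[y]>%VS) ?memv_line // -?memvE // dim_vline y0.
have [dv E] : \dim v = 2 /\ (v + rho)%VS = fullv.
  have := dimv_sum_cap v rho; rewrite capO dO dr.
  have := dimvS (subvf (v + rho)); rewrite dim_full => h1 h2.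
  by split; [move: h1 h2 dv2 | apply: vs_eq; rewrite ?subvf // dim_full; move: h1 h2 dv2];
    move: (\dim v) (\dim (v + rho)); clear; lia.
have rv : orth a v fullv.
  by rewrite -E orthDr // v_rho andbT -(orth_self alt dO dv Ov) (orth_sub (subvv _) (subvf v) rO).
have nvr : ~~ (v <= rho)%VS.
  by apply/negP => vr'; have := dO; rewrite -capO (capv_idPl vr') dv.
exists v; split=> // Z dZ; apply/idP/idP => [rZ|Zv]; last exact: orth_sub rv.
(* A radical point off v would give a radical plane, which meets rho in more than O. *)
apply: contraT => Zv; have d3 : \dim (Z + v) = 3 by rewrite dim_add1 ?dv.
have rZv : orth a (Z + v) fullv by rewrite orthDl //; apply/andP.
have [Y dY] : exists2 Y, \dim Y = 1 & (Y <= (Z + v) :&: rho)%VS /\ Y != O.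
  have d2 : 2 <= \dim ((Z + v) :&: rho).
    have := dim_cap_ge (subvf (Z + v)) (subvf rho); rewrite d3 dr dim_full.
    by move: (\dim _); clear; lia.
  have /subvPn[y yZ yO] : ~~ ((Z + v) :&: rho <= O)%VS.
    by apply/negP => /dimvS; rewrite dO leqNgt d2.
  exists <[y]>%VS; first by rewrite dim_vline; case: eqP yO => // ->; rewrite mem0v.
  by rewrite -memvE yZ; split=> //; apply: contraNneq yO => <-; apply: memv_line.
rewrite subv_cap => -[/andP[YZ Yr]]; rewrite (rad dY Yr) ?eqxx //.
by apply: orth_sub rZv; rewrite ?subvf.
Qed.

End Degenerate.

(** Through a point P of z1 the only candidate is the intersection of the planes [P + z2] and
    [P + z3]. *)
Lemma card_transversals z1 z2 z3 : \dim z1 = 2 -> \dim z2 = 2 -> \dim z3 = 2 ->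
  (z1 :&: z2 = 0)%VS -> (z1 :&: z3 = 0)%VS -> (z2 :&: z3 = 0)%VS ->
  #|[set x : T | [&& \dim x == 2, x :&: z1 != 0, x :&: z2 != 0 & x :&: z3 != 0]%VS]| <= q.+1.
Proof.
move=> d1 d2 d3 s12 s13 s23; rewrite -[q.+1]mul1n -(card_points2 d1) -[leqLHS]mul1n.
have out z P : (z1 :&: z = 0)%VS -> P \in points z1 -> ~~ (P <= z)%VS.
  move=> s /pointsP[dP Pz1]; apply/negP => Pz; have : (P <= z1 :&: z)%VS by rewrite subv_cap Pz1.
  by rewrite s => /dimvS; rewrite dimv0 dP.
apply: (double_count (I := fun x P => (P <= x)%VS)) => [x|P Pz1].
  rewrite inE => /and4P[/eqP dx m1 _ _].
  have [P dP] : exists2 P, \dim P = 1 & (P <= x :&: z1)%VS.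
    by apply: exists_point_in; rewrite lt0n dimv_eq0.
  by rewrite subv_cap => /andP[Px Pz]; apply/card_gt0P; exists P; rewrite inE Px andbT; apply/pointsP.
have [dP _] := pointsP _ _ Pz1.
have dPz z : \dim z = 2 -> (z1 :&: z = 0)%VS -> \dim (P + z) = 3.
  by move=> dz s; rewrite dim_add1 ?dz // (out z P).
have ne : (P + z2)%VS != (P + z3)%VS.
  apply/eqP => E; have n23 : z2 != z3.
    by apply/eqP => E2; move: s23; rewrite E2 capvv => E3; rewrite E3 dimv0 in d3.
  by have := lines_cap d2 d3 (dPz z2 d2 s12) n23 (addvSr _ _); rewrite E addvSr s23 dimv0 => /(_ isT).
have dc := planes_cap (dPz _ d2 s12) (dPz _ d3 s13) ne.
apply: (@card_sub1 _ _ ((P + z2) :&: (P + z3))%VS) => x /setIdP[]; rewrite inE => /and4P[/eqP dx _ m2 m3] Px.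
have sub z : (z1 :&: z = 0)%VS -> (x :&: z != 0)%VS -> (x <= P + z)%VS.
  move=> s m; have [Y dY] : exists2 Y, \dim Y = 1 & (Y <= x :&: z)%VS.
    by apply: exists_point_in; rewrite lt0n dimv_eq0.
  rewrite subv_cap => /andP[Yx Yz].
  have PY : P != Y by apply: contraNneq (out z P s Pz1) => ->.
  by rewrite (line_joinE dP dY dx PY Px Yx) addvS.
by apply: vs_eq; rewrite ?subv_cap ?sub // dc dx.
Qed.

Lemma max_missing P0 : \dim P0 = 1 -> ~~ radical P0 -> exists P, [/\ \dim P = 1, ~~ radical P,
  #|missing_on P0| <= #|missing_on P| &
  forall R, \dim R = 1 -> ~~ radical R -> #|missing_on R| <= #|missing_on P|].
Proof.
move=> d0 r0; have h0 : (\dim P0 == 1) && ~~ radical P0 by rewrite d0 r0.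
case: (arg_maxnP (P := fun P : T => (\dim P == 1) && ~~ radical P) (fun P => #|missing_on P|) h0).
move=> P /andP[/eqP dP rP] hP; exists P; split=> //; first exact: hP.
by move=> R dR rR; apply: hP; rewrite dR rR.
Qed.

(** Let u be the maximal number of missing lines on a point. Then q + q (q - 1) u <= #|extra| <= q^2
    + u (q + 1), which only u = 1 survives. The missing lines are then pairwise skew, and three of
    them would have too many common transversals. *)
Lemma nondegenerate_no_missing P0 : (forall P, \dim P = 1 -> ~~ radical P) ->
  \dim P0 = 1 -> #|missing_on P0| = 0.
Proof.
move=> nd d0; apply/eqP; rewrite -leqn0 leqNgt; apply/negP => m0.
have [P [dP rP le hP]] := max_missing d0 (nd P0 d0); set u := #|missing_on P| in le hP.
have u0 : 0 < u := leq_trans m0 le.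
have lower := card_extra_missing_on BBdim BBblk alt dP rP u0; rewrite -/u in lower.
have rOp : perp a O = rho.
  by apply/esym/vs_eq; rewrite ?perpE // dr (perp_dim alt dO (nd O dO)).
have cm : #|missing| <= u * q.+1.
  apply: leq_trans (card_nonrad_off hP); apply: subset_leq_card; apply/subsetP => z zM.
  have [dz oz zB] := missingP zM; have d1 := missing_cap zM.
  apply/setIdP; split.
    apply/setIdP; split=> //; apply/exists_inP; exists (z :&: rho)%VS; last exact: nd.
    by apply/pointsP; rewrite capvSl.
  apply: contra zB => Oz; apply: isotropic_rho => //.
  by rewrite -rOp perpE // (orth_self alt dO dz Oz).
have := card_balance BB a; rewrite card_nondegenerate // => bal.
have up : #|extra| <= q ^ 2 + #|missing|.
  by move: bal BBcard; move: #|extra| #|missing| #|BB| (q ^ 3) (q ^ 2) #|F|; clear => *; lia.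
have u1 : u = 1.
  apply/eqP; rewrite eqn_leq u0 andbT leqNgt; apply/negP => u2.
  move: lower (leq_trans up (leq_add (leqnn _) cm)) q4; case: u u2 {u0 m0 le hP cm} => [|[|u]] // _.
  by move: #|extra| #|F|; clear => e [|q] //; rewrite expnS expn1 succnK; nia.
have [z0 z0P] : exists z0, z0 \in missing_on P by apply/card_gt0P.
have z0M : z0 \in missing by case/setIdP: z0P.
have meet z := @card_extra_meet _ BB BBdim BBblk a alt z nd.
(* One missing line is met by q^2 + q extra lines, and there are at most q^2 + #|missing|, so at
   least q lines are missing. *)
have m3 : 2 < #|missing|.
  have := meet z0 z0M; have : #|[set x in extra | (x :&: z0 != 0)%VS]| <= #|extra|.
    by apply: subset_leq_card; apply/subsetP => x /setIdP[].
  move: up q4; rewrite expnS expn1 mulnS; move: #|[set x in _ | _]| #|extra| #|missing| (q * q) #|F|.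
  by clear => *; lia.
have [z1 [z2 [z3 [[M1 M2 M3] [n12 n23 n31]]]]] : exists x y z : T,
    [/\ [/\ x \in missing, y \in missing & z \in missing] & [/\ x != y, y != z & z != x]].
  by have /card_gt2P[x [y [z [h h']]]] := m3; exists x, y, z.
have skew z z' : z \in missing -> z' \in missing -> z != z' -> (z :&: z' = 0)%VS.
  move=> zM zM' ne; apply/eqP; rewrite -dimv_eq0 -leqn0 leqNgt; apply/negP => d0'.
  have [Y dY] := exists_point_in d0'; rewrite subv_cap => /andP[Yz Yz'].
  have := hP Y dY (nd Y dY); rewrite u1 leqNgt => /negP; apply.
  by apply/card_gt1P; exists z, z'; split=> //; apply/setIdP.
have [[d1 _ _] [d2 _ _] [d3 _ _]] := And3 (missingP M1) (missingP M2) (missingP M3).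
rewrite eq_sym in n31.
(* Each of the three lines is met by all but at most one of the at most q^2 + q + 1 extra lines. By
   inclusion and exclusion at least q^2 + q - 2 extra lines meet all three, against the bound q +
   1. *)
have := card_transversals d1 d2 d3 (skew _ _ M1 M2 n12) (skew _ _ M1 M3 n31) (skew _ _ M2 M3 n23).
pose A z := [set x in extra | (x :&: z != 0)%VS].
have sA z : A z \subset extra by apply/subsetP => x /setIdP[].
have : A z1 :&: A z2 :&: A z3 \subset [set x : T | [&& \dim x == 2, x :&: z1 != 0, x :&: z2 != 0 & x :&: z3 != 0]%VS].
  apply/subsetP => x /setIP[/setIP[/setIdP[xX m1] /setIdP[_ m2]] /setIdP[_ m3']].
  by rewrite inE m1 m2 m3' !andbT BBdim //; move: xX; rewrite inE => /andP[].
move/subset_leq_card.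
have := cardsUI (A z1) (A z2); have := cardsUI (A z1 :&: A z2) (A z3).
have : #|A z1 :|: A z2| <= #|extra| by rewrite subset_leq_card // subUset !sA.
have : #|A z1 :&: A z2 :|: A z3| <= #|extra|.
  by rewrite subset_leq_card // subUset sA (subset_trans (subsetIl _ _)).
move: (meet z1 M1) (meet z2 M2) (meet z3 M3) up cm q4; rewrite -/(A z1) -/(A z2) -/(A z3) u1 mul1n.
rewrite expnS expn1 mulnS.
move: #|A z1| #|A z2| #|A z3| #|_ :|: A z2| #|_ :|: A z3| #|A z1 :&: A z2| #|_ :&: A z3| #|extra| #|missing|.
move: #|[set x : T | _]| => tr b1 b2 b3 c2 c3 i2 i3 ex mi.
have : 4 <= q -> 4 * q <= q * q by move=> h; rewrite leq_mul2r h orbT.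
by move: (q * q) #|F|; clear => qq q; lia.
Qed.

(** The same inequality forces u = 1. Transversals are replaced by a count of the nonradical points
    on missing lines: they are numerous because each lies on one missing line only, and each needs q
    extra lines. *)
Lemma degenerate_no_missing P0 : (exists2 P, \dim P = 1 & radical P) ->
  \dim P0 = 1 -> ~~ radical P0 -> #|missing_on P0| = 0.
Proof.
move=> deg d0 r0; apply/eqP; rewrite -leqn0 leqNgt; apply/negP => m0.
have [v [dv Ov vr hv]] := radical_line deg.
have [P [dP rP le hP]] := max_missing d0 r0; set u := #|missing_on P| in le hP.
have u0 : 0 < u := leq_trans m0 le.
have lower := card_extra_missing_on BBdim BBblk alt dP rP u0; rewrite -/u in lower.
have nv z : \dim z = 2 -> (forall R, R \in points z -> radical R) -> z = v.
  move=> dz hz; have [R [R' [Rz Rz' ne]]] : exists R R', [/\ R \in points z, R' \in points z & R != R'].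
    by apply/card_gt1P; rewrite card_points2 // ltnS ltnW // q_gt1.
  have [[dR Rz0] [dR' Rz0']] := (pointsP _ _ Rz, pointsP _ _ Rz').
  apply: vs_eq; last by rewrite dz dv.
  by rewrite (line_joinE dR dR' dz ne Rz0 Rz0') subv_add -!hv // !hz.
(* The extra unit is for v itself, the only line without nonradical points. *)
have cm : #|missing| <= #|nonrad|.+1.
  have sub : missing \subset v |: nonrad.
    apply/subsetP => z zM; have [dz _ _] := missingP zM; rewrite in_setU1.
    have [/eqP->//|zv] := boolP (z == v); apply/setIdP; split=> //; apply: contraT => /exists_inPn none.
    by case/eqP: zv; apply: nv => // R Rz; move: (none R Rz); rewrite negbK.
  by apply: leq_trans (subset_leq_card sub) _; rewrite cardsU1; case: (v \notin nonrad).
(* Of the q^2 + q + 1 lines on O, the isotropic ones in rho belong to BB, and v has only radical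
   points. *)
have c0 : #|[set z in nonrad | (O <= z)%VS]| <= (q ^ 2).-1.
  pose D := lines_on O :\: [set n in lines_in rho | (O <= n)%VS].
  have sP : [set n in lines_in rho | (O <= n)%VS] \subset lines_on O.
    by apply/subsetP => n /setIdP[]; rewrite !inE => /andP[-> _] ->.
  have vD : v \in D.
    by apply/setDP; split; [rewrite inE dv Ov | apply: contra vr => /setIdP[]; rewrite inE => /andP[]].
  have cD : #|D| = q ^ 2.
    by rewrite /D cardsD (setIidPr sP) card_pencil // card_lines_on //; clear; lia.
  have := cardsD1 v D; rewrite vD cD.
  have : #|[set z in nonrad | (O <= z)%VS]| <= #|D :\ v|.
    apply: subset_leq_card; apply/subsetP => z /setIdP[zR Oz].
    have [zM [Q Qz rQ]] := nonradP zR; have [dz oz zB] := missingP zM.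
    apply/setD1P; split.
      by apply: contraNneq rQ => E; have [dQ Qz'] := pointsP _ _ Qz; rewrite hv // -E.
    apply/setDP; split; first by rewrite inE dz Oz.
    by apply: contra zB => /setIdP[]; rewrite inE => /andP[_ zr] _; apply: isotropic_rho.
  by move: #|[set z in nonrad | _]| #|D :\ v| (q ^ 2) #|F|; clear => *; lia.
have cr : #|nonrad| <= (q ^ 2).-1 + u * q.+1.
  rewrite -(cardsID [set z | (O <= z)%VS] nonrad); apply: leq_add.
    by apply: leq_trans c0; apply: subset_leq_card; apply/subsetP => z; rewrite !inE.
  apply: leq_trans (card_nonrad_off hP); apply: subset_leq_card; apply/subsetP => z.
  by move=> /setDP[zR]; rewrite inE => Oz; apply/setIdP.
have := card_balance BB a; rewrite (card_degenerate alt dv hv) => bal.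
have up : #|extra| <= #|nonrad|.+1.
  by move: bal cm BBcard; move: #|extra| #|missing| #|BB| #|nonrad| (q ^ 3) (q ^ 2) #|F|; clear => *; lia.
have u1 : u = 1.
  apply/eqP; rewrite eqn_leq u0 andbT leqNgt; apply/negP => u2.
  have {}up : #|extra| <= q ^ 2 + u * q.+1.
    have : 0 < q ^ 2 by rewrite expn_gt0; move: q4; case: #|F|.
    by move: up cr; move: #|extra| #|nonrad| (q ^ 2) (u * _); clear => *; lia.
  move: lower up q4; case: u u2 {u0 m0 le hP cr} => [|[|u]] // _.
  by move: #|extra| #|F|; clear => e [|q] //; rewrite expnS expn1 succnK; nia.
pose bad := [set R in points (fullv : T) | ~~ radical R && (0 < #|missing_on R|)].
have c1 : q * #|nonrad| <= 1 * #|bad|.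
  apply: (double_count (I := fun z R => (R <= z)%VS)) => [z zR|R /setIdP[/pointsP[dR _] /andP[rR _]]]; last first.
    rewrite -[leqRHS]u1; apply: leq_trans (hP R dR rR); apply: subset_leq_card; apply/subsetP => z.
    by move=> /setIdP[/nonradP[zM _] Rz]; apply/setIdP.
  have [zM [Q Qz rQ]] := nonradP zR; have [dz oz zB] := missingP zM.
  have : #|[set R in points z | radical R]| <= 1.
    apply/card_le1_eqP => R R' /setIdP[Rz rR] /setIdP[Rz' rR']; apply/eqP; apply: contraNT rQ => ne.
    have [[dR Rz0] [dR' Rz0']] := (pointsP _ _ Rz, pointsP _ _ Rz').
    have [dQ Qz'] := pointsP _ _ Qz; rewrite hv //; apply: subv_trans Qz' _.
    by rewrite (line_joinE dR' dR dz ne Rz0' Rz0) subv_add -!hv // rR'.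
  have : #|points z :\: [set R | radical R]| <= #|[set R in bad | (R <= z)%VS]|.
    apply: subset_leq_card; apply/subsetP => R /setDP[/pointsP[dR Rz] rR]; rewrite in_set in rR.
    apply/setIdP; split=> //; apply/setIdP; split; first by apply/pointsP; rewrite subvf.
    by rewrite rR; apply/card_gt0P; exists z; apply/setIdP.
  have := cardsID [set R | radical R] (points z); rewrite card_points2 //.
  rewrite (_ : points z :&: _ = [set R in points z | radical R]); last by apply/setP => R; rewrite !inE.
  move: #|[set R in points z | _]| #|points z :\: _| #|[set R in bad | _]| #|F|; clear => *; lia.
have c2 : q * #|bad| <= q.+1 * #|extra|.
  apply: (double_count (I := fun R x => (R <= x)%VS)) =>
    [R /setIdP[/pointsP[dR _] /andP[rR /card_gt0P[z /setIdP[zM Rz]]]]|x].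
    exact: (card_extra_star BBdim BBblk alt dR rR zM Rz).
  rewrite inE => /andP[_ xB]; rewrite -(card_points2 (BBdim xB)); apply: subset_leq_card; apply/subsetP => R.
  by move=> /setIdP[/setIdP[/pointsP[dR _] _] Rx]; apply/pointsP.
(* With r = #|nonrad|, [c1] and [c2] combine to q^2 r <= (q + 1)(r + 1), which fails once r is at
   least q (q - 1). *)
move: lower up c1 c2 q4; rewrite u1 mul1n muln1; move: #|extra| #|nonrad| #|bad| #|F|; clear.
move=> e r b q; case: q => [|q] //; rewrite succnK => lower up c1 c2 q4.
have c3 : q.+1 * (q.+1 * r) <= q.+2 * r.+1.
  by apply: leq_trans (leq_mul (leqnn _) c1) _; apply: leq_trans c2 _; rewrite leq_mul2l up orbT.
have r_ge : q.+1 * q <= r by lia.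
by nia.
Qed.

End NoMissing.

Lemma isotropic_blocking (F : finFieldType) (BB : {set {vspace 'rV[F]_4}}) :
  4 <= #|F| -> #|BB| <= #|F| ^ 3 + 2 * #|F| ^ 2 + #|F| + 1 ->
  (forall n, n \in BB -> \dim n = 2) ->
  (forall P pi : {vspace 'rV[F]_4}, \dim P = 1 -> \dim pi = 3 -> (P <= pi)%VS ->
    exists2 n, n \in BB & (P <= n)%VS && (n <= pi)%VS) ->
  exists a, [/\ alternating a, exists x y, a x y != 0%R &
    forall P pi : {vspace 'rV[F]_4}, \dim P = 1 -> \dim pi = 3 -> (P <= pi)%VS ->
    exists2 n, n \in BB & [&& (P <= n)%VS, (n <= pi)%VS & orth a n n]].
Proof.
move=> q4 BBcard BBdim BBblk.
have [rho [dr tr]] := thin_plane BBdim BBblk BBcard.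
have [O [dO Or thin]] := thin_point BBdim BBblk dr tr.
have sum_e := sum_eP BBdim BBblk BBcard dr tr.
have [a [alt radO rad lightP]] := light_good BBdim BBblk q4 dr dO Or thin sum_e.
exists a; split=> //.
  have [P /pointsP[dP Pr] nPO] := exists_off dr dO Or q4.
  have : ~~ orth a P rho by apply: contra nPO => o; rewrite (rad P dP Pr o).
  by move=> /forall_inPn[x _ /forall_inPn[y _ h]]; exists x, y.
have none P : \dim P = 1 -> ~~ radical a P -> #|missing_on BB a P| = 0.
  move=> dP nr; have [/forallP h|/forallPn[R]] :=
    boolP [forall R : {vspace 'rV[F]_4}, (\dim R == 1) ==> ~~ radical a R].
    apply: (nondegenerate_no_missing BBdim BBblk BBcard q4 dr dO Or thin sum_e alt radO rad lightP) => // R dR.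
    by have := h R; rewrite dR.
  rewrite negb_imply negbK => /andP[/eqP dR rR].
  by apply: (degenerate_no_missing BBdim BBblk BBcard q4 dr dO Or thin sum_e alt radO rad lightP) => //; exists R.
move=> P pi dP dpi Ppi; have [rP|nr] := boolP (radical a P).
  have [n nB /andP[Pn np]] := BBblk P pi dP dpi Ppi; exists n; rewrite // Pn np /=.
  by rewrite -(orth_self alt dP (BBdim n nB) Pn); apply: orth_sub rP; rewrite ?subvf.
(* The polar plane of P meets pi in at least a line on P, and that yields an isotropic line of the
   pencil. *)
have [R [dR RP Rp Ro]] : exists R, [/\ \dim R = 1, R != P, (R <= pi)%VS & orth a P R].
  have d2 : 2 <= \dim (pi :&: perp a P).
    have := dim_cap_ge (subvf pi) (subvf (perp a P)); rewrite dpi (perp_dim alt dP nr) dim_full.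
    by move: (\dim _); clear; lia.
  have /subvPn[y yp yP] : ~~ (pi :&: perp a P <= P)%VS by apply/negP => /dimvS; rewrite dP leqNgt d2.
  move: yp; rewrite memvE subv_cap => /andP[yp yo]; exists <[y]>%VS; split=> //.
  - by rewrite dim_vline; case: eqP yP => // ->; rewrite mem0v.
  - by apply: contraNneq yP => <-; apply: memv_line.
  by rewrite -(perpE alt).
have dn : \dim (P + R) = 2 by rewrite joinPP // eq_sym.
have on : orth a (P + R) (P + R).
  by rewrite -(orth_self alt dP dn (addvSl _ _)) (orthDr alt) (orth_point alt dP).
exists (P + R)%VS; last by rewrite addvSl subv_add Ppi Rp.
apply: contraT => nB; have : (P + R)%VS \in missing_on BB a P.
  by apply/setIdP; rewrite addvSl; split=> //; apply/setDP; split=> //; rewrite inE dn on.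
by move=> h; have := cards0_eq (none P dP nr) => E; rewrite E inE in h.
Qed.

(** * The Klein correspondence *)

Section Wedge.
Variable F : finFieldType.
Notation V := 'rV[F]_4.
Notation T := {vspace V}.
Implicit Types x y z w : V.
Implicit Types s t : 'rV[F]_6.
Local Open Scope ring_scope.

Definition minor x y (i j : nat) : F :=
  x 0 (inord i) * y 0 (inord j) - x 0 (inord j) * y 0 (inord i).

(* Pluecker coordinates, ordered and signed (minor 3 1) so that [klein_form] is the Pluecker relation. *)
Definition wedge x y : 'rV[F]_6 := \row_(i < 6) nth 0 [:: minor x y 0 1; minor x y 2 3;
  minor x y 0 2; minor x y 3 1; minor x y 0 3; minor x y 1 2] i.

Definition polar s t : F :=
  s 0 (inord 0) * t 0 (inord 1) + s 0 (inord 1) * t 0 (inord 0) +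
  (s 0 (inord 2) * t 0 (inord 3) + s 0 (inord 3) * t 0 (inord 2)) +
  (s 0 (inord 4) * t 0 (inord 5) + s 0 (inord 5) * t 0 (inord 4)).

Lemma row_nth n (l : seq F) i : (i < n.+1)%N -> (\row_(j < n.+1) nth 0 l j) 0 (inord i) = nth 0 l i.
Proof. by move=> h; rewrite mxE inordK. Qed.

Lemma klein_wedge x y : klein_form (wedge x y) = 0.
Proof. by rewrite /klein_form /wedge !row_nth //= /minor; ring. Qed.

Lemma kleinD s t : klein_form (s + t) = klein_form s + klein_form t + polar s t.
Proof. by rewrite /klein_form /polar !mxE; ring. Qed.

Lemma kleinZ c s : klein_form (c *: s) = c ^+ 2 * klein_form s.
Proof. by rewrite /klein_form !mxE; ring. Qed.

Lemma wedge_linear c x y z : wedge (c *: x + y) z = c *: wedge x z + wedge y z.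
Proof.
apply/rowP => i; rewrite !mxE; case: i => [[|[|[|[|[|[|i]]]]]] hi] //=; rewrite /minor !mxE; ring.
Qed.

Lemma wedge_anti x y : wedge x y = - wedge y x.
Proof.
by apply/rowP => i; rewrite !mxE; case: i => [[|[|[|[|[|[|i]]]]]] hi] //=; rewrite /minor; ring.
Qed.

Lemma wedgexx x : wedge x x = 0.
Proof.
by apply/rowP => i; rewrite !mxE; case: i => [[|[|[|[|[|[|i]]]]]] hi] //=; rewrite /minor; ring.
Qed.

Lemma polarDr s t t' : polar s (t + t') = polar s t + polar s t'.
Proof. by rewrite /polar !mxE; ring. Qed.
Lemma polarZr c s t : polar s (c *: t) = c * polar s t.
Proof. by rewrite /polar !mxE; ring. Qed.
Lemma polarZl c s t : polar (c *: s) t = c * polar s t.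
Proof. by rewrite /polar !mxE; ring. Qed.

(** For nonzero s, a line is isotropic for this form when its Pluecker point lies in the hyperplane
    polar to s; [form_polar] shows that every alternating form arises so. *)
Definition line_form s z w := polar s (wedge z w).

Lemma line_form_alt s : alternating (line_form s).
Proof.
split=> [c x y z|x y|x]; rewrite /line_form.
- by rewrite wedge_linear polarDr polarZr.
- by rewrite wedge_anti -scaleN1r polarZr mulN1r.
by rewrite wedgexx -(scale0r (0 : 'rV[F]_6)) polarZr mul0r.
Qed.

Lemma line_form_l x y w : line_form (wedge x y) x w = 0.
Proof. by rewrite /line_form /polar /wedge !row_nth //= /minor; ring. Qed.

Lemma line_form_r x y w : line_form (wedge x y) y w = 0.
Proof. by rewrite /line_form /polar /wedge !row_nth //= /minor; ring. Qed.

Lemma inord_delta n i j : (i < n.+1)%N -> (j < n.+1)%N ->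
  (delta_mx 0 (inord i) : 'rV[F]_n.+1) 0 (inord j) = (j == i)%:R.
Proof. by move=> hi hj; rewrite mxE eqxx /= -val_eqE /= !inordK. Qed.

Lemma line_form_delta s (i j : nat) : (i < 4)%N -> (j < 4)%N ->
  line_form s (delta_mx 0 (inord i)) (delta_mx 0 (inord j)) =
  nth 0 (nth [::] [:: [:: 0; s 0 (inord 1); s 0 (inord 3); s 0 (inord 5)];
    [:: - s 0 (inord 1); 0; s 0 (inord 4); - s 0 (inord 2)];
    [:: - s 0 (inord 3); - s 0 (inord 4); 0; s 0 (inord 0)];
    [:: - s 0 (inord 5); s 0 (inord 2); - s 0 (inord 0); 0]] i) j.
Proof.
move=> hi hj; rewrite /line_form /polar /wedge !row_nth //= /minor !inord_delta //.
move: hi hj; case: i => [|[|[|[|i]]]] // _; case: j => [|[|[|[|j]]]] //= _; ring.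
Qed.

Lemma line_form_eq0 s : (forall x y, line_form s x y = 0) -> s = 0.
Proof.
move=> h; apply/rowP => i; rewrite [RHS]mxE -[i]inord_val.
have e i' j' := h (delta_mx 0 (inord i')) (delta_mx 0 (inord j')).
move: (e 0%N 1%N) (e 2%N 3%N) (e 0%N 2%N) (e 3%N 1%N) (e 0%N 3%N) (e 1%N 2%N).
rewrite !line_form_delta //=.
by case: i => [[|[|[|[|[|[|i]]]]]] hi].
Qed.

Lemma alt_suml (a : V -> V -> F) (alt : alternating a) (c : 'I_4 -> F) (u : 'I_4 -> V) y :
  a (\sum_i c i *: u i) y = \sum_i c i * a (u i) y.
Proof.
by elim/big_rec2: _ => [|i b x _ IH]; [exact: (alt0l alt y) | rewrite (alt_linear alt) IH].
Qed.

Lemma form_eq (a b : V -> V -> F) : alternating a -> alternating b ->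
  (forall i j, (i < j < 4)%N -> a (delta_mx 0 (inord i)) (delta_mx 0 (inord j)) =
     b (delta_mx 0 (inord i)) (delta_mx 0 (inord j))) -> forall x y, a x y = b x y.
Proof.
move=> alta altb h.
have D (i j : 'I_4) : a (delta_mx 0 i) (delta_mx 0 j) = b (delta_mx 0 i) (delta_mx 0 j).
  rewrite -[i]inord_val -[j]inord_val; case: (ltngtP i j) => [lt|lt|E].
  - by apply: h; rewrite lt ltn_ord.
  - by rewrite (alt_anti alta) [RHS](alt_anti altb) h // lt ltn_ord.
  by rewrite E (altxx alta) (altxx altb).
have D1 (i : 'I_4) y : a y (delta_mx 0 i) = b y (delta_mx 0 i).
  by rewrite [y]row_sum_delta (alt_suml alta) (alt_suml altb); apply: eq_bigr => j _; rewrite D.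
move=> x y; rewrite [y]row_sum_delta (alt_anti alta) [RHS](alt_anti altb) (alt_suml alta) (alt_suml altb).
by congr (- _); apply: eq_bigr => j _; rewrite (alt_anti alta) D1 -(alt_anti altb).
Qed.

Lemma form_polar a : alternating a -> exists s, forall x y, a x y = line_form s x y.
Proof.
move=> alt; pose e i := delta_mx 0 (inord i) : V.
exists (\row_(k < 6) nth 0 [:: a (e 2%N) (e 3%N); a (e 0%N) (e 1%N); a (e 3%N) (e 1%N);
   a (e 0%N) (e 2%N); a (e 1%N) (e 2%N); a (e 0%N) (e 3%N)] k).
apply: form_eq => //; first exact: line_form_alt.
move=> i j /andP[ij j4]; rewrite line_form_delta //; last exact: ltn_trans j4.
rewrite !row_nth //=; move: ij j4.
case: i => [|[|[|[|i]]]] //; case: j => [|[|[|[|j]]]] //= _ _.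
by rewrite (alt_anti alt).
Qed.

End Wedge.

(** * Singular vectors are decomposable *)

Section Decomposition.
Variable F : finFieldType.
Notation V := 'rV[F]_4.
Notation T := {vspace V}.
Implicit Types x y z w : V.
Implicit Types s t : 'rV[F]_6.
Local Open Scope ring_scope.

Lemma wedgeDl x y z : wedge (x + y) z = wedge x z + wedge y z.
Proof. by rewrite -[x]scale1r wedge_linear !scale1r. Qed.
Lemma wedgeZl c x z : wedge (c *: x) z = c *: wedge x z.
Proof.
by apply/rowP => i; rewrite !mxE; case: i => [[|[|[|[|[|[|i]]]]]] hi] //=; rewrite /minor !mxE; ring.
Qed.
Lemma wedgeDr x y z : wedge z (x + y) = wedge z x + wedge z y.
Proof. by rewrite wedge_anti wedgeDl opprD -!wedge_anti. Qed.
Lemma wedgeZr c x z : wedge z (c *: x) = c *: wedge z x.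
Proof. by rewrite wedge_anti wedgeZl -scalerN -wedge_anti. Qed.

(* Row i of the alternating matrix with Pluecker coordinates s. *)
Definition plucker_row s (i : nat) : V := \row_(j < 4) nth 0 (nth [::]
  [:: [:: 0; s 0 (inord 0); s 0 (inord 2); s 0 (inord 4)];
      [:: - s 0 (inord 0); 0; s 0 (inord 5); - s 0 (inord 3)];
      [:: - s 0 (inord 2); - s 0 (inord 5); 0; s 0 (inord 1)];
      [:: - s 0 (inord 4); s 0 (inord 3); - s 0 (inord 1); 0]] i) j.

(** For s = wedge x y, row i is x_i y - y_i x, and the wedge of rows i and j is their minor times s.
    Here it is derived from the quadratic relation alone, so any nonzero entry lets [wedge_exists]
    decompose s. *)
Lemma wedge_plucker_row s i j : klein_form s = 0 -> (i < 4)%N -> (j < 4)%N ->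
  wedge (plucker_row s i) (plucker_row s j) = plucker_row s i 0 (inord j) *: s.
Proof.
rewrite /klein_form => k0 hi hj; apply/rowP => c; rewrite -[c]inord_val mxE inordK //.
rewrite [RHS]mxE /minor /plucker_row !row_nth //.
have E : s 0 (inord 0) * s 0 (inord 1) = - (s 0 (inord 2) * s 0 (inord 3) + s 0 (inord 4) * s 0 (inord 5)).
  by apply/eqP; rewrite -addr_eq0 addrA k0.
move: E {k0}; case: c => [[|[|[|[|[|[|c]]]]]] hc] //=; move: hi hj;
  case: i => [|[|[|[|i]]]] // _; case: j => [|[|[|[|j]]]] //= _ E; rewrite ?[in RHS]/=;
  do ?[by ring | by ring: E].
Qed.

Lemma wedge_exists s : klein_form s = 0 -> exists x y, s = wedge x y.
Proof.
move=> k0; have use i j : (i < 4)%N -> (j < 4)%N -> plucker_row s i 0 (inord j) != 0 -> exists x y, s = wedge x y.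
  move=> hi hj ne; exists ((plucker_row s i 0 (inord j))^-1 *: plucker_row s i), (plucker_row s j).
  by rewrite wedgeZl wedge_plucker_row // scalerA mulVf // scale1r.
have [s0|?] := eqVneq (plucker_row s 0 0 (inord 1)) 0; last exact: (use 0%N 1%N).
have [s1|?] := eqVneq (plucker_row s 2 0 (inord 3)) 0; last exact: (use 2%N 3%N).
have [s2|?] := eqVneq (plucker_row s 0 0 (inord 2)) 0; last exact: (use 0%N 2%N).
have [s3|?] := eqVneq (plucker_row s 3 0 (inord 1)) 0; last exact: (use 3%N 1%N).
have [s4|?] := eqVneq (plucker_row s 0 0 (inord 3)) 0; last exact: (use 0%N 3%N).
have [s5|?] := eqVneq (plucker_row s 1 0 (inord 2)) 0; last exact: (use 1%N 2%N).
exists 0, 0; rewrite wedgexx; apply/rowP => i; rewrite mxE -[i]inord_val.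
by move: s0 s1 s2 s3 s4 s5; rewrite /plucker_row !row_nth //=; case: i => [[|[|[|[|[|[|i]]]]]] hi].
Qed.

Lemma wedge_eq0 x y : x != 0 -> wedge x y = 0 -> y \in <[x]>%VS.
Proof.
move=> x0 w0; have m0 i j : (i < 4)%N -> (j < 4)%N -> minor x y i j = 0.
  have e k : (k < 6)%N -> wedge x y 0 (inord k) = 0 by move=> _; rewrite w0 mxE.
  move: (e 0%N isT) (e 1%N isT) (e 2%N isT) (e 3%N isT) (e 4%N isT) (e 5%N isT).
  rewrite /wedge !row_nth //= => h0 h1 h2 h3 h4 h5 hi hj.
  have anti a b : minor x y a b = - minor x y b a by rewrite /minor; ring.
  have diag a : minor x y a a = 0 by rewrite /minor; ring.
  move: hi hj; case: i => [|[|[|[|i]]]] // _; case: j => [|[|[|[|j]]]] // _; rewrite ?diag //;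
    by rewrite anti ?h0 ?h1 ?h2 ?h3 ?h4 ?h5 oppr0.
have [i xi] : exists i, x 0 i != 0.
  apply/existsP; rewrite -negb_forall; apply: contra x0 => /forallP h.
  by apply/eqP/rowP => i; rewrite mxE; apply/eqP/h.
apply/vlineP; exists (y 0 i / x 0 i); apply/rowP => j; rewrite mxE.
have := m0 i j (ltn_ord i) (ltn_ord j); rewrite /minor !inord_val => /eqP; rewrite subr_eq0 => /eqP E.
by rewrite mulrAC [y 0 i * _]mulrC -E mulrAC mulfV // mul1r.
Qed.

Lemma wedge_neq0 x y : wedge x y != 0 -> \dim (<[x]> + <[y]>) = 2%N.
Proof.
move=> w0; have y0 : y != 0 by apply: contraNneq w0 => ->; rewrite -(scale0r 0) wedgeZr scale0r.
have x0 : x != 0 by apply: contraNneq w0 => ->; rewrite -(scale0r 0) wedgeZl scale0r.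
rewrite dim_add1 ?dim_vline ?x0 ?y0 //; apply: contra w0; rewrite -memvE => /vlineP[c ->].
by rewrite wedgeZl wedgexx scaler0.
Qed.

Lemma wedge_indep x y : \dim (<[x]> + <[y]>) = 2%N -> wedge x y != 0.
Proof.
by move=> /span2_free[x0]; apply: contra => /eqP; apply: wedge_eq0.
Qed.

Lemma wedge_span x y u v : u \in (<[x]> + <[y]>)%VS -> v \in (<[x]> + <[y]>)%VS ->
  exists c, wedge u v = c *: wedge x y.
Proof.
move=> /memv_addP[_ /vlineP[a ->] [_ /vlineP[b ->] ->]].
move=> /memv_addP[_ /vlineP[c ->] [_ /vlineP[d ->] ->]].
exists (a * d - b * c); rewrite !(wedgeDl, wedgeDr, wedgeZl, wedgeZr) !wedgexx !scaler0 addr0 add0r.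
by rewrite [wedge y x]wedge_anti !scalerN !scalerA -scalerBl; congr (_ *: _); ring.
Qed.

Lemma line_form_line x y : orth (line_form (wedge x y)) (<[x]> + <[y]>) fullv.
Proof.
have alt := line_form_alt (wedge x y).
rewrite (orthDl alt); apply/andP; split; apply/(orth_line alt) => z _.
  exact: line_form_l.
exact: line_form_r.
Qed.

(** A radical hyperplane together with one further point, which is orthogonal to itself, would make
    the form vanish. *)
Lemma line_form_radical s (U : T) : s != 0 -> orth (line_form s) U fullv -> (\dim U <= 2)%N.
Proof.
move=> s0 o; have alt := line_form_alt s; rewrite leqNgt; apply: contra s0 => dU; apply/eqP.
apply: line_form_eq0 => x y; suff /orthP h : orth (line_form s) fullv fullv by apply: h; apply: memvf.
have [d4|d3] := leqP 4 (\dim U).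
  by rewrite -{1}(vs_eq (subvf U)) ?dim_full.
have [Y dY YU] := exists_point_out d3.
have <- : (Y + U)%VS = fullv by apply: vs_eq; rewrite ?subvf // dim_full dim_add1.
rewrite (orthDl alt) (orthDr alt) (orth_point alt dY) [orth _ Y U](orth_sym alt).
by rewrite !(orth_sub (subvv U) (subvf _) o).
Qed.

End Decomposition.

(** * Lines of the quadric as pencils, and the hyperplane *)

Section Correspondence.
Variable F : finFieldType.
Notation V := 'rV[F]_4.
Notation W := 'rV[F]_6.
Notation T := {vspace V}.
Implicit Types x y z w p r : V.
Implicit Types s t : W.
Implicit Types n m pi : T.
Variable g : 'M[F]_6.
Hypothesis gu : g \in unitmx.

Definition klein x y : W := (wedge x y *m invmx g)%R.

Lemma kleinK x y : (klein x y *m g = wedge x y)%R.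
Proof. by rewrite /klein mulmxKV. Qed.

Lemma klein_inj s t : (s *m g = t *m g)%R -> s = t.
Proof. by move/(congr1 (mulmx^~ (invmx g))); rewrite !mulmxK. Qed.

Lemma klein_eq0 x y : (klein x y == 0)%R = (wedge x y == 0)%R.
Proof. by rewrite -kleinK; apply/eqP/eqP => [->|h]; [rewrite mul0mx | apply: klein_inj; rewrite h mul0mx]. Qed.

Lemma klein_span x y u v : u \in (<[x]> + <[y]>)%VS -> v \in (<[x]> + <[y]>)%VS ->
  klein u v \in <[klein x y]>%VS.
Proof.
move=> ux vx; have [c E] := wedge_span ux vx; apply/vlineP; exists c.
by rewrite /klein E scalemxAl.
Qed.

Definition pencil_map p : V -> W := klein p.
Lemma pencil_map_linear p : linear (pencil_map p).
Proof.
move=> c x y; rewrite /pencil_map /klein wedgeDr wedgeZr mulmxDl scalemxAl //.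
Qed.
HB.instance Definition _ p := GRing.isLinear.Build F V W *:%R (pencil_map p) (pencil_map_linear p).

Definition pencil_line p pi := (linfun (pencil_map p) @: pi)%VS.

Lemma pencil_lineP p (pi : T) s : reflect (exists2 r, r \in pi & s = klein p r) (s \in pencil_line p pi).
Proof.
by apply: (iffP memv_imgP) => -[r rp ->]; exists r => //; rewrite lfunE.
Qed.

Lemma dim_pencil_line p pi : p != 0%R -> p \in pi -> \dim pi = 3 -> \dim (pencil_line p pi) = 2.
Proof.
move=> p0 pp dpi; have := limg_ker_dim (linfun (pencil_map p)) pi; rewrite dpi -/(pencil_line p pi).
have -> : (pi :&: lker (linfun (pencil_map p)) = <[p]>)%VS.
  apply/eqP; rewrite eqEsubv; apply/andP; split; last first.
    rewrite subv_cap -!memvE pp memv_ker lfunE /= /pencil_map klein_eq0 wedgexx eqxx //.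
  apply/subvP => r; rewrite memv_cap => /andP[_]; rewrite memv_ker lfunE /= /pencil_map klein_eq0.
  by move/eqP/(wedge_eq0 p0).
by rewrite dim_vline p0 => -[].
Qed.

Variables (Q B : {set {vspace W}}).
Hypothesis QE : Q = [set P : {vspace W} | (\dim P == 1) &&
   [forall x : W, (x \in P) ==> (klein_form (x *m g) == 0)%R]].
Hypothesis Bblk : line_blocking_set Q B.

(** Quantifying over all pairs avoids choosing a basis of n: a dependent pair gives 0, which lies in
    every P, and all independent pairs give the same point. *)
Definition blocked_lines : {set T} := [set n : T | (\dim n == 2) &&
  [exists P in B, [forall x in n, forall y in n, klein x y \in P]]].

Lemma blocked_dim n : n \in blocked_lines -> \dim n = 2.
Proof. by rewrite inE => /andP[/eqP]. Qed.

Lemma B_point P : P \in B -> exists2 s, s != 0%R & P = <[s]>%VS /\ klein_form (s *m g) = 0%R.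
Proof.
case/andP: Bblk => /subsetP sB _ /sB; rewrite QE inE => /andP[/eqP /dim1E[s s0 PE] /forallP h].
by exists s => //; split=> //; have := h s; rewrite PE memv_line => /eqP.
Qed.

Lemma blocked_linesP n x y : \dim n = 2 -> n = (<[x]> + <[y]>)%VS ->
  (n \in blocked_lines) = (<[klein x y]>%VS \in B).
Proof.
move=> dn nE; have w0 : klein x y != 0%R by rewrite klein_eq0 wedge_indep // -nE.
rewrite inE dn eqxx /=; apply/exists_inP/idP => [[P PB /forall_inP h]|KB]; last first.
  exists <[klein x y]>%VS => //; apply/forall_inP => u un; apply/forall_inP => v vn.
  by apply: klein_span; rewrite -nE.
have [s s0 [PE _]] := B_point PB.
have xn : x \in n by rewrite nE (subvP (addvSl _ _)) // memv_line.
have yn : y \in n by rewrite nE (subvP (addvSr _ _)) // memv_line.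
suff -> : <[klein x y]>%VS = P by [].
apply: vs_eq; last by rewrite PE !dim_vline s0 w0.
by rewrite -memvE; move/forall_inP: (h x xn); apply.
Qed.

(** Both lines lie in the radical of the nonzero form [line_form (wedge x y)], whose dimension is at
    most 2. *)
Lemma line_unique x y u v c : \dim (<[x]> + <[y]>) = 2 -> \dim (<[u]> + <[v]>) = 2 ->
  wedge u v = (c *: wedge x y)%R -> (<[x]> + <[y]> = <[u]> + <[v]>)%VS.
Proof.
move=> dn dm E; have w0 := wedge_indep dn; have alt := line_form_alt (wedge x y).
have c0 : c != 0%R by apply: contraNneq (wedge_indep dm) => c0; rewrite E c0 scale0r.
have o : orth (line_form (wedge x y)) ((<[x]> + <[y]>) + (<[u]> + <[v]>)) fullv.
  rewrite (orthDl alt) line_form_line /=; apply/orthP => a b am _.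
  have /orthP/(_ a b am (memvf b)) := line_form_line u v.
  by rewrite /line_form E polarZl => /eqP; rewrite mulf_eq0 (negPf c0) => /eqP.
have le := line_form_radical w0 o.
have E1 := vs_eq (addvSl (<[x]> + <[y]>) (<[u]> + <[v]>)); rewrite E1 ?dn //.
by apply/esym/vs_eq; rewrite ?addvSr ?dm.
Qed.

Lemma card_blocked_lines : #|blocked_lines| <= #|B|.
Proof.
rewrite -[leqLHS]mul1n -[leqRHS]mul1n.
apply: (double_count (I := fun (n : T) (P : {vspace W}) =>
  [forall x in n, forall y in n, klein x y \in P])) => [n|P PB].
  rewrite inE => /andP[_ /exists_inP[P PB h]]; apply/card_gt0P; exists P.
  by rewrite inE PB.
apply/card_le1_eqP => n m /setIdP[/blocked_dim dn /forall_inP hn] /setIdP[/blocked_dim dm /forall_inP hm].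
have [[x [y nE]] [u [v mE]]] := (line_span dn, line_span dm).
have [s s0 [PE _]] := B_point PB.
have in2 (l : T) a b : l = (<[a]> + <[b]>)%VS -> a \in l /\ b \in l.
  by move=> ->; rewrite (subvP (addvSl _ _)) ?(subvP (addvSr _ _)) ?memv_line.
have [[xn yn] [um vm]] := (in2 _ _ _ nE, in2 _ _ _ mE).
have := forall_inP (hn x xn) y yn; have := forall_inP (hm u um) v vm.
rewrite PE => /vlineP[d Ed] /vlineP[c Ec]; rewrite nE mE; rewrite nE in dn; rewrite mE in dm.
have c0 : c != 0%R.
  by apply: contraTneq (wedge_indep dn) => c0; rewrite -klein_eq0 Ec c0 scale0r eqxx.
have : klein u v = ((d / c) *: klein x y)%R by rewrite Ed Ec scalerA divfK.
rewrite /klein scalemxAl => /(congr1 (mulmx^~ g)); rewrite !mulmxKV // => E.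
by rewrite (line_unique dn dm E).
Qed.

Lemma blocked_flag (P pi : T) : \dim P = 1 -> \dim pi = 3 -> (P <= pi)%VS ->
  exists2 n, n \in blocked_lines & (P <= n)%VS && (n <= pi)%VS.
Proof.
move=> /dim1E[p p0 PE] dpi Ppi; have pp : p \in pi by rewrite memvE -PE.
have lQ : line_contained_in Q (pencil_line p pi).
  rewrite /line_contained_in dim_pencil_line //=; apply/forallP => R; apply/implyP => /andP[dR RL].
  rewrite QE inE dR; apply/forallP => x; apply/implyP => xR.
  by have /pencil_lineP[r _ ->] := subvP RL x xR; rewrite kleinK klein_wedge.
case/andP: Bblk => _ /forallP/(_ (pencil_line p pi)); rewrite lQ => /exists_inP[R RB RL].
have [s s0 [RE _]] := B_point RB.
have /pencil_lineP[r rpi sE] : s \in pencil_line p pi by rewrite memvE -RE.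
have d2 : \dim (<[p]> + <[r]>) = 2 by apply: wedge_neq0; rewrite -klein_eq0 -sE.
exists (<[p]> + <[r]>)%VS; last by rewrite PE addvSl subv_add -!memvE pp.
by rewrite (blocked_linesP d2 erefl) -sE -RE.
Qed.

Lemma singular_in_line L s : line_contained_in Q L -> s \in L -> klein_form (s *m g) = 0%R.
Proof.
move=> /andP[_ /forallP h] sL; have [->|s0] := eqVneq s 0%R.
  by rewrite mul0mx -(scale0r 0%R) kleinZ expr0n mul0r.
have := h <[s]>%VS; rewrite dim_vline s0 -memvE sL /= QE inE => /andP[_ /forallP/(_ s)].
by rewrite memv_line => /eqP.
Qed.

(** Two spanning vectors of L represent lines n1 and n2, and their polar product vanishes because
    their sum is singular too. So n2 is isotropic for the form of n1; if the lines were skew, this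
    form would vanish on the whole space. The pencil has the point of n1 and n2 as its centre and
    their span as its plane. *)
Lemma line_is_pencil L : line_contained_in Q L ->
  exists p (pi : T), [/\ p != 0%R, p \in pi, \dim pi = 3 & pencil_line p pi = L].
Proof.
move=> LQ; have dL : \dim L = 2 by case/andP: LQ => /eqP.
have [s [t LE]] := line_span dL.
have sL : s \in L by rewrite LE (subvP (addvSl _ _)) // memv_line.
have tL : t \in L by rewrite LE (subvP (addvSr _ _)) // memv_line.
have [ks kt] := (singular_in_line LQ sL, singular_in_line LQ tL).
have pol : polar (s *m g) (t *m g) = 0%R.
  by have := singular_in_line LQ (memvD sL tL); rewrite mulmxDl kleinD ks kt !add0r.
have [[x [y sE]] [z [w tE]]] := (wedge_exists ks, wedge_exists kt).
have [s0 ts] : s != 0%R /\ t \notin <[s]>%VS by apply: span2_free; rewrite -LE.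
have t0 : t != 0%R by apply: contraNneq ts => ->; apply: mem0v.
have sK : s = klein x y by apply: klein_inj; rewrite kleinK.
have tK : t = klein z w by apply: klein_inj; rewrite kleinK.
have wxy : wedge x y != 0%R by rewrite -klein_eq0 -sK.
have wzw : wedge z w != 0%R by rewrite -klein_eq0 -tK.
have [d1 d2] := (wedge_neq0 wxy, wedge_neq0 wzw).
set n1 := (<[x]> + <[y]>)%VS in d1; set n2 := (<[z]> + <[w]>)%VS in d2.
have alt := line_form_alt (wedge x y).
have o1 : orth (line_form (wedge x y)) n1 fullv := line_form_line x y.
have o2 : orth (line_form (wedge x y)) n2 n2.
  have ozw : line_form (wedge x y) z w = 0%R by rewrite /line_form -sE -tE.
  rewrite /n2 !(orthDl alt) !(orthDr alt) !(orth_vline alt) ?(altxx alt) //.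
  by rewrite (alt_anti alt) ozw oppr0.
have cap0 : 0 < \dim (n1 :&: n2).
  rewrite lt0n; apply/negP => /eqP c0; have := dimv_sum_cap n1 n2; rewrite c0 d1 d2 addn0 => d4.
  have E : (n1 + n2)%VS = fullv by apply: vs_eq; rewrite ?subvf // dim_full d4.
  suff /(line_form_radical wxy) : orth (line_form (wedge x y)) fullv fullv by rewrite dim_full.
  rewrite -{1}E (orthDl alt) o1 -E (orthDr alt) o2 andbT [orth _ n2 n1](orth_sym alt) /=.
  exact: orth_sub (subvv _) (subvf _) o1.
have n12 : n1 != n2.
  apply: contraNneq ts => E; rewrite tK sK; apply: klein_span.
    by rewrite -/n1 E /n2 (subvP (addvSl _ _)) // memv_line.
  by rewrite -/n1 E /n2 (subvP (addvSr _ _)) // memv_line.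
have [P dP] := exists_point_in cap0; have [p p0 PE] := dim1E dP.
rewrite subv_cap PE -!memvE => /andP[p1 p2].
have [Pn1 Pn2] : (P <= n1)%VS /\ (P <= n2)%VS by rewrite PE -!memvE.
have [d3 _] := lines_sum d1 d2 n12 dP Pn1 Pn2; have p12 : p \in (n1 + n2)%VS by rewrite (subvP (addvSl _ _)).
exists p, (n1 + n2)%VS; split=> //.
apply: vs_eq; last by rewrite dL dim_pencil_line.
apply/subvP => _ /pencil_lineP[_ /memv_addP[u u1 [v v2 ->]] ->].
rewrite /klein wedgeDr mulmxDl LE; apply: memv_add; rewrite -/(klein _ _) ?sK ?tK; exact: klein_span.
Qed.

Definition functional c : W -> F^o := fun s => polar c (s *m g)%R.
Lemma functional_linear c : linear (functional c).
Proof. by move=> k s t; rewrite /functional mulmxDl -scalemxAl polarDr polarZr. Qed.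
HB.instance Definition _ c :=
  GRing.isLinear.Build F W F^o *:%R (functional c) (functional_linear c).

Lemma blocking_hyperplane : 4 <= #|F| -> #|B| <= #|F| ^ 3 + 2 * #|F| ^ 2 + #|F| + 1 ->
  exists2 H : {vspace W}, \dim H = 5 & line_blocking_set Q [set P in B | (P <= H)%VS].
Proof.
move=> q4 Bcard.
have [a [alt [x0 [y0 a0]] iso]] := isotropic_blocking q4 (leq_trans card_blocked_lines Bcard)
  blocked_dim blocked_flag.
have [c cE] := form_polar alt.
pose H := lker (linfun (functional c)).
have HE s : (s \in H) = (polar c (s *m g) == 0)%R by rewrite memv_ker lfunE.
exists H.
  have := limg_ker_dim (linfun (functional c)) fullv; rewrite capfv -/H dimvf /dim /= mul1n.
  have : \dim (limg (linfun (functional c))) = 1.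
    have := dimvS (subvf (limg (linfun (functional c)))); rewrite dimvf /dim /=.
    suff : 0 < \dim (limg (linfun (functional c))) by move: (\dim _); clear; lia.
    rewrite lt0n dimv_eq0; apply: contra a0 => /eqP l0.
    have := memv_img (linfun (functional c)) (memvf (klein x0 y0)); rewrite l0 memv0 lfunE /=.
    by rewrite /functional kleinK cE.
  by move=> ->; rewrite addn1 => -[].
apply/andP; split.
  by case/andP: Bblk => sB _; apply: subset_trans sB; apply/subsetP => P /setIdP[].
apply/forallP => L; apply/implyP => /line_is_pencil[p [pi [p0 pp dpi LE]]].
have dp : \dim <[p]> = 1 by rewrite dim_vline p0.
have [n nB /and3P[pn np on]] := iso <[p]>%VS pi dp dpi pp.
have dn := blocked_dim nB; have [r nE] := line_through dn p0 (pn : p \in n).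
have rn : r \in n by rewrite nE (subvP (addvSr _ _)) // memv_line.
apply/exists_inP; exists <[klein p r]>%VS; last first.
  by rewrite -memvE -LE; apply/pencil_lineP; exists r => //; apply: subvP np _ rn.
apply/setIdP; split; first by rewrite -(blocked_linesP dn nE).
rewrite -memvE HE kleinK; apply/eqP; rewrite -[polar _ _]/(line_form c p r) -cE.
by move/orthP: on; apply.
Qed.

End Correspondence.

Theorem theorem1p4 (F : finFieldType) (q : nat) (hF : #|F| = q) (hq : 4 <= q)
    (Q B : {set {vspace 'rV[F]_6}}) (hQ : is_klein_quadric Q)
    (hB : minset (line_blocking_set Q) B)
    (hcard : #|B| <= q ^ 3 + 2 * q ^ 2 + q + 1) :
  exists2 H : {vspace 'rV[F]_6}, \dim H = 5 &
    B \subset [set P in Q | (P <= H)%VS].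
Proof.
case: hQ => g gu QE; have /minsetP[Bblk minB] := hB; rewrite -hF in hq hcard.
have [H dH blk] := blocking_hyperplane gu QE Bblk hq hcard.
exists H => //; rewrite -(minB _ blk); last by apply/subsetP => P /setIdP[].
apply/subsetP => P /setIdP[PB PH]; apply/setIdP; split=> //.
by case/andP: Bblk => /subsetP sB _; apply: sB.
Qed.
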